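(* Let $X,Y$ be Banach spaces and let $H$ be a Hilbert space. Suppose that for some $\theta\in(0,1)$ we have $X=[H,Y]_\theta$. Then for every $p\in(1,\infty)$, $$\mathfrak P_p(X)\le\frac{2\max\{p,\,p/(p-1)\}}{1-\theta}.$$
   Context: $[\cdot,\cdot]_\theta$ denotes (Calderón's) complex interpolation, as in Bergh–Löfström; $H$ and $Y$ are understood to form a compatible couple, as this method requires. For $n\in\mathbb N$ let $\mu$ be the uniform probability measure on $\{-1,1\}^n$. For $f:\{-1,1\}^n\to X$ and $j\in\{1,\ldots,n\}$, $\partial_jf(\varepsilon)=\frac{f(\varepsilon)-f(\varepsilon_1,\ldots,\varepsilon_{j-1},-\varepsilon_j,\varepsilon_{j+1},\ldots,\varepsilon_n)}{2}$ and $\Delta f=\sum_{j=1}^n\partial_jf$. $\mathfrak P_p^n(X)$ is the infimum over those $\mathfrak P\in(0,\infty)$ such that every $f_1,\ldots,f_n:\{-1,1\}^n\to X$ satisfy $$\Bigg(\int_{\{-1,1\}^n}\Big\|\sum_{j=1}^n\partial_jf_j(\varepsilon)\Big\|^pd\mu(\varepsilon)\Bigg)^{1/p}\le\mathfrak P\Bigg(\int_{\{-1,1\}^n}\int_{\{-1,1\}^n}\Big\|\sum_{j=1}^n\delta_j\Delta f_j(\varepsilon)\Big\|^pd\mu(\varepsilon)d\mu(\delta)\Bigg)^{1/p},$$ and $\mathfrak P_p(X)=\sup_{n\in\mathbb N}\mathfrak P_p^n(X)$. *)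

(* Defs.v *)
From HB Require Import structures.
From mathcomp Require Import all_boot all_order all_algebra.
From mathcomp Require Import all_classical all_reals all_analysis.
From mathcomp.real_closed Require Export complex.

Set Implicit Arguments.
Unset Strict Implicit.
Unset Printing Implicit Defensive.

Import Order.TTheory GRing.Theory Num.Theory.
Import numFieldNormedType.Exports.

Local Open Scope classical_set_scope.
Local Open Scope ring_scope.
Local Open Scope complex_scope.

(* In a normed module over R[i] the norm `|x| is an element of R[i] (with zero
   imaginary part); rnorm is the corresponding real number. *)
Definition rnorm (R : realType) (V : normedModType R[i]) (x : V) : R :=
  complex.Re `|x|.

Section rnorm_theory.
Context (R : realType) (V : normedModType R[i]).
Implicit Types x y : V.

Lemma rnormE x : `|x| = (rnorm x)%:C.
Proof.
rewrite /rnorm; have /ger0_Im : 0 <= `|x| by exact: normr_ge0.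
by case: (`|x|) => a b /= ->.
Qed.

Lemma rnorm_ge0 x : 0 <= rnorm x.
Proof. by rewrite -lecR -rnormE normr_ge0. Qed.

Lemma ler_rnormD x y : rnorm (x + y) <= rnorm x + rnorm y.
Proof. by rewrite -lecR rmorphD /= -!rnormE ler_normD. Qed.

Lemma rnormZ (l : R[i]) x : rnorm (l *: x) = complex.Re `|l| * rnorm x.
Proof.
by rewrite {1}/rnorm normrZ rnormE normc_def /= mulr0 subr0.
Qed.

Lemma rnorm0 : rnorm (0 : V) = 0.
Proof. by rewrite /rnorm normr0. Qed.

Lemma rnorm_nbhs0 (W : topologicalLmodType R[i]) (f : {linear V -> W})
    (Q : set W) : continuous f -> nbhs 0 Q ->
  exists2 e : R, 0 < e & forall x, rnorm x < e -> Q (f x).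
Proof.
move=> cf; rewrite -(raddf0 f) => /cf /nbhs_ballP[e /= e0 He].
have ee : e = (complex.Re e)%:C by case: e e0 {He} => a b /gtr0_real/RIm_real/=[->].
exists (complex.Re e); first by rewrite -ltcR -ee.
move=> x xe; apply: He; rewrite -ball_normE /= sub0r normrN rnormE ee.
by rewrite ltcR.
Qed.

End rnorm_theory.

(* A Banach space is a Hilbert space when its norm comes from an inner product
   (linear in the first variable, conjugate-linear in the second one). *)
Definition is_hilbert (R : realType) (H : completeNormedModType R[i]) : Prop :=
  exists ip : {dot H for Num.conj}, forall x : H, `|x| ^+ 2 = ip x x.

(* Both spaces are continuously embedded in a common Hausdorff topological
   vector space, which is not assumed to be locally convex. *)
Record compatible_couple (R : realType) (A0 A1 : normedModType R[i]) :=
  CompatibleCouple {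
    ambient : topologicalLmodType R[i] ;
    emb0 : {linear A0 -> ambient} ;
    emb1 : {linear A1 -> ambient} ;
    ambient_hausdorff : hausdorff_space ambient ;
    emb0_inj : injective emb0 ;
    emb1_inj : injective emb1 ;
    emb0_continuous : continuous emb0 ;
    emb1_continuous : continuous emb1 }.

Section sum_space.
Context (R : realType) (A0 A1 : normedModType R[i]).
Variable c : compatible_couple A0 A1.

Definition sum_pred : {pred ambient c} :=
  fun u => `[< exists a0 a1, u = emb0 c a0 + emb1 c a1 >].

Lemma sum_pred_closed : submod_closed sum_pred.
Proof.
split=> [|l u v /asboolP[a0 [a1 ->]] /asboolP[b0 [b1 ->]]]; apply/asboolP.
  by exists 0, 0; rewrite !raddf0 addr0.
by exists (l *: a0 + b0), (l *: a1 + b1); rewrite !linearP scalerDr addrACA.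
Qed.

HB.instance Definition _ :=
  GRing.isSubmodClosed.Build R[i] (ambient c) sum_pred sum_pred_closed.

Record sum_space :=
  SumSpace { sum_val : ambient c ; sum_valP : sum_val \in sum_pred }.

HB.instance Definition _ := [isSub for sum_val].
HB.instance Definition _ := [Choice of sum_space by <:].
HB.instance Definition _ := [SubChoice_isSubLmodule of sum_space by <:].

Implicit Types u v : sum_space.

Lemma sum_valD u v : sum_val (u + v) = sum_val u + sum_val v.
Proof. exact: (raddfD (\val : sum_space -> ambient c)). Qed.

Lemma sum_valZ (l : R[i]) u : sum_val (l *: u) = l *: sum_val u.
Proof. exact: (linearZ_LR (\val : sum_space -> ambient c)). Qed.

Lemma sum_val0 : sum_val 0 = 0.
Proof. exact: (raddf0 (\val : sum_space -> ambient c)). Qed.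

Definition decomposition_norms u : set R :=
  [set r | exists a0 a1,
     sum_val u = emb0 c a0 + emb1 c a1 /\ r = rnorm a0 + rnorm a1].

Definition sum_norm u : R := inf (decomposition_norms u).

Lemma decomposition_norms_neq0 u : decomposition_norms u !=set0.
Proof.
have /asboolP[a0 [a1 ua]] := sum_valP u.
by exists (rnorm a0 + rnorm a1), a0, a1.
Qed.

Lemma decomposition_norms_lb u : lbound (decomposition_norms u) 0.
Proof. by move=> _ [a0 [a1 [_ ->]]]; rewrite addr_ge0 ?rnorm_ge0. Qed.

Lemma decomposition_norms_has_inf u : has_inf (decomposition_norms u).
Proof.
by split; [exact: decomposition_norms_neq0|exists 0; exact: decomposition_norms_lb].
Qed.

Lemma sum_norm_ge0 u : 0 <= sum_norm u.
Proof.
by apply: lb_le_inf; [exact: decomposition_norms_neq0|exact: decomposition_norms_lb].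
Qed.

Lemma sum_norm_le u a0 a1 :
  sum_val u = emb0 c a0 + emb1 c a1 -> sum_norm u <= rnorm a0 + rnorm a1.
Proof.
by move=> ua; apply: (inf_lbound (decomposition_norms_has_inf u).2); exists a0, a1.
Qed.

Lemma sum_norm_approx u (e : R) : 0 < e -> exists a0 a1,
  sum_val u = emb0 c a0 + emb1 c a1 /\ rnorm a0 + rnorm a1 < sum_norm u + e.
Proof.
move=> e0; have [_ [a0 [a1 [ua ->]]] lt_e] :=
  inf_adherent e0 (decomposition_norms_has_inf u).
by exists a0, a1.
Qed.

Lemma ler_sum_normD u v : sum_norm (u + v) <= sum_norm u + sum_norm v.
Proof.
apply/ler_addgt0Pr => e e0; have e20 : 0 < e / 2 by rewrite divr_gt0.
have [a0 [a1 [ua lta]]] := sum_norm_approx u e20.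
have [b0 [b1 [vb ltb]]] := sum_norm_approx v e20.
have uvab : sum_val (u + v) = emb0 c (a0 + b0) + emb1 c (a1 + b1).
  by rewrite sum_valD ua vb !raddfD addrACA.
apply: (le_trans (sum_norm_le uvab)).
apply: (le_trans (lerD (ler_rnormD _ _) (ler_rnormD _ _))).
rewrite addrACA (le_trans (ltW (ltrD lta ltb)))//.
by rewrite addrACA -splitr.
Qed.

Lemma sum_normZ_le (l : R[i]) u : sum_norm (l *: u) <= complex.Re `|l| * sum_norm u.
Proof.
have l0 : 0 <= complex.Re `|l| by rewrite normc_def /= sqrtr_ge0.
apply/ler_addgt0Pr => e e0.
have e'0 : 0 < e / (1 + complex.Re `|l|) by rewrite divr_gt0// ltr_pwDl.
have [a0 [a1 [ua lta]]] := sum_norm_approx u e'0.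
have lua : sum_val (l *: u) = emb0 c (l *: a0) + emb1 c (l *: a1).
  by rewrite sum_valZ ua scalerDr !linearZ_LR.
apply: (le_trans (sum_norm_le lua)); rewrite !rnormZ -mulrDr.
apply: (le_trans (ler_wpM2l l0 (ltW lta))); rewrite mulrDr lerD2l.
rewrite mulrCA ler_piMr ?(ltW e0)// ler_pdivrMr ?ltr_pwDl// mul1r.
by rewrite lerDr.
Qed.

Lemma sum_norm_eq0 u : sum_norm u = 0 -> u = 0.
Proof.
move=> u0; apply: val_inj; change (sum_val u = sum_val 0); rewrite sum_val0.
apply: ambient_hausdorff => P Q Pu Q0.
suff [a0 [a1 [ua Qa]]] : exists a0 a1, sum_val u = emb0 c a0 + emb1 c a1 /\
    Q (emb0 c a0 + emb1 c a1).
  by exists (sum_val u); split; [exact: nbhs_singleton|rewrite ua].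
have /(_ Q)[|[Q1 Q2] /= [Q10 Q20] Q12] := @add_continuous (ambient c) (0, 0).
  by rewrite /= addr0.
have [e0 e00 He0] := rnorm_nbhs0 (@emb0_continuous _ _ _ c) Q10.
have [e1 e10 He1] := rnorm_nbhs0 (@emb1_continuous _ _ _ c) Q20.
have e_gt0 : 0 < Num.min e0 e1 by rewrite lt_min e00.
have [a0 [a1 [ua]]] := sum_norm_approx u e_gt0.
rewrite u0 add0r lt_min => /andP[lt0 lt1]; exists a0, a1; split => //.
apply: (Q12 (emb0 c a0, emb1 c a1)); split => /=.
  by apply: He0; apply: le_lt_trans lt0; rewrite lerDl rnorm_ge0.
by apply: He1; apply: le_lt_trans lt1; rewrite lerDr rnorm_ge0.
Qed.

Lemma sum_normZ (l : R[i]) u :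
  (sum_norm (l *: u))%:C = `|l| * (sum_norm u)%:C.
Proof.
set nl := complex.Re `|l|.
have El : `|l| = nl%:C by rewrite /nl normc_def.
rewrite El -rmorphM; congr (_%:C); apply/le_anti.
rewrite [X in X && _]sum_normZ_le andTb.
have [l0|l0] := eqVneq l 0; first by rewrite /nl l0 normr0 mul0r sum_norm_ge0.
have nl0 : 0 < nl by rewrite -ltcR -El normr_gt0.
have Elv : complex.Re `|l^-1| = nl^-1 by rewrite normfV El -fmorphV.
have := sum_normZ_le l^-1 (l *: u); rewrite scalerA mulVf// scale1r Elv => h.
by rewrite -ler_pdivlMl.
Qed.

Lemma ler_sum_normCD u v :
  (sum_norm (u + v))%:C <= (sum_norm u)%:C + (sum_norm v)%:C.
Proof. by rewrite -rmorphD lecR ler_sum_normD. Qed.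

Lemma sum_normC_eq0 u : (sum_norm u)%:C = 0 -> u = 0.
Proof. by move=> /complexI; exact: sum_norm_eq0. Qed.

HB.instance Definition _ :=
  Lmodule_isNormed.Build R[i] sum_space ler_sum_normCD sum_normZ sum_normC_eq0.

Lemma rnorm_sum_space u : rnorm u = sum_norm u.
Proof. by []. Qed.

End sum_space.

Section complex_interpolation.
Context (R : realType) (A0 A1 : normedModType R[i]).
Variable c : compatible_couple A0 A1.

(* R[i]^o is R[i] as a normed space over itself, so that derivable _ _ 1 is
   complex differentiability. *)
Definition strip : set R[i]^o := [set z | 0 <= complex.Re z <= 1].
Definition open_strip : set R[i]^o := [set z | 0 < complex.Re z < 1].

(* The functions of Bergh-Loefstrom, section 4.1. Values of calderon_fun outside
   the closed strip are irrelevant; bdry0 and bdry1 are the two boundary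
   functions t |-> f (i t) and t |-> f (1 + i t), seen as valued in A0, A1. *)
Record calderon_space := CalderonSpace {
  calderon_fun :> R[i]^o -> sum_space c ;
  bdry0 : R -> A0 ;
  bdry1 : R -> A1 ;
  calderon_continuous : {within strip, continuous calderon_fun} ;
  calderon_bounded :
    exists M : R, forall z, strip z -> rnorm (calderon_fun z) <= M ;
  calderon_holomorphic : forall z, open_strip z -> derivable calderon_fun z 1 ;
  bdry0E : forall t : R, sum_val (calderon_fun (0 +i* t)) = emb0 c (bdry0 t) ;
  bdry1E : forall t : R, sum_val (calderon_fun (1 +i* t)) = emb1 c (bdry1 t) ;
  bdry0_continuous : continuous bdry0 ;
  bdry1_continuous : continuous bdry1 ;
  bdry0_cvg0 : bdry0 t @[t --> +oo] --> 0 /\ bdry0 t @[t --> -oo] --> 0 ;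
  bdry1_cvg0 : bdry1 t @[t --> +oo] --> 0 /\ bdry1 t @[t --> -oo] --> 0 }.

(* Both suprema are finite, by the continuity of the boundary functions and
   their decay at infinity. *)
Definition calderon_norm (f : calderon_space) : R :=
  Num.max (sup [set rnorm (bdry0 f t) | t in [set: R]])
          (sup [set rnorm (bdry1 f t) | t in [set: R]]).

Definition interp_space (theta : R) : set (sum_space c) :=
  [set a | exists f : calderon_space, f theta%:C = a].

Definition interp_norm (theta : R) (a : sum_space c) : R :=
  inf [set calderon_norm f | f in [set f : calderon_space | f theta%:C = a]].

(* X = [A0, A1]_theta with equality of norms; X is identified with a subspace
   of A0 + A1 by iota. *)
Definition is_interpolation (theta : R) (X : normedModType R[i]) : Prop :=
  exists iota : {linear X -> sum_space c},
    [/\ injective iota,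
        range iota = interp_space theta &
        forall x, rnorm x = interp_norm theta (iota x)].

End complex_interpolation.

(* The cube {-1,1}^n; the boolean b encodes the sign (-1) ^+ b. *)
Definition cube (n : nat) := {ffun 'I_n -> bool}.

Definition flip (n : nat) (j : 'I_n) (e : cube n) : cube n :=
  [ffun k => if k == j then ~~ e k else e k].

(* The integral against the uniform probability measure on the cube. *)
Definition cube_mean (R : realType) (n : nat) (F : cube n -> R) : R :=
  (2 ^+ n)^-1 * \sum_(e : cube n) F e.

Section pisier.
Context (R : realType) (X : normedModType R[i]) (n : nat).

Definition cube_partial (j : 'I_n) (f : cube n -> X) (e : cube n) : X :=
  2^-1 *: (f e - f (flip j e)).

Definition cube_laplacian (f : cube n -> X) (e : cube n) : X :=
  \sum_(j < n) cube_partial j f e.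

Definition pisier_ineq (p P : R) : Prop :=
  forall f : 'I_n -> cube n -> X,
    cube_mean (fun e => rnorm (\sum_(j < n) cube_partial j (f j) e) `^ p) `^ p^-1
    <= P * cube_mean (fun e => cube_mean (fun d : cube n =>
         rnorm (\sum_(j < n) (-1) ^+ d j *: cube_laplacian (f j) e) `^ p)) `^ p^-1.

Definition pisier_const_dim (p : R) : \bar R :=
  ereal_inf [set P%:E | P in [set P : R | 0 < P /\ pisier_ineq p P]].

End pisier.

Definition pisier_const (R : realType) (X : normedModType R[i]) (p : R) : \bar R :=
  ereal_sup [set pisier_const_dim X n p | n in [set n : nat | (0 < n)%N]].

(* Main.v *)
(** Write [Sum_j partial_j f_j] as the integral over [0 < s < 1] of
    [s^-1 E[k_s(e, .) x]], where [x (z, d) = Sum_j d_j Delta f_j z] and [k_s] is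
    the part, odd in [d], of the Riesz product
    [prod_k (1 + (1 - s) e_k z_k + s e_k z_k d_k)]; averaging against [k_s] is a
    contraction of [L_p(V)] for every normed space [V].  Embed this integral in
    the analytic family [T_w] with weight [s^(w - 2)], so that [T_1] is the
    operator to be bounded.  If [Re w = 1 + a] with [a > 0], then [T_w] has norm
    at most [max(1, 1/a)] on every [L_p(V)].  On a Hilbert space orthogonality of
    the Walsh functions bounds [T_w] on [L_2] as soon as [Re w >= 1/2], and
    interpolating with the previous estimate on [L_1] or [L_oo] yields the bound
    [2 m] on [L_p(H)], [m = max(p, p')], for [Re w = 1 - 1/(2 m)].
    Interpolation between [L_p(H)] on that line and [L_p(Y)] on the line
    [Re w = 1 + (1 - theta)/(2 m theta)] gives the theorem, both bounds being at
    most [2 m / (1 - theta)].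

    The integrals over [s] are replaced by Riemann sums with [N] nodes, so that
    every analytic function in play is a finite combination of exponentials;
    [N] tends to infinity at the very end.  That interpolating the spaces
    commutes with taking [L_p] norms is proved with outer functions on the strip,
    which are built from a discretized Poisson kernel of the disc.  The maximum
    principle is only needed for twice complex differentiable functions, where it
    follows from the second derivative test. *)
Require Import Defs.
From mathcomp Require Import all_boot all_order all_algebra.
From mathcomp Require Import all_classical all_reals all_analysis.
From mathcomp Require Import ring lra.
Import Order.TTheory GRing.Theory Num.Theory.
Import numFieldNormedType.Exports.

Set Implicit Arguments.
Unset Strict Implicit.
Unset Printing Implicit Defensive.

Local Open Scope classical_set_scope.
Local Open Scope ring_scope.
Local Open Scope complex_scope.

(** * Complex moduli and complex derivatives *)

(** At [w = 1] the weight [s^-1] is not integrable, so the contraction property of the kernels alone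
    gives no bound on [T_1]; the Hilbert endpoint supplies the missing power of [s]. The estimates
    are proved for arbitrary functions of [(z, d)], although only those linear in [d] occur in the
    inequality: interpolating between spaces of functions linear in [d] would call for a projection
    onto them, and for general [Y] this is not bounded on [L_p(Y)] uniformly in [n]. Hence Walsh
    functions of every odd degree in [d] enter the L_2 estimate. Taking the odd part removes the
    constant one, whose coefficient does not vanish at [s = 0]. Origin of [1/(2m)]: over [H], the
    line [Re w = 1/2 + 1/(2m)] carries the L_2 bound 4 and the line [Re w = 1 + 1/(2m)] the L_1 or
    L_oo bound [2m]; L_p sits at the point [1 - 2/m] between them, where [Re w = 1 - 1/(2m)]. *)

Section complex_modulus.
Context (R : realType).
Implicit Types z w : R[i].

Definition cabs z : R := complex.Re `|z|.

Lemma cabsE z : `|z| = (cabs z)%:C.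
Proof. by rewrite /cabs normc_def. Qed.

Lemma cabs_def z : cabs z = Num.sqrt (complex.Re z ^+ 2 + complex.Im z ^+ 2).
Proof. by rewrite /cabs normc_def. Qed.

Lemma cabs_ge0 z : 0 <= cabs z.
Proof. by rewrite cabs_def sqrtr_ge0. Qed.

Lemma sqr_cabs z : cabs z ^+ 2 = complex.Re z ^+ 2 + complex.Im z ^+ 2.
Proof. by rewrite cabs_def sqr_sqrtr// addr_ge0 ?sqr_ge0. Qed.

Lemma cabsM z w : cabs (z * w) = cabs z * cabs w.
Proof. by apply: (@complexI R); rewrite rmorphM /= -!cabsE normrM. Qed.

Lemma cabsD z w : cabs (z + w) <= cabs z + cabs w.
Proof. by rewrite -lecR rmorphD /= -!cabsE ler_normD. Qed.

Lemma cabsN z : cabs (- z) = cabs z.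
Proof. by rewrite /cabs normrN. Qed.

Lemma cabs_real (x : R) : cabs x%:C = `|x|.
Proof. by rewrite cabs_def /= expr0n addr0 sqrtr_sqr. Qed.

Lemma cabs0 : cabs 0 = 0.
Proof. by rewrite /cabs normr0. Qed.

Lemma cabs1 : cabs 1 = 1.
Proof. by rewrite /cabs normr1. Qed.

Lemma cabs_eq0 z : (cabs z == 0) = (z == 0).
Proof. by rewrite -(inj_eq (@complexI R)) -cabsE normr_eq0. Qed.

Lemma cabs_gt0 z : (0 < cabs z) = (z != 0).
Proof. by rewrite lt_def cabs_ge0 andbT cabs_eq0. Qed.

Lemma cabsV z : cabs z^-1 = (cabs z)^-1.
Proof. by apply: (@complexI R); rewrite fmorphV /= -!cabsE normfV. Qed.

Lemma normr_Re_le z : `|complex.Re z| <= cabs z.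
Proof. by rewrite -lecR -cabsE normc_ge_Re. Qed.

Lemma Re_le z : complex.Re z <= cabs z.
Proof. exact: le_trans (ler_norm _) (normr_Re_le z). Qed.

Lemma cabs_le_Re_Im z : cabs z <= `|complex.Re z| + `|complex.Im z|.
Proof.
rewrite -ler_sqr ?nnegrE ?cabs_ge0 ?addr_ge0// sqr_cabs sqrrD !real_normK ?num_real//.
by rewrite addrAC lerDl mulrn_wge0// mulr_ge0.
Qed.

Lemma normr_Im_le z : `|complex.Im z| <= cabs z.
Proof.
by rewrite -ler_sqr ?nnegrE ?cabs_ge0// sqr_cabs real_normK ?num_real// lerDr sqr_ge0.
Qed.

Lemma cabs_sum (I : Type) (r : seq I) (P : pred I) (F : I -> R[i]) :
  cabs (\sum_(i <- r | P i) F i) <= \sum_(i <- r | P i) cabs (F i).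
Proof.
elim/big_rec2 : _ => [|i y x _ h]; first by rewrite cabs0.
by rewrite (le_trans (cabsD _ _))// lerD2l.
Qed.

Lemma ReD z w : complex.Re (z + w) = complex.Re z + complex.Re w.
Proof. by case: z w => [a b] [c d]. Qed.

Lemma ReB z w : complex.Re (z - w) = complex.Re z - complex.Re w.
Proof. by case: z w => [a b] [c d]. Qed.

Lemma Re_sum (I : Type) (r : seq I) (P : pred I) (F : I -> R[i]) :
  complex.Re (\sum_(i <- r | P i) F i) = \sum_(i <- r | P i) complex.Re (F i).
Proof. by apply: (big_morph _ ReD). Qed.

Lemma Re_realM (x : R) z : complex.Re (x%:C * z) = x * complex.Re z.
Proof. by case: z => a b /=; rewrite mul0r subr0. Qed.

End complex_modulus.

Section rnorm_extra.
Context (R : realType) (V : normedModType R[i]).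
Implicit Types x y : V.

Lemma rnormZc (l : R[i]) x : rnorm (l *: x) = cabs l * rnorm x.
Proof. exact: rnormZ. Qed.

Lemma rnormN x : rnorm (- x) = rnorm x.
Proof. by rewrite /rnorm normrN. Qed.

Lemma rnormBC x y : rnorm (x - y) = rnorm (y - x).
Proof. by rewrite -rnormN opprB. Qed.

Lemma rnorm_eq0 x : (rnorm x == 0) = (x == 0).
Proof. by rewrite -(inj_eq (@complexI R)) -rnormE normr_eq0. Qed.

Lemma ler_rnorm_sum (I : Type) (r : seq I) (P : pred I) (F : I -> V) :
  rnorm (\sum_(i <- r | P i) F i) <= \sum_(i <- r | P i) rnorm (F i).
Proof.
elim/big_rec2 : _ => [|i y x _ h]; first by rewrite rnorm0.
by rewrite (le_trans (ler_rnormD _ _))// lerD2l.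
Qed.

Lemma ler_dist_rnorm x y : `|rnorm x - rnorm y| <= rnorm (x - y).
Proof.
have h a b : rnorm a - rnorm b <= rnorm (a - b).
  by rewrite lerBlDr -{1}[a](subrK b) ler_rnormD.
by rewrite ler_norml h andbT lerNl opprB rnormBC h.
Qed.

Lemma rnorm_cvgP (T : Type) (F : set_system T) (FF : Filter F) (f : T -> V) l :
  f @ F --> l <-> forall e : R, 0 < e -> \forall t \near F, rnorm (f t - l) < e.
Proof.
split => [/cvgrPdist_lt fl e e0|fl].
  have /fl : (0 : R[i]) < e%:C by rewrite ltcR.
  by apply: filterS => t; rewrite rnormE ltcR rnormBC.
apply/cvgrPdist_lt => e e0.
have ee : e = (complex.Re e)%:C by case: e e0 => a b /gtr0_real/RIm_real/=[->].
have /fl : 0 < complex.Re e by rewrite -ltcR -ee.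
by apply: filterS => t; rewrite ee rnormE ltcR rnormBC.
Qed.

End rnorm_extra.

Lemma nbhs_cabsP (R : realType) (z : R[i]^o) (P : set R[i]^o) :
  nbhs z P <-> exists2 d : R, 0 < d & forall w, cabs (w - z) < d -> P w.
Proof.
split => [/nbhs_ballP[e /= e0 eP]|[d d0 dP]].
  have ee : e = (complex.Re e)%:C by case: e e0 {eP} => a b /gtr0_real/RIm_real/=[->].
  exists (complex.Re e); first by rewrite -ltcR -ee.
  move=> w we; apply: eP; rewrite -ball_normE /= distrC cabsE ee.
  by rewrite ltcR.
apply/nbhs_ballP; exists d%:C => /=; first by rewrite ltcR.
by move=> w; rewrite -ball_normE /= distrC cabsE ltcR; exact: dP.
Qed.

Section cderivative.
Context (R : realType) (V : normedModType R[i]).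
Implicit Types (F G : R[i] -> V) (z : R[i]) (D E : V).

(** A first-order expansion with a non-strict remainder, so that [h = 0] is allowed and no quotient
    appears; the next two lemmas exchange it for [derivable]. *)
Definition is_cderive F z D := forall e : R, 0 < e -> exists2 d : R, 0 < d &
  forall h, cabs h < d -> rnorm (F (z + h) - F z - h *: D) <= e * cabs h.

Lemma is_cderive_derivable (F : R[i]^o -> V) z D : is_cderive F z D -> derivable F z 1.
Proof.
move=> FD; apply/cvg_ex; exists D; apply/rnorm_cvgP => e e0.
have /FD[d d0 dF] : 0 < e / 2 by rewrite divr_gt0.
rewrite near_withinE; apply/nbhs_cabsP; exists d => // h; rewrite subr0 => hd h0 /=.
have h0' : 0 < cabs h by rewrite cabs_gt0.
have := dF _ hd; rewrite -ler_pdivrMr// => dh; apply: (@le_lt_trans _ _ (e / 2));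
  last first.
  by rewrite ltr_pdivrMr// ltr_pMr// ltr1n.
apply: le_trans dh; rewrite mulrC -cabsV -rnormZc [in leRHS]scalerBr scalerA mulVf//.
by rewrite scale1r [h *: 1]mulr1 [h + z]addrC.
Qed.

Lemma derivable_is_cderive (F : R[i]^o -> V) z : derivable F z 1 -> exists D,
  is_cderive F z D.
Proof.
move=> /cvg_ex[D FD]; exists D => e e0; move/rnorm_cvgP/(_ e e0) : FD.
rewrite near_withinE => /nbhs_cabsP[d d0 dF]; exists d => // h hd.
have [->|h0] := eqVneq h 0.
  by rewrite addr0 subrr scale0r subrr rnorm0 cabs0 mulr0.
have h0' : 0 < cabs h by rewrite cabs_gt0.
have /= := dF h; rewrite subr0 => /(_ hd h0) /ltW.
rewrite -ler_pdivrMr// => dh; apply: le_trans dh.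
rewrite mulrC -cabsV -rnormZc [in leLHS]scalerBr scalerA mulVf//.
by rewrite scale1r [h *: 1]mulr1 [h + z]addrC.
Qed.

Lemma is_cderive_cst (v : V) z : is_cderive (fun=> v) z 0.
Proof.
move=> e e0; exists 1 => // h _.
by rewrite subrr scaler0 subrr rnorm0 mulr_ge0 ?cabs_ge0// ltW.
Qed.

Lemma is_cderiveD F G z D E : is_cderive F z D -> is_cderive G z E ->
  is_cderive (fun w => F w + G w) z (D + E).
Proof.
move=> FD GE e e0; have e20 : 0 < e / 2 by rewrite divr_gt0.
have [d1 d10 h1] := FD _ e20; have [d2 d20 h2] := GE _ e20.
exists (Num.min d1 d2); first by rewrite lt_min d10.
move=> h; rewrite lt_min => /andP[/h1 {}h1 /h2 {}h2].
rewrite (_ : _ - _ = (F (z + h) - F z - h *: D) + (G (z + h) - G z - h *: E)).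
  rewrite (le_trans (ler_rnormD _ _))// (le_trans (lerD h1 h2))//.
  by rewrite -mulrDl -splitr.
by rewrite scalerDr !opprD [RHS]addrACA; congr (_ + _); rewrite addrACA.
Qed.

Lemma is_cderive_lip F z D : is_cderive F z D -> exists2 d : R, 0 < d &
  forall h, cabs h < d -> rnorm (F (z + h) - F z) <= (1 + rnorm D) * cabs h.
Proof.
move=> /(_ 1 ltr01)[d d0 dF]; exists d => // h /dF {}dF.
rewrite -[_ - F z](subrK (h *: D)) (le_trans (ler_rnormD _ _))//.
by rewrite rnormZc mulrDl lerD// mulrC.
Qed.

Lemma is_cderive_continuous F z D : is_cderive F z D ->
  forall e : R, 0 < e -> exists2 d : R, 0 < d &
    forall h, cabs h < d -> rnorm (F (z + h) - F z) < e.
Proof.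
move=> /is_cderive_lip[d d0 dF] e e0.
have p : 0 < 1 + rnorm D by rewrite ltr_pwDl// rnorm_ge0.
exists (Num.min d (e / (1 + rnorm D))); first by rewrite lt_min d0 divr_gt0.
move=> h; rewrite lt_min => /andP[/dF hd]; rewrite ltr_pdivlMr// mulrC.
exact: le_lt_trans.
Qed.

End cderivative.

Section cderivative_rules.
Context (R : realType) (V : normedModType R[i]).

Notation scal := (R[i]^o).

Lemma is_cderive_scale (f : R[i] -> scal) (F : R[i] -> V) z (d : scal) D :
  is_cderive f z d -> is_cderive F z D ->
  is_cderive (fun w => f w *: F w) z (f z *: D + d *: F z).
Proof.
move=> fd FD e e0.
(* The remainder splits into the product of the two increments, [f z] times the remainder of [F],
   and the remainder of [f] times [F z]; [K] adds up the three factors. *)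
pose K := 1 + (cabs (f z) + rnorm (F z) + (1 + rnorm d) * (1 + rnorm D)).
have K1 : 0 < 1 + rnorm d by rewrite ltr_pwDl// rnorm_ge0.
have K2 : 0 < 1 + rnorm D by rewrite ltr_pwDl// rnorm_ge0.
have K0 : 0 < K.
  by rewrite ltr_pwDl// !addr_ge0 ?cabs_ge0 ?rnorm_ge0// mulr_ge0// ltW.
pose e' := e / K; have e'0 : 0 < e' by rewrite divr_gt0.
have [d1 d10 h1] := fd _ e'0; have [d2 d20 h2] := FD _ e'0.
have [d3 d30 h3] := is_cderive_lip fd; have [d4 d40 h4] := is_cderive_lip FD.
exists (Num.min (Num.min d1 d2) (Num.min (Num.min d3 d4) e')).
  by rewrite !lt_min d10 d20 d30 d40.
move=> h; rewrite !lt_min => /andP[/andP[/h1 {}h1 /h2 {}h2] /andP[/andP[/h3 {}h3 /h4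
  {}h4] he]].
rewrite (_ : _ - _ = (f (z + h) - f z) *: (F (z + h) - F z) +
   (f z *: (F (z + h) - F z - h *: D) + (f (z + h) - f z - h *: d) *: F z)); last first.
  rewrite -{1}[f (z + h)](addrNK (f z)) -{1}[F (z + h)](addrNK (F z)).
  move: (f (z + h) - f z) (F (z + h) - F z) => a b.
  rewrite [h *: d](_ : _ = h * d)// [a + _]addrC [b + _]addrC.
  rewrite !scalerDl !scalerDr !scalerN !scaleNr !scalerA [h * f z]mulrC.
  move: (_ *: F z) (f z *: b) (a *: F z) (a *: b) (_ *: D) (_ *: F z) => p q r s k l.
  move: ((h * d) *: _) => m.
  by rewrite addrA addrK opprD [in RHS]addrACA [in RHS](addrC (_ - _)) [q + l]addrC
    !addrA.
have -> : e = e' * K by rewrite divfK// gt_eqF.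
apply: (@le_trans _ _ (e' * cabs h * ((1 + rnorm d) * (1 + rnorm D)) + (cabs (f z) *
  (e' * cabs h) + e' * cabs h * rnorm (F z)))); last first.
  rewrite /K; have := cabs_ge0 h; have := cabs_ge0 (f z) => ? ?.
  have : 0 <= e' * cabs h by rewrite mulr_ge0// ltW.
  nra.
rewrite (le_trans (ler_rnormD _ _))// lerD//.
  rewrite rnormZc (@le_trans _ _ ((1 + rnorm d) * cabs h * ((1 + rnorm D) * cabs h)))//.
    by rewrite ler_pM// ?cabs_ge0 ?rnorm_ge0.
  rewrite mulrACA mulrC ler_wpM2r ?mulr_ge0 ?(ltW K1) ?(ltW K2)//.
  by rewrite ler_wpM2r ?cabs_ge0 ?(ltW he).
rewrite (le_trans (ler_rnormD _ _))// lerD// rnormZc.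
  by rewrite ler_wpM2l// cabs_ge0.
by rewrite ler_wpM2r// rnorm_ge0.
Qed.

Lemma is_cderive_comp (G : R[i] -> V) (f : R[i] -> scal) z (d : scal) D :
  is_cderive f z d -> is_cderive G (f z) D -> is_cderive (fun w => G (f w)) z (d *: D).
Proof.
move=> fd GD e e0.
have [d3 d30 h3] := is_cderive_lip fd.
have K1 : 0 < 1 + rnorm d by rewrite ltr_pwDl// rnorm_ge0.
have K2 : 0 < 1 + rnorm D by rewrite ltr_pwDl// rnorm_ge0.
have e20 : 0 < e / 2 by rewrite divr_gt0.
have [d1 d10 h1] : exists2 d1 : R, 0 < d1 & forall k, cabs k < d1 ->
    rnorm (G (f z + k) - G (f z) - k *: D) <= (e / 2 / (1 + rnorm d)) * cabs k.
  by apply: GD; rewrite divr_gt0.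
have [d2 d20 h2] : exists2 d2 : R, 0 < d2 & forall h, cabs h < d2 ->
    rnorm (f (z + h) - f z - h *: d) <= (e / 2 / (1 + rnorm D)) * cabs h.
  by apply: fd; rewrite divr_gt0.
exists (Num.min (Num.min d2 d3) (d1 / (1 + rnorm d))).
  by rewrite !lt_min d20 d30 divr_gt0.
move=> h; rewrite !lt_min => /andP[/andP[/h2 {}h2 /h3 {}h3]].
rewrite ltr_pdivlMr// mulrC => hd.
have /h1 := le_lt_trans h3 hd; rewrite [f z + _]addrC subrK => {}h1.
rewrite (_ : _ - _ = (G (f (z + h)) - G (f z) - (f (z + h) - f z) *: D) +
    (f (z + h) - f z - h *: d) *: D); last first.
  rewrite scalerA -[X in _ = _ + X]/((f (z + h) - f z - h * d) *: D).
  by move: (f (z + h) - f z) => k; rewrite scalerBl addrA subrK.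
rewrite (le_trans (ler_rnormD _ _))// (splitr e) mulrDl lerD//.
  rewrite (le_trans h1)// mulrAC -mulrA ler_wpM2l ?(ltW e20)//.
  by rewrite ler_pdivrMr// mulrC.
rewrite rnormZc (@le_trans _ _ (e / 2 / (1 + rnorm D) * cabs h * rnorm D))//.
  by rewrite ler_wpM2r// rnorm_ge0.
rewrite mulrAC ler_wpM2r ?cabs_ge0// mulrAC ler_pdivrMr//.
by rewrite ler_wpM2l ?(ltW e20)// lerDr.
Qed.

End cderivative_rules.

Section scalar_cderivative.
Context (R : realType).
Notation scal := (R[i]^o).
Implicit Types (f g : R[i] -> scal) (z : R[i]).

Lemma is_cderive_id z : is_cderive (fun w => w : scal) z 1.
Proof.
move=> e e0; exists 1 => // h _.
rewrite -[rnorm _]/(cabs (z + h - z - h * 1)) mulr1 [z + h]addrC addrK subrr cabs0.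
by rewrite mulr_ge0 ?cabs_ge0// ltW.
Qed.

Lemma is_cderiveM f g z (d e : scal) : is_cderive f z d -> is_cderive g z e ->
  is_cderive (fun w => f w * g w : scal) z (f z * e + d * g z).
Proof. exact: is_cderive_scale. Qed.

Lemma is_cderive_inv z : z != 0 -> is_cderive (fun w => w^-1 : scal) z (- z ^- 2).
Proof.
move=> z0 e e0; have z0' : 0 < cabs z by rewrite cabs_gt0.
pose C := 2 / cabs z ^+ 3; have C0 : 0 < C by apply: divr_gt0; rewrite ?exprn_gt0.
exists (Num.min (cabs z / 2) (e / C));
  first by rewrite lt_min (divr_gt0 z0')//= (divr_gt0 e0 C0).
move=> h; rewrite lt_min => /andP[hz]; rewrite ltr_pdivlMr// => he.
have zh : cabs z / 2 <= cabs (z + h).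
  rewrite -[X in _ <= cabs X]opprK opprD cabsN.
  have := cabsD (z + h) (- h); rewrite addrK cabsN -[- z - h]opprD cabsN; lra.
have zh0 : z + h != 0 by rewrite -cabs_gt0 (lt_le_trans _ zh)// divr_gt0.
rewrite -[rnorm _]/(cabs ((z + h)^-1 - z^-1 - h * (- z ^- 2))).
rewrite (_ : _ - _ = h * h * (z ^- 2 * (z + h)^-1)); last by field; rewrite zh0 z0.
rewrite 2!cabsM [e * _]mulrC -mulrA ler_wpM2l ?cabs_ge0//.
apply: le_trans (ltW he); rewrite ler_wpM2l ?cabs_ge0//.
have -> : C = (cabs z ^+ 2)^-1 * (cabs z / 2)^-1 by rewrite /C; field; rewrite gt_eqF.
rewrite cabsM !cabsV expr2 cabsM -expr2 ler_wpM2l ?invr_ge0 ?sqr_ge0//.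
by rewrite lef_pV2 ?posrE ?(lt_le_trans _ zh) ?divr_gt0.
Qed.

Definition cexp z : R[i] := (expR (complex.Re z))%:C * (cos (complex.Im z) +i* sin
  (complex.Im z)).

Lemma cexpD z w : cexp (z + w) = cexp z * cexp w.
Proof.
case: z w => [a b] [c d]; rewrite /cexp /= expRD cosD sinD.
by apply/eqP; rewrite eq_complex /=; apply/andP; split; apply/eqP; ring.
Qed.

Lemma cexp0 : cexp 0 = 1.
Proof. by rewrite /cexp /= expR0 cos0 sin0 mul1r. Qed.

Lemma cabs_cexp z : cabs (cexp z) = expR (complex.Re z).
Proof.
by rewrite /cexp cabsM cabs_real cabs_def /= cos2Dsin2 sqrtr1 mulr1 ger0_norm ?expR_ge0.
Qed.

Lemma cexp_real (x : R) : cexp x%:C = (expR x)%:C.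
Proof. by rewrite /cexp /= cos0 sin0 mulr1. Qed.


Lemma real_derive_eps (g : R -> R) (x D : R) : is_derive x 1 g D <->
  forall e : R, 0 < e -> exists2 d : R, 0 < d &
  forall h, `|h| < d -> `|g (x + h) - g x - h * D| <= e * `|h|.
Proof.
split=> [[/cvg_ex[l gl] <-] e e0|H].
  have -> : 'D_1 g x = l by exact: cvg_lim gl.
  have [d /= d0 dP] := (cvgrPdist_le _ _).1 gl e e0.
  exists d => // h hd; have [->|h0] := eqVneq h 0.
    by rewrite addr0 subrr mul0r subrr normr0 mulr0.
  have /= := dP h; rewrite sub0r normrN => /(_ hd h0) H.
  rewrite (_ : _ - _ = - (h * (l - h^-1 *: (g (h *: 1 + x) - g x)))).
    by rewrite normrN normrM mulrC ler_wpM2r.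
  rewrite [_ *: 1]mulr1 [h + x]addrC mulrBr opprB; congr (_ - _).
  by rewrite [_ *: _]/(_ * _) mulVKf.
suff gl : h^-1 *: ((g \o shift x) (h *: 1) - g x) @[h --> 0^'] --> D.
  by apply: DeriveDef; [apply/cvg_ex; exists D|apply: cvg_lim gl].
apply/cvgrPdist_le => e e0; have [d d0 dP] := H _ e0.
exists d => // h; rewrite /= sub0r normrN => hd h0.
rewrite [_ *: 1]mulr1 [h + x]addrC distrC.
rewrite -(@ler_pM2r _ `|h|) ?normr_gt0// -normrM (le_trans _ (dP _ hd))//.
by rewrite mulrBl [_ *: _]/(_ * _) mulrAC mulVf// mul1r [D * h]mulrC.
Qed.

Lemma is_cderive_cexp0 : is_cderive (fun w => cexp w : scal) 0 1.
Proof.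
(* 9 = 3 + 3 + 1 + 2, the factors of [e' * h] in [p1] to [p4] below. *)
move=> e e0; have [e' [e'0 e'1 e'5]] : exists e' : R, [/\ 0 < e', e' <= 1 & 9 * e' <=
  e].
  exists (Num.min (e / 9) 1); split; first by rewrite lt_min divr_gt0//=.
    by rewrite ge_min lexx orbT.
  by rewrite mulrC -ler_pdivlMr// ge_min lexx.
have [d1 d10 h1] := (@real_derive_eps _ _ _).1 (is_derive_expR 0) _ e'0.
have [d2 d20 h2] := (@real_derive_eps _ _ _).1 (is_derive_sin (0 : R)) _ e'0.
have [d3 d30 h3] := (@real_derive_eps _ _ _).1 (is_derive_cos (0 : R)) _ e'0.
exists (Num.min (Num.min d1 e') (Num.min d2 d3));
  first by rewrite !lt_min d10 d20 d30 e'0.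
move=> [a b]; rewrite !lt_min => /andP[/andP[ad1 ae] /andP[bd2 bd3]].
have := normr_Re_le (a +i* b); have := normr_Im_le (a +i* b) => /= bh ah.
have := h1 _ (le_lt_trans ah ad1); have := h2 _ (le_lt_trans bh bd2).
have := h3 _ (le_lt_trans bh bd3);
  rewrite expR0 sin0 cos0 !add0r oppr0 mulr0 !mulr1 !subr0 ?addr0.
move: ah bh ae; set h := cabs _; rewrite /cexp /= => ah bh ae c s x.
rewrite -[rnorm _]/(cabs ((cexp (a +i* b)) - cexp 0 - (a +i* b) * 1)) cexp0 mulr1
  /cexp /=.
rewrite (le_trans (cabs_le_Re_Im _))//= !mul0r !subr0 !addr0.
move: (expR a) (cos b) (sin b) (normr_ge0 a) (normr_ge0 b) c s x => A B C na nb c s x.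
have x' : `|A - 1| <= 2 * `|a|.
  have := ler_normD (A - 1 - a) a; have := ler_wpM2r na e'1; rewrite subrK; lra.
have x2 : `|A| <= 3 by have := ler_normD (A - 1) 1; rewrite subrK normr1; lra.
rewrite (_ : A * B - 1 - a = A * (B - 1) + (A - 1 - a)); last by ring.
rewrite (_ : A * C - b = A * (C - b) + (A - 1) * b); last by ring.
have := ler_normD (A * (B - 1)) (A - 1 - a);
  have := ler_normD (A * (C - b)) ((A - 1) * b).
rewrite !normrM => u1 u2.
have p1 : `|A| * `|B - 1| <= 3 * (e' * h) by rewrite ler_pM// (le_trans c)//
  ler_wpM2l// ltW.
have p2 : `|A| * `|C - b| <= 3 * (e' * h) by rewrite ler_pM// (le_trans s)//
  ler_wpM2l// ltW.
have p3 : `|A - 1 - a| <= e' * h by rewrite (le_trans x)// ler_wpM2l// ltW.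
have p4 : `|A - 1| * `|b| <= 2 * (e' * h).
  rewrite mulrA ler_pM// (le_trans x')// ler_wpM2l// (le_trans ah)// ltW//.
have p5 : 9 * e' * h <= e * h by rewrite ler_wpM2r// cabs_ge0.
lra.
Qed.
End scalar_cderivative.

(** * The maximum principle on the strip *)

Section strip_maximum.
Context (R : realType).
Notation scal := (R[i]^o).
Implicit Types (f g : R[i] -> scal) (z : R[i]).

Lemma scale_mulE (a b : R) : a *: (b : R^o) = a * b.
Proof. by []. Qed.

Lemma is_cderive_ext (V : normedModType R[i]) (F G : R[i] -> V) z D E :
  is_cderive F z D -> F =1 G -> D = E -> is_cderive G z E.
Proof. by move=> FD /funext <- <-. Qed.

Lemma is_cderiveZl (c : R[i]) (f : R[i] -> scal) z (d : scal) :
  is_cderive f z d -> is_cderive (fun w => c * f w : scal) z (c * d).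
Proof.
move=> fd; apply: (is_cderive_ext (is_cderiveM (@is_cderive_cst _ _ (c : scal) z) fd))
  => //=.
by rewrite mul0r addr0.
Qed.

Lemma is_cderive_cexp z : is_cderive (fun w => cexp w : scal) z (cexp z).
Proof.
move=> e e0; have c0 : 0 < cabs (cexp z) by rewrite cabs_cexp expR_gt0.
have [d d0 dP] := @is_cderive_cexp0 R _ (divr_gt0 e0 c0); exists d => // h /dP.
rewrite -[rnorm _]/(cabs (cexp (0 + h) - cexp 0 - h * 1)) add0r cexp0 mulr1 => H.
rewrite -[rnorm _]/(cabs (cexp (z + h) - cexp z - h * cexp z)) cexpD.
rewrite (_ : _ - _ = cexp z * (cexp h - 1 - h)); last by ring.
rewrite cabsM (le_trans (ler_wpM2l (cabs_ge0 _) H))// mulrA mulrCA divff ?gt_eqF//.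
by rewrite mulr1.
Qed.

Lemma is_cderive_cexp_comp f z (d : scal) : is_cderive f z d ->
  is_cderive (fun w => cexp (f w) : scal) z (d * cexp (f z)).
Proof. by move=> fd; exact: (is_cderive_comp fd (is_cderive_cexp _)). Qed.

Lemma is_derive_Re_x f (x y : R) (d : scal) : is_cderive f (x +i* y) d ->
  is_derive x 1 (fun t => complex.Re (f (t +i* y))) (complex.Re d).
Proof.
move=> fd; apply/real_derive_eps => e /fd[r r0 rP]; exists r => // h hr.
have := rP h%:C; rewrite cabs_real => /(_ hr); apply: le_trans.
apply: le_trans (normr_Re_le _); rewrite !raddfB /= -[h%:C *: d]/(h%:C * d) Re_realM.
by rewrite -[(x + h) +i* y]/((x + h) +i* y) (_ : (x +i* y) + h%:C = (x + h) +i* y)//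
  /real_complex_def; congr (_ +i* _); rewrite addr0.
Qed.

Lemma is_derive_Re_y f (x y : R) (d : scal) : is_cderive f (x +i* y) d ->
  is_derive y 1 (fun t => complex.Re (f (x +i* t))) (- complex.Im d).
Proof.
move=> fd; apply/real_derive_eps => e /fd[r r0 rP]; exists r => // h hr.
have hi : cabs (0 +i* h) = `|h| by rewrite cabs_def /= expr0n add0r sqrtr_sqr.
have := rP (0 +i* h); rewrite hi => /(_ hr); apply: le_trans.
apply: le_trans (normr_Re_le _); rewrite !raddfB /= -[(0 +i* h) *: d]/((0 +i* h) * d).
rewrite (_ : (x +i* y) + (0 +i* h) = x +i* (y + h)); last first.
  by congr (_ +i* _); rewrite addr0.
by case: d {fd rP} => a b /=; rewrite mul0r sub0r mulrN.
Qed.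

(** At the maximum the first derivative vanishes; a positive [c] would make [g'] positive just to
    the right of [x], and [g] would increase there by the mean value theorem. *)
Lemma second_derivative_test (g g' : R -> R) (a b x c : R) :
  a < x < b -> (forall t, a < t < b -> is_derive t 1 g (g' t)) ->
  is_derive x 1 g' c -> (forall t, a < t < b -> g t <= g x) -> c <= 0.
Proof.
move=> axb gd gc gx; rewrite leNgt; apply/negP => c0.
have ab : a < b by case/andP: axb => /lt_trans; apply.
have inab t : t \in `]a, b[ -> a < t < b by rewrite in_itv.
have xab : x \in `]a, b[ by rewrite in_itv.
have g'x0 : g' x = 0.
  have dx := gd _ axb; rewrite -(@derive_val _ _ _ _ _ _ _ dx).
  have d0 : is_derive x 1 g 0.
    apply: (@derive1_at_max R g a b x (ltW ab) _ xab) => t /inab tab; last exact: gx.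
    by have [] := gd _ tab.
  exact: (@derive_val _ _ _ _ _ _ _ d0).
have c20 : 0 < c / 2 by rewrite divr_gt0.
have [d d0 dP] := (@real_derive_eps _ _ _ _).1 gc _ c20.
have [y [xy yb yd]] : exists y, [/\ x < y, y < b & y < x + d].
  exists (x + Num.min d (b - x) / 2); case/andP: axb => ax xb.
  have m0 : 0 < Num.min d (b - x) by rewrite lt_min d0 subr_gt0.
  have m1 : Num.min d (b - x) <= d by rewrite ge_min lexx.
  have m2 : Num.min d (b - x) <= b - x by rewrite ge_min lexx orbT.
  split; lra.
have xyab t : x <= t <= y -> a < t < b.
  by case/andP: axb => ax xb /andP[xt ty]; rewrite (lt_le_trans ax)//= (le_lt_trans ty).
have [||s] := @MVT R g g' x y xy.
- by move=> t; rewrite in_itv /= => /andP[/ltW xt /ltW ty]; apply: gd; rewrite xyab ?xt.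
- apply: derivable_within_continuous => t; rewrite in_itv /= => txy.
  by have [] := gd _ (xyab _ txy).
rewrite in_itv /= => /andP[xs sy] gyx.
have gyx' : g y <= g x by apply: gx; rewrite xyab// lexx ltW.
have : 0 < g' s * (y - x).
  rewrite mulr_gt0 ?subr_gt0//.
  have := dP (s - x); rewrite gtr0_norm ?subr_gt0// [x + _]addrC subrK g'x0 subr0.
  have sd : s - x < d by rewrite ltrBlDl (lt_trans sy).
  move=> /(_ sd); rewrite ler_norml => /andP[+ _].
  have : 0 < (s - x) * c by rewrite mulr_gt0// subr_gt0.
  lra.
by rewrite -gyx subr_gt0 ltNge gyx'.
Qed.

(** At boundary points the increments may leave the strip, so no one-sided derivative arises. Two
    derivatives are recorded because the maximum principle below tests second derivatives of the
    real part instead of using Cauchy's formula. *)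
Definition holo2 f := exists f1 f2 : R[i] -> scal, forall z, strip z ->
  is_cderive f z (f1 z) /\ is_cderive f1 z (f2 z).

Lemma holo2_continuous_Re f (p : R * R) : holo2 f -> strip (p.1 +i* p.2) ->
  {for p, continuous (fun q : R * R => complex.Re (f (q.1 +i* q.2)))}.
Proof.
move=> [f1 [f2 ff]] /ff[f1p _]; apply/cvgrPdist_lt => e e0.
have [d d0 dP] := is_cderive_continuous f1p e0.
have d20 : 0 < d / 2 by rewrite divr_gt0.
have n1 : \forall q \near p, `|p.1 - q.1| < d / 2.
  exact: (cvgrPdist_lt _ _).1 (@cvg_fst _ _ (nbhs p.1) (nbhs p.2) _) _ d20.
have n2 : \forall q \near p, `|p.2 - q.2| < d / 2.
  exact: (cvgrPdist_lt _ _).1 (@cvg_snd _ _ (nbhs p.1) (nbhs p.2) _) _ d20.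
near=> q.
have q1 : `|p.1 - q.1| < d / 2 by near: q.
have q2 : `|p.2 - q.2| < d / 2 by near: q.
rewrite distrC -raddfB /=; apply: le_lt_trans (normr_Re_le _) _.
rewrite (_ : q.1 +i* q.2 = (p.1 +i* p.2) + ((q.1 - p.1) +i* (q.2 - p.2))); last first.
  by congr (_ +i* _); rewrite addrC subrK.
apply: dP; rewrite (le_lt_trans (cabs_le_Re_Im _))//= distrC [X in _ + X]distrC.
by rewrite (splitr d) ltrD.
Unshelve. all: by end_near. Qed.

(** Subtracting from [Re f] a small multiple of [y^2 - 2 x^2 + 3], whose Laplacian is -2, makes it
    strictly subharmonic and sends it to -oo along the strip: a maximum exists and cannot be
    interior. The constant 3 keeps the subtracted function positive on the strip. *)
Lemma strip_max f (M B : R) : holo2 f ->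
  (forall z, strip z -> complex.Re (f z) <= B) ->
  (forall t, complex.Re (f (0 +i* t)) <= M) ->
  (forall t, complex.Re (f (1 +i* t)) <= M) ->
  forall z, strip z -> complex.Re (f z) <= M.
Proof.
move=> hf fB f0 f1 [x0 y0] /= xy0.
have [f' [f'' ff]] := hf.
apply/ler_addgt0Pr => e e0.
have [eta [eta0 etae]] : exists eta : R, 0 < eta /\ eta * (y0 ^+ 2 - 2 * x0 ^+ 2 + 3)
  <= e.
  have y2 := sqr_ge0 y0; exists (e / (y0 ^+ 2 + 3)).
  have p : 0 < y0 ^+ 2 + 3 by rewrite ltr_wpDl.
  split; first by rewrite divr_gt0.
  rewrite mulrAC ler_pdivrMr// ler_wpM2l ?(ltW e0)//; have := sqr_ge0 x0; lra.
pose v (p : R * R) := complex.Re (f (p.1 +i* p.2)) - eta * (p.2 ^+ 2 - 2 * p.1 ^+ 2 +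
  3).
suff : v (x0, y0) <= M by rewrite /v /= lerBlDr => /le_trans; apply; rewrite lerD2l.
rewrite leNgt; apply/negP => vM.
(* Beyond height [L] the subtracted term is at least [B - M], so that the horizontal sides of the
   rectangle carry no value above [M]. *)
pose L := `|y0| + Num.max 0 (B - M) / eta + 1.
have L1 : 1 <= L by rewrite lerDr addr_ge0// divr_ge0 ?(ltW eta0)// le_max lexx.
have LB : B - M <= eta * L.
  rewrite -ler_pdivrMl// mulrC /L -addrA (le_trans _ (_ : Num.max 0 (B - M) / eta <=
    _))//.
    by rewrite ler_wpM2r ?invr_ge0 ?(ltW eta0)// le_max lexx orbT.
  by rewrite addrCA lerDl addr_ge0.
have y0L : `|y0| <= L by rewrite /L -addrA lerDl addr_ge0// divr_ge0 ?(ltW eta0)//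
  le_max lexx.
pose A : set (R * R) := `[0, 1] `*` `[- L, L].
have Axy : A (x0, y0) by split; rewrite /= in_itv /= // -ler_norml.
have cA : compact A by apply: compact_setX; exact: segment_compact.
have vc : {within A, continuous v}.
  apply/subspace_continuousP => p Ap; apply: cvg_within_filter.
  apply: cvgB.
    apply: holo2_continuous_Re => //=.
    by case: Ap => /=; rewrite in_itv.
  apply: cvgM; first exact: cvg_cst.
  apply: cvgD; last exact: cvg_cst.
  apply: cvgB; first by apply: cvgM; exact: cvg_snd.
  apply: cvgM; first exact: cvg_cst.
  by apply: cvgM; exact: cvg_fst.
have [[x y] /set_mem[/= x01 yL] vmax] := compact_EVT_max (ex_intro _ _ Axy) cA vc.
have vxy : M < v (x, y) by apply: lt_le_trans vM (vmax _ _); rewrite inE.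
rewrite in_itv /= in x01; rewrite in_itv /= in yL.
have h0 (x1 y1 : R) : 0 <= x1 <= 1 -> 1 <= y1 ^+ 2 - 2 * x1 ^+ 2 + 3.
  move=> /andP[a0 a1]; have : x1 ^+ 2 <= 1 by rewrite expr_le1.
  have := sqr_ge0 y1; lra.
have x_gt0 : 0 < x.
  case/andP: x01 => x0' x1; rewrite lt_neqAle x0' andbT eq_sym; apply/eqP => xE.
  move: vxy; rewrite /v /= xE; have := f0 y; have := h0 0 y;
    rewrite lexx ler01 => /(_ isT).
  by move=> h; have : 0 < eta * (y ^+ 2 - 2 * 0 ^+ 2 + 3);
    [rewrite mulr_gt0// (lt_le_trans _ h)|lra].
have x_lt1 : x < 1.
  case/andP: x01 => x0' x1; rewrite lt_neqAle x1 andbT; apply/eqP => xE.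
  move: vxy; rewrite /v /= xE; have := f1 y; have := h0 1 y;
    rewrite lexx ler01 => /(_ isT).
  by move=> h; have : 0 < eta * (y ^+ 2 - 2 * 1 ^+ 2 + 3);
    [rewrite mulr_gt0// (lt_le_trans _ h)|lra].
have yLs : - L < y < L.
  rewrite -ltr_norml ltNge; apply/negP => Ly.
  have : v (x, y) <= B - eta * L.
    rewrite /v /= lerB// ?fB// ler_wpM2l ?(ltW eta0)//.
    have : L ^+ 2 <= y ^+ 2 by rewrite -[y ^+ 2]real_normK ?num_real// ler_sqr
      ?nnegrE// (le_trans ler01).
    have : x ^+ 2 <= 1 by rewrite expr_le1 ?ltW.
    by nra.
  lra.
(* The second derivatives of [Re f] in [x] and [y] are opposite by the Cauchy-Riemann equations; the
   two tests add up to [2 * eta <= 0]. *)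
have d1 : complex.Re (f'' (x +i* y)) + 4 * eta <= 0.
  apply: (@second_derivative_test (fun t => v (t, y))
    (fun t => complex.Re (f' (t +i* y)) + 4 * eta * t) 0 1 x); first by rewrite x_gt0.
  - move=> t /andP[t0 t1]; have /ff[/is_derive_Re_x fd _] : strip (t +i* y) by rewrite
    /strip /= !ltW.
    rewrite /v /=; apply: is_derive_eq.
    by rewrite !scale_mulE; ring.
  - have /ff[_ /is_derive_Re_x fd] : strip (x +i* y) by rewrite /strip /= !ltW.
    by apply: is_derive_eq; rewrite !scale_mulE; ring.
  - by move=> t /andP[t0 t1]; apply: vmax; rewrite inE; split;
    rewrite /= in_itv /= ?(ltW t0) ?(ltW t1).
have d2 : - complex.Re (f'' (x +i* y)) - 2 * eta <= 0.
  apply: (@second_derivative_test (fun t => v (x, t))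
    (fun t => - complex.Im (f' (x +i* t)) - 2 * eta * t) (- L) L y) => //.
  - move=> t _; have /ff[/is_derive_Re_y fd _] : strip (x +i* t) by rewrite /strip /=
    !ltW.
    rewrite /v /=; apply: is_derive_eq.
    by rewrite !scale_mulE; ring.
  - have /ff[_ fd] : strip (x +i* y) by rewrite /strip /= !ltW.
    (* Writing [- Im f'] as [Re (i f')] allows the rule for vertical derivatives to be applied a
       second time. *)
    have fd' := is_derive_Re_y (is_cderiveZl 'i fd).
    have E : (fun t => - complex.Im (f' (x +i* t)) - 2 * eta * t) =
      (fun t => complex.Re ('i * f' (x +i* t)) - 2 * eta * t).
      by apply/funext => t; case: (f' _) => a b /=; rewrite mul0r sub0r mul1r.
    rewrite E; apply: is_derive_eq.
    case: (f'' _) => a b /=; rewrite !scale_mulE; ring.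
  - by move=> t /andP[t0 t1]; apply: vmax; rewrite inE; split;
    rewrite /= in_itv /= ?(ltW t0) ?(ltW t1).
lra.
Qed.
End strip_maximum.

(** * Closure properties of differentiable functions on the strip *)

Section holomorphic_closure.
Context (R : realType).
Notation scal := (R[i]^o).
Implicit Types (f g : R[i] -> scal) (z : R[i]).

Definition holo1 f := exists f1 : R[i] -> scal, forall z, strip z -> is_cderive f z
  (f1 z).

Lemma holo2P f : holo2 f <-> exists f1 : R[i] -> scal,
  holo1 f1 /\ forall z, strip z -> is_cderive f z (f1 z).
Proof.
split=> [[f1 [f2 ff]]|[f1 [[f2 f12] f01]]].
  by exists f1; split=> [|z /ff[]//]; exists f2 => z /ff[].
by exists f1, f2 => z zs; split; [exact: f01|exact: f12].
Qed.

Lemma holo2_holo1 f : holo2 f -> holo1 f.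
Proof. by move=> /holo2P[f1 [_ ff]]; exists f1. Qed.

Lemma holo1_cst (c : R[i]) : holo1 (fun=> c).
Proof. by exists (fun=> 0) => z _; exact: is_cderive_cst. Qed.

Lemma holo2_cst (c : R[i]) : holo2 (fun=> c).
Proof. by apply/holo2P; exists (fun=> 0); split=> [|z _];
  [exact: holo1_cst|exact: is_cderive_cst]. Qed.

Lemma holo2_id : holo2 (fun z => z).
Proof. by apply/holo2P; exists (fun=> 1); split=> [|z _];
  [exact: holo1_cst|exact: is_cderive_id]. Qed.

Lemma holo1D f g : holo1 f -> holo1 g -> holo1 (fun z => f z + g z).
Proof.
by move=> [f1 ff] [g1 gg]; exists (fun z => f1 z + g1 z) => z zs; apply: is_cderiveD;
  auto.
Qed.

Lemma holo1M f g : holo1 f -> holo1 g -> holo1 (fun z => f z * g z).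
Proof.
by move=> [f1 ff] [g1 gg]; exists (fun z => f z * g1 z + f1 z * g z) => z zs;
  apply: is_cderiveM; auto.
Qed.

Lemma holo1_inv f : (forall z, strip z -> f z != 0) -> holo1 f -> holo1 (fun z => (f
  z)^-1).
Proof.
move=> f0 [f1 ff]; exists (fun z => f1 z * - f z ^- 2) => z zs.
by apply: (is_cderive_comp (ff _ zs)); apply: is_cderive_inv; exact: f0.
Qed.

Lemma holo1_cexp f : holo1 f -> holo1 (fun z => cexp (f z)).
Proof.
by move=> [f1 ff]; exists (fun z => f1 z * cexp (f z)) => z zs;
  apply: is_cderive_cexp_comp; auto.
Qed.

Lemma holo2D f g : holo2 f -> holo2 g -> holo2 (fun z => f z + g z).
Proof.
move=> /holo2P[f1 [h1 ff]] /holo2P[g1 [h2 gg]]; apply/holo2P.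
exists (fun z => f1 z + g1 z); split; first exact: holo1D.
by move=> z zs; apply: is_cderiveD; auto.
Qed.

Lemma holo2M f g : holo2 f -> holo2 g -> holo2 (fun z => f z * g z).
Proof.
move=> hf hg; have kf := holo2_holo1 hf; have kg := holo2_holo1 hg.
move: hf hg => /holo2P[f1 [h1 ff]] /holo2P[g1 [h2 gg]]; apply/holo2P.
exists (fun z => f z * g1 z + f1 z * g z); split; first by apply: holo1D; exact: holo1M.
by move=> z zs; apply: is_cderiveM; auto.
Qed.

Lemma holo2_inv f : (forall z, strip z -> f z != 0) -> holo2 f -> holo2 (fun z => (f
  z)^-1).
Proof.
move=> f0 hf; have kf := holo1_inv f0 (holo2_holo1 hf).
move: hf => /holo2P[f1 [h1 ff]]; apply/holo2P.
exists (fun z => f1 z * (- 1 * ((f z)^-1 * (f z)^-1))); split.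
  by apply: holo1M => //; apply: holo1M; [exact: holo1_cst|exact: holo1M].
move=> z zs; apply: is_cderive_ext (is_cderive_comp (ff _ zs) (is_cderive_inv (f0 _
  zs))) _ _ => //.
by rewrite mulN1r -invfM.
Qed.

Lemma holo2_cexp f : holo2 f -> holo2 (fun z => cexp (f z)).
Proof.
move=> hf; have kf := holo1_cexp (holo2_holo1 hf).
move: hf => /holo2P[f1 [h1 ff]]; apply/holo2P.
exists (fun z => f1 z * cexp (f z)); split; first exact: holo1M.
by move=> z zs; apply: is_cderive_cexp_comp; auto.
Qed.

Lemma holo2_sum (I : Type) (r : seq I) (F : I -> R[i] -> scal) :
  (forall i, holo2 (F i)) -> holo2 (fun z => \sum_(i <- r) F i z).
Proof.
move=> hF; elim: r => [|i r ih].
  by under [X in holo2 X]funext do rewrite big_nil; exact: holo2_cst.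
under [X in holo2 X]funext do rewrite big_cons.
by apply: (@holo2D (F i) (fun w => \sum_(j <- r) F j w)).
Qed.

Lemma holo2B f g : holo2 f -> holo2 g -> holo2 (fun z => f z - g z).
Proof.
move=> hf hg; have := holo2D hf (holo2M (holo2_cst (-1)) hg).
by under [X in holo2 X -> _]funext do rewrite mulN1r.
Qed.

Lemma holo2_affine_exp (a b : R[i]) : holo2 (fun z => cexp (a + b * z)).
Proof.
apply: holo2_cexp; apply: holo2D; first exact: holo2_cst.
by apply: holo2M; [exact: holo2_cst|exact: holo2_id].
Qed.

End holomorphic_closure.

(** * Outer functions with prescribed boundary modulus *)

Section boundary_function.
Context (R : realType).

Lemma sin_eq0_0pi (x : R) : - pi <= x <= pi -> sin x = 0 -> x = 0 \/ `|x| = pi.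
Proof.
move=> /andP[x1 x2] s0; have [->|x0] := eqVneq x 0; first by left.
right; apply/eqP; rewrite eq_le ler_norml x1 x2 /= leNgt; apply/negP => xp.
have : 0 < sin `|x| by apply: sin_gt0_pi; rewrite normr_gt0 x0.
by case: (ger0P x) => _; rewrite ?sinN s0 ?oppr0 ltxx.
Qed.

(** [U] lives on the circle obtained from [[0, pi]] by joining its ends, where [|sin (a - b)|]
    vanishes only on the diagonal. It has a positive minimum on the compact set of pairs with
    [|U a - U b| >= e]. *)
Lemma sin_modulus (U : R -> R) : continuous U -> U 0 = U pi ->
  forall e : R, 0 < e -> exists2 d : R, 0 < d & forall a b, 0 <= a <= pi -> 0 <= b <=
    pi ->
    `|sin (a - b)| < d -> `|U a - U b| < e.
Proof.
move=> Uc U0 e e0.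
pose A : set (R * R) := `[0, pi] `*` `[0, pi].
pose g (q : R * R) := `|U q.1 - U q.2|.
have gc : continuous g.
  move=> q; apply: cvg_norm; apply: cvgB.
    exact: (cvg_comp _ _ (@cvg_fst _ _ (nbhs q.1) (nbhs q.2) _) (Uc q.1)).
  exact: (cvg_comp _ _ (@cvg_snd _ _ (nbhs q.1) (nbhs q.2) _) (Uc q.2)).
have sc : continuous (fun q : R * R => `|sin (q.1 - q.2)|).
  move=> q; apply: cvg_norm.
  apply: (@cvg_comp _ _ _ (fun q : R * R => q.1 - q.2) sin _ (nbhs (q.1 - q.2))).
    by apply: cvgB; [exact: cvg_fst|exact: cvg_snd].
  exact: continuous_sin.
pose K := A `&` g @^-1` [set y | e <= y].
have Kc : compact K.
  apply: compact_closedI; first by apply: compact_setX; exact: segment_compact.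
  by apply: closed_comp => [q _|]; [exact: gc|exact: closed_ge].
have [Kne|K0] := pselect (K !=set0); last first.
  exists 1 => // a b ha hb _; rewrite ltNge; apply/negP => h; apply: K0.
  by exists (a, b); split=> //; split; rewrite /= in_itv.
have [[a0 b0] /set_mem[[/= ha hb] gab] smin] :=
  compact_EVT_min Kne Kc (continuous_subspaceT sc).
exists `|sin (a0 - b0)|.
  rewrite normr_gt0; apply/eqP => s0; move: ha hb; rewrite !in_itv /= => ha hb.
  have hab : - pi <= a0 - b0 <= pi by move: ha hb => /andP[? ?] /andP[? ?];
    apply/andP; split; lra.
  have [E|E] := sin_eq0_0pi hab s0.
  - by move: gab; rewrite /g /=; move/eqP: E; rewrite subr_eq0 => /eqP ->;
    rewrite subrr normr0 leNgt e0.
  - case/andP: ha => ha1 ha2; case/andP: hb => hb1 hb2.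
    move: gab; rewrite /g /=.
    have [[-> ->]|[-> ->]] : (a0 = 0 /\ b0 = pi) \/ (a0 = pi /\ b0 = 0).
      move: E; case: (ger0P (a0 - b0)) => _ E; [right|left]; lra.
    + by rewrite U0 subrr normr0 leNgt e0.
    + by rewrite U0 subrr normr0 leNgt e0.
move=> a b ha' hb'; rewrite !ltNge; apply: contra => gab'.
by apply: (smin (a, b)); rewrite inE; split => //; split; rewrite /= in_itv.
Qed.

Variables (u0 u1 : R -> R) (L : R).
Hypothesis (u0c : continuous u0) (u1c : continuous u1).
Hypothesis (u0p : u0 t @[t --> +oo] --> L) (u0m : u0 t @[t --> -oo] --> L).
Hypothesis (u1p : u1 t @[t --> +oo] --> L) (u1m : u1 t @[t --> -oo] --> L).

(* The two boundary lines, glued along the real line by z |-> exp(i pi z). *)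
Definition glued (w : R) : R :=
  if 0 < w then u0 (- ln w / pi) else if w < 0 then u1 (- ln (- w) / pi) else L.

Lemma far_limit (e : R) : 0 < e -> exists2 A : R, 0 < A &
  forall t, A < `|t| -> `|u0 t - L| < e /\ `|u1 t - L| < e.
Proof.
move=> e0.
have [A1 [_ h1]] := (cvgrPdist_lt _ _).1 u0p _ e0.
have [A2 [_ h2]] := (cvgrPdist_lt _ _).1 u0m _ e0.
have [A3 [_ h3]] := (cvgrPdist_lt _ _).1 u1p _ e0.
have [A4 [_ h4]] := (cvgrPdist_lt _ _).1 u1m _ e0.
exists (1 + `|A1| + `|A2| + `|A3| + `|A4|); first by rewrite !ltr_wpDr.
move=> t tA; rewrite distrC [`|u1 t - L|]distrC.
have [a1 a2 a3 a4] : [/\ A1 < `|t|, - `|t| < A2, A3 < `|t| & - `|t| < A4].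
  have := ler_norm A1; have := ler_norm A3; have := ler_norm (- A2);
    have := ler_norm (- A4).
  have := normr_ge0 A1; have := normr_ge0 A2; have := normr_ge0 A3;
    have := normr_ge0 A4.
  rewrite !normrN; split; lra.
case: (ger0P t) a1 a2 a3 a4 => t0; first by split; [exact: h1|exact: h3].
by rewrite opprK => *; split; [exact: h2|exact: h4].
Qed.

(** Under exp(i pi z) the two ends of the strip go to 0 and to infinity. A single limit [L] for all
    four ends of the boundary lines makes the glued function continuous there. *)
Lemma glued_near_infty (e : R) : 0 < e -> exists2 A : R, 0 < A &
  forall w, A < `|w| \/ `|w| < A^-1 -> `|glued w - L| < e.
Proof.
move=> e0; have [A A0 hA] := far_limit e0.
have pi0 : 0 < pi :> R := pi_gt0 R.
exists (expR (A * pi)); first exact: expR_gt0.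
move=> w; have [->|w0] := eqVneq w 0; first by rewrite /glued ltxx subrr normr0.
have w0' : 0 < `|w| by rewrite normr_gt0.
rewrite -expRN -{1 2}[`|w|]lnK ?posrE// !ltr_expR => H.
have {}H : A < `|- ln `|w| / pi|.
  rewrite normrM normrN [X in _ * X]gtr0_norm ?invr_gt0// ltr_pdivlMr//.
  by case: H => H; rewrite ltr_normr ?H// ltrNr H orbT.
have [h0 h1] := hA _ H.
by rewrite /glued; case: (ltrgt0P w) w0 h0 h1 => //.
Qed.

Lemma glued_continuous : continuous glued.
Proof.
have pi0 : 0 < pi :> R := pi_gt0 R.
move=> w; change (glued x @[x --> w] --> glued w).
have [w0|w0|->] := ltrgt0P w.
- have -> : glued w = u0 (- ln w / pi) by rewrite /glued w0.
  have H : u0 (- ln x / pi) @[x --> w] --> u0 (- ln w / pi).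
    apply: (@cvg_comp _ _ _ (fun x => - ln x / pi) u0 _ (nbhs (- ln w / pi)));
      last exact: u0c.
    by apply: cvgMr_tmp; apply: cvgN; exact: continuous_ln.
  apply: cvg_trans H; apply: near_eq_cvg; near=> x.
  have x0 : 0 < x by near: x; exact: lt_nbhsr.
  by rewrite /glued x0.
- have -> : glued w = u1 (- ln (- w) / pi) by rewrite /glued w0 ltNge ltW.
  have H : u1 (- ln (- x) / pi) @[x --> w] --> u1 (- ln (- w) / pi).
    apply: (@cvg_comp _ _ _ (fun x => - ln (- x) / pi) u1 _ (nbhs (- ln (- w) / pi)));
      last exact: u1c.
    apply: cvgMr_tmp; apply: cvgN.
    apply: (@cvg_comp _ _ _ (fun x => - x) (@ln R) _ (nbhs (- w)));
      first by apply: cvgN.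
    by apply: continuous_ln; rewrite oppr_gt0.
  apply: cvg_trans H; apply: near_eq_cvg; near=> x.
  have x0 : x < 0 by near: x; exact: lt_nbhsl.
  by rewrite /glued x0 ltNge ltW.
- apply/cvgrPdist_lt => e e0; have [A A0 hA] := glued_near_infty e0.
  have -> : glued 0 = L by rewrite /glued ltxx.
  exists A^-1; first by rewrite /= invr_gt0.
  by move=> x /=; rewrite sub0r normrN distrC => xA; apply: hA; right.
Unshelve. all: by end_near. Qed.

(** The projective line in the coordinate [w = cot s], of period [pi]; [sin s = 0] is the point at
    infinity. *)
Definition circle_data (s : R) : R := if sin s == 0 then L else glued (cos s / sin s).

Lemma circle_data_continuous : continuous circle_data.
Proof.
move=> s; change (circle_data x @[x --> s] --> circle_data s).
have [s0|s0] := eqVneq (sin s) 0; last first.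
  have -> : circle_data s = glued (cos s / sin s) by rewrite /circle_data (negbTE s0).
  have H : glued (cos x / sin x) @[x --> s] --> glued (cos s / sin s).
    apply: (@cvg_comp _ _ _ (fun x => cos x / sin x) glued _ (nbhs (cos s / sin s)));
      last exact: glued_continuous.
    by apply: cvgM; [exact: continuous_cos|apply: cvgV => //; exact: continuous_sin].
  apply: cvg_trans H; apply: near_eq_cvg; near=> x.
  have x0 : sin x != 0.
    by near: x; apply: (@continuous_sin R s [set y | y != 0]); apply: open_nbhs_nbhs;
      split; [exact: open_neq|exact: s0].
  by rewrite /circle_data (negbTE x0).
have -> : circle_data s = L by rewrite /circle_data s0 eqxx.
apply/cvgrPdist_lt => e e0; have [A A0 hA] := glued_near_infty e0.
have c1 : `|cos s| = 1.
  have := cos2Dsin2 s; rewrite s0 expr0n addr0 -[cos s ^+ 2]real_normK ?num_real// =>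
    /eqP.
  by rewrite sqrp_eq1// => /eqP.
near=> x; rewrite distrC /circle_data; case: ifPn => [_|sx];
  first by rewrite subrr normr0.
apply: hA; left; rewrite normrM normfV ltr_pdivlMr ?normr_gt0//.
have h1 : 1 / 2 < `|cos x|.
  have := ler_dist_dist (cos s) (cos x); rewrite c1 ler_norml => /andP[_].
  have : `|cos s - cos x| < 1 / 2 by near: x;
    apply: (cvgrPdist_lt _ _).1 (@continuous_cos R s) _ _; rewrite divr_gt0.
  lra.
have h2 : `|sin x| < 1 / (2 * A).
  have : `|sin s - sin x| < 1 / (2 * A).
    by near: x; apply: (cvgrPdist_lt _ _).1 (@continuous_sin R s) _ _;
      rewrite divr_gt0// mulr_gt0.
  by rewrite s0 sub0r normrN.
apply: lt_trans h1; rewrite mulrC -ltr_pdivlMr//.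
by rewrite (_ : 1 / 2 / A = 1 / (2 * A))// -mulrA -invfM.
Unshelve. all: by end_near. Qed.

End boundary_function.

(** * Herglotz and Poisson kernels at roots of unity *)

Section discrete_poisson_kernel.
Context (R : realType).

Definition cis (x : R) : R[i] := cos x +i* sin x.

Lemma cisE x : cis x = cexp (0 +i* x).
Proof. by rewrite /cexp /= expR0 mul1r. Qed.

Lemma cisD x y : cis (x + y) = cis x * cis y.
Proof. by rewrite !cisE -cexpD; congr cexp; congr (_ +i* _); rewrite addr0. Qed.

Lemma cabs_cis x : cabs (cis x) = 1.
Proof. by rewrite cisE cabs_cexp expR0. Qed.

Lemma cisX x n : cis x ^+ n = cis (n%:R * x).
Proof.
elim: n => [|n ih]; first by rewrite expr0 mul0r /cis cos0 sin0.
by rewrite exprS ih -cisD -natr1 mulrDl mul1r addrC.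
Qed.

Lemma Re_div (u v : R[i]) : complex.Re (u / v) =
  (complex.Re u * complex.Re v + complex.Im u * complex.Im v) / (complex.Re v ^+ 2 +
    complex.Im v ^+ 2).
Proof. by case: u v => [a b] [c d] /=; ring. Qed.

(** The Herglotz kernel; its real part is the Poisson kernel of the disc. *)
Definition herglotz (x : R[i]) : R[i] := (1 + x) * (1 - x)^-1.

Lemma Re_herglotz (r t : R) : complex.Re (herglotz (r%:C * cis (- 2 * t))) =
  (1 - r ^+ 2) / ((1 - r) ^+ 2 + 4 * r * sin t ^+ 2).
Proof.
have ct : cos (- 2 * t) = 1 - 2 * sin t ^+ 2.
  by rewrite mulNr cosN mulrC mulr_natr cos_mulr2n; have := cos2Dsin2 t; lra.
have h := cos2Dsin2 (- 2 * t).
rewrite /herglotz Re_div /cis; congr (_ / _).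
  rewrite [LHS](_ : _ = 1 - r ^+ 2 * (cos (- 2 * t) ^+ 2 + sin (- 2 * t) ^+ 2)).
    by rewrite h mulr1.
  by move: (cos _) (sin _) => C S /=; ring.
rewrite [LHS](_ : _ = 1 - 2 * r * cos (- 2 * t) + r ^+ 2 * (cos (- 2 * t) ^+ 2 + sin
  (- 2 * t) ^+ 2)).
  by rewrite h ct; ring.
by move: (cos _) (sin _) => C S /=; ring.
Qed.

Lemma cis_2piM k : cis (2 * (k%:R * pi)) = 1.
Proof.
elim: k => [|k ih]; first by rewrite mul0r mulr0 /cis cos0 sin0.
by rewrite -[k.+1%:R]natr1 (_ : 2 * _ = 2 * (k%:R * pi) + 2 * pi) 1?cisD;
  [rewrite ih mul1r mulr_natl /cis cos2pi sin2pi|ring].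
Qed.

Variable N : nat.
Hypothesis N0 : (0 < N)%N.
Let NR : (N%:R : R) != 0. Proof. by rewrite pnatr_eq0 -lt0n. Qed.

Let node (k : nat) : R := pi * k%:R / N%:R.

Lemma cis_node k : cis (2 * node k) = cis (2 * node 1) ^+ k.
Proof. by rewrite cisX; congr cis; rewrite /node; field. Qed.

Lemma cis_node_unity k : cis (2 * node k) ^+ N = 1.
Proof.
rewrite cisX (_ : _ * _ = 2 * (k%:R * pi)); last by rewrite /node; field.
exact: cis_2piM.
Qed.

Lemma cis_node_neq1 j : (0 < j < N)%N -> cis (2 * node j) != 1.
Proof.
move=> /andP[j0 jN]; apply/eqP => /(congr1 (@complex.Re R)) /= c1.
have : 0 < sin (node j).
  apply: sin_gt0_pi; rewrite /node divr_gt0 ?mulr_gt0 ?pi_gt0 ?ltr0n//=.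
  by rewrite ltr_pdivrMr ?ltr0n// ltr_pM2l ?pi_gt0// ltr_nat.
move=> s0; move: c1; rewrite mulr_natl cos_mulr2n => c1.
have := cos2Dsin2 (node j); have : 0 < sin (node j) ^+ 2 by rewrite exprn_gt0.
lra.
Qed.

Lemma sum_roots j : (j < N)%N -> \sum_(k < N) cis (2 * node k) ^+ j = (if j == 0%N
  then N%:R else 0).
Proof.
move=> jN; case: eqP => [->|/eqP j0].
  by under eq_bigr do rewrite expr0; rewrite sumr_const card_ord.
have /cis_node_neq1 c1 : (0 < j < N)%N by rewrite lt0n j0.
have := subrX1 (cis (2 * node j)) N; rewrite cis_node_unity subrr => /esym/eqP.
rewrite mulf_eq0 subr_eq0 (negbTE c1) /= => /eqP S0; rewrite -[RHS]S0;
  apply: eq_bigr => k _.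
by rewrite cis_node [in RHS]cis_node -!exprM mulnC.
Qed.

(** A finite geometric sum, with [1 - b ^+ N] as common denominator, makes each summand a polynomial
    in a root of unity, of which averaging keeps only the constant term. So the discrete Poisson
    kernel has mean close to 1 once [b ^+ N] is small. *)
Lemma sum_herglotz (b : R[i]) : b ^+ N != 1 ->
  \sum_(k < N) herglotz (b * cis (2 * node k)) = N%:R * herglotz (b ^+ N).
Proof.
move=> bN; have D k : 1 - b * cis (2 * node k) != 0.
  rewrite subr_eq0; apply: contra bN => /eqP /(congr1 (fun x => x ^+ N)).
  by rewrite expr1n exprMn cis_node_unity mulr1 => <-.
have D' : 1 - b ^+ N != 0 by rewrite subr_eq0 eq_sym.
have E k : herglotz (b * cis (2 * node k)) =
    2 * (1 - b ^+ N)^-1 * \sum_(j < N) (b ^+ j * cis (2 * node k) ^+ j) - 1.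
  have := subrX1 (b * cis (2 * node k)) N.
  rewrite exprMn cis_node_unity mulr1; under eq_bigr do rewrite exprMn.
  move: (\sum_(_ < _) _) => S hS; rewrite /herglotz.
  have -> : S = (1 - b ^+ N) * (1 - b * cis (2 * node k))^-1.
    apply: (mulIf (D k)); rewrite mulfVK//.
    by rewrite -[1 - b ^+ N]opprB hS; ring.
  by field; rewrite D D'.
under eq_bigr do rewrite E.
rewrite big_split /= sumr_const card_ord -mulr_sumr exchange_big /=.
under eq_bigr => j _ do rewrite -mulr_sumr sum_roots//.
case: N N0 D' => // n _ D'; rewrite big_ord_recl /= expr0 mul1r big1 => [|i _];
  last by rewrite mulr0.
rewrite addr0 /herglotz; move: (b ^+ _) D' => x D'; rewrite mulNrn.
by field.
Qed.

End discrete_poisson_kernel.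

(** * Conformal map onto the disc and approximate outer functions *)

Section outer_functions.
Context (R : realType).
Notation scal := (R[i]^o).

Definition half_plane (z : R[i]) : R[i] := cexp ((0 +i* pi) * z).
Definition disc (z : R[i]) : R[i] :=
  (half_plane z - (0 +i* 1)) * (half_plane z + (0 +i* 1))^-1.

Lemma Im_half_plane_ge0 z : strip z -> 0 <= complex.Im (half_plane z).
Proof.
case: z => x y /= /andP[x0 x1]; rewrite /half_plane /cexp /= !mul0r addr0 add0r.
rewrite mulr_ge0 ?expR_ge0// sin_ge0_pi// add0r mulr_ge0 ?pi_ge0//=.
by rewrite ler_piMr ?pi_ge0.
Qed.

Lemma half_plane_neq0 z : strip z -> half_plane z + (0 +i* 1) != 0.
Proof.
move=> /Im_half_plane_ge0; case: (half_plane z) => a b /= b0.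
by rewrite eq_complex /= negb_and orbC gt_eqF// ltr_wpDl.
Qed.

Lemma cabs_disc_le1 z : strip z -> cabs (disc z) <= 1.
Proof.
move=> zs; have := Im_half_plane_ge0 zs; have := half_plane_neq0 zs.
rewrite /disc -cabs_gt0 => c0 i0; rewrite cabsM cabsV ler_pdivrMr// mul1r.
rewrite -ler_sqr ?nnegrE ?cabs_ge0// !sqr_cabs.
case: (half_plane z) i0 {c0} => a b /= b0; lra.
Qed.

Lemma holo2_disc : holo2 disc.
Proof.
have hw : holo2 half_plane.
  by apply: holo2_cexp; apply: holo2M; [exact: holo2_cst|exact: holo2_id].
apply: holo2M; first by apply: holo2B => //; exact: holo2_cst.
by apply: holo2_inv; [exact: half_plane_neq0|apply: holo2D => //; exact: holo2_cst].
Qed.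

(** Take [s = arccot w]: then [w + i] and [w - i] are exp(i s) and exp(- i s) divided by [sin s], so
    their quotient is [cis (- 2 * s)]. *)
Lemma disc_boundary z (w : R) : half_plane z = w%:C ->
  exists s, [/\ 0 <= s <= pi, disc z = cis (- 2 * s), 0 < sin s & cos s / sin s = w].
Proof.
move=> zw; pose k := cos (atan w).
have k0 : 0 < k by apply: cos_gt0_pihalf; rewrite atan_gtNpi2 atan_ltpi2.
have sk : sin (atan w) = w * k.
  by rewrite -{2}(atanK w) /tan divfK// gt_eqF.
have sin_s : sin (pi / 2 - atan w) = k.
  by rewrite -opprB sinN sinBpihalf opprK.
have cos_s : cos (pi / 2 - atan w) = w * k.
  by rewrite -cosN opprB cosBpihalf.
have k2 : k ^+ 2 * (1 + w ^+ 2) = 1.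
  by have := cos2Dsin2 (pi / 2 - atan w); rewrite sin_s cos_s; lra.
clearbody k.
exists (pi / 2 - atan w); split.
- have := atan_gtNpi2 w; have := atan_ltpi2 w; lra.
- have w0 : w%:C + (0 +i* 1) != 0 :> R[i].
    by rewrite eq_complex /= add0r negb_and oner_eq0 orbT.
  rewrite /disc zw; apply: (canLR (mulfK w0)).
  rewrite /cis mulNr cosN sinN !mulr_natl cos_mulr2n sin_mulr2n sin_s cos_s.
  apply/eqP; rewrite eq_complex /=; apply/andP; split; apply/eqP.
    rewrite [RHS](_ : _ = 2 * w * (k ^+ 2 * (1 + w ^+ 2)) - w); last by ring.
    by rewrite k2; ring.
  by ring.
- by rewrite sin_s.
- by rewrite sin_s cos_s mulfK// gt_eqF.
Qed.

Lemma cabs_herglotz (r : R) x : r < 1 -> cabs x <= r -> cabs (herglotz x) <= 2 / (1 -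
  r).
Proof.
move=> r1 xr; rewrite /herglotz cabsM cabsV.
have h1 : cabs (1 + x) <= 2 by rewrite (le_trans (cabsD _ _))// cabs1; lra.
have h2 : 1 - r <= cabs (1 - x).
  by have := cabsD (1 - x) x; rewrite subrK cabs1; lra.
have r0 : 0 < 1 - r by rewrite subr_gt0.
rewrite ler_pM ?cabs_ge0 ?invr_ge0 ?cabs_ge0//.
by rewrite lef_pV2 ?posrE// (lt_le_trans r0).
Qed.

Lemma expn_small (r e : R) : 0 <= r < 1 -> 0 < e -> exists N, (0 < N)%N /\ r ^+ N < e.
Proof.
move=> /andP[r0 r1] e0.
have : r ^+ n @[n --> \oo] --> 0 by apply: cvg_expr; rewrite ger0_norm.
move=> /cvgrPdist_lt /(_ _ e0)[n _ hn]; exists n.+1; split => //.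
by have := hn n.+1 (leqnSn n); rewrite sub0r normrN ger0_norm// exprn_ge0.
Qed.

(** [P] is the Herglotz integral of the boundary data with two approximations: the disc is shrunk by
    a factor [r < 1], which keeps [P] analytic up to the boundary, and the integral becomes a sum
    over N-th roots of unity. The radius is adapted to the modulus of continuity of the data, then
    [N] to the radius. *)
Lemma outer_function_exists (u0 u1 : R -> R) (L : R) :
  continuous u0 -> continuous u1 ->
  u0 t @[t --> +oo] --> L -> u0 t @[t --> -oo] --> L ->
  u1 t @[t --> +oo] --> L -> u1 t @[t --> -oo] --> L ->
  forall e : R, 0 < e -> exists P : R[i] -> scal, [/\ holo2 P,
    exists B : R, forall z, strip z -> cabs (P z) <= B,
    forall t, `|complex.Re (P (0 +i* t)) - u0 t| <= e &
    forall t, `|complex.Re (P (1 +i* t)) - u1 t| <= e].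
Proof.
move=> u0c u1c u0p u0m u1p u1m e e0.
pose U := circle_data u0 u1 L.
have Uc : continuous U by exact: circle_data_continuous.
have U0 : U 0 = U pi by rewrite /U /circle_data sin0 sinpi eqxx.
have pi0 : 0 < pi :> R := pi_gt0 R.
have [M M0 UM] : exists2 M : R, 0 < M & forall s, 0 <= s <= pi -> `|U s| <= M.
  have nUc : continuous (fun s => `|U s|) by move=> s; apply: cvg_norm; exact: Uc.
  have [c _ hc] := EVT_max (ltW pi0) (continuous_subspaceT nUc).
  exists (1 + `|U c|); first by rewrite ltr_pwDl.
  by move=> s s0; rewrite (le_trans (hc s _)) ?in_itv//= lerDr.
have e60 : 0 < e / 6 by rewrite divr_gt0.
have [d d0 Ud] := sin_modulus Uc U0 e60.
have d20 : 0 < d ^+ 2 by rewrite exprn_gt0.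
pose r : R := 1 - Num.min (1 / 2) (e / 6 * d ^+ 2 / (2 * M)).
have m0 : 0 < Num.min (1 / 2) (e / 6 * d ^+ 2 / (2 * M)) by rewrite lt_min !divr_gt0
  ?mulr_gt0.
have m1 : Num.min (1 / 2) (e / 6 * d ^+ 2 / (2 * M)) <= 1 / 2 by rewrite ge_min lexx.
have r1 : r < 1 by rewrite /r; lra.
have r2 : 1 / 2 <= r by rewrite /r; lra.
have r0 : 0 < r by lra.
have rM : 2 * M * (1 - r) <= e / 6 * d ^+ 2.
  by rewrite mulrC -ler_pdivlMr ?mulr_gt0// /r opprB addrC subrK ge_min lexx orbT.
clearbody r.
(* The mean of the kernel differs from 1 by at most [3 * r ^+ N]. The first bound keeps that mean
   below 2; the second makes the deviation, multiplied by [M], at most [e / 4]. *)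
have [N [N0 rN]] : exists N, (0 < N)%N /\ r ^+ N < Num.min (1 / 3) (e / (12 * M)).
  by apply: expn_small; [rewrite (ltW r0)|rewrite lt_min !divr_gt0 ?mulr_gt0].
have NR0 : 0 < N%:R :> R by rewrite ltr0n.
pose node k : R := pi * k%:R / N%:R.
have node_pi k : (k < N)%N -> 0 <= node k <= pi.
  move=> kN; rewrite /node divr_ge0 ?mulr_ge0 ?(ltW pi0) ?ler0n//=.
  by rewrite ler_pdivrMr// ler_pM2l// ler_nat ltnW.
pose arg k z : R[i] := r%:C * disc z * cis (2 * node k).
have arg_le k z : strip z -> cabs (arg k z) <= r.
  move=> zs; rewrite /arg cabsM cabs_cis mulr1 cabsM cabs_real gtr0_norm//.
  by rewrite ler_piMr ?(ltW r0) ?cabs_disc_le1.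
pose P z : R[i] := \sum_(k < N) (U (node k) / N%:R)%:C * herglotz (arg k z).
have hP : holo2 P.
  apply: holo2_sum => k; apply: holo2M; first exact: holo2_cst.
  have ha : holo2 (fun z => arg k z).
    by apply: holo2M; [apply: holo2M;
      [exact: holo2_cst|exact: holo2_disc]|exact: holo2_cst].
  apply: holo2M; first by apply: holo2D => //; exact: holo2_cst.
  apply: holo2_inv; last by apply: holo2B => //; exact: holo2_cst.
  move=> z /(arg_le k) ar; rewrite subr_eq0 eq_sym; apply/eqP => a1.
  by move: ar; rewrite a1 cabs1 leNgt r1.
have bd z w : strip z -> half_plane z = w%:C -> `|complex.Re (P z) - glued u0 u1 L w|
  <= e.
  move=> zs /disc_boundary[s [spi zd ss cs]].
  have <- : U s = glued u0 u1 L w by rewrite /U /circle_data gt_eqF// cs.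
  pose K k := complex.Re (herglotz (arg k z)).
  have KE k : K k = (1 - r ^+ 2) / ((1 - r) ^+ 2 + 4 * r * sin (s - node k) ^+ 2).
    rewrite -Re_herglotz /K /arg zd -mulrA -cisD;
      congr (complex.Re (herglotz (_ * cis _))).
    by ring.
  have r21 : 0 < 1 - r ^+ 2 by rewrite subr_gt0 exprn_ilt1 ?(ltW r0).
  have r12 : 0 < (1 - r) ^+ 2 by rewrite exprn_gt0// subr_gt0.
  have den k : 0 < (1 - r) ^+ 2 + 4 * r * sin (s - node k) ^+ 2.
    by rewrite ltr_pwDl// mulr_ge0 ?sqr_ge0// mulr_ge0// ltW.
  have K0 k : 0 < K k by rewrite KE divr_gt0.
  (* Near [s] the data vary by at most [e / 6]; elsewhere the kernel is at most
     [(1 - r^2) / (4 r d^2)], which the choice of [r] makes at most [e / 6] after multiplication by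
     [2 * M]. *)
  have dev k : (k < N)%N -> `|U (node k) - U s| * K k <= e / 6 * K k + e / 6.
    move=> kN; have kpi := node_pi _ kN.
    have [sd|sd] := ltP `|sin (s - node k)| d.
      by rewrite -[leLHS]addr0 lerD ?(ltW e60)// ler_wpM2r ?(ltW (K0 _))// distrC
        ltW// Ud.
    have eK : 0 <= e / 6 * K k by apply: mulr_ge0; apply: ltW.
    rewrite -[leLHS]add0r lerD//.
    have UU : `|U (node k) - U s| <= 2 * M.
      by rewrite (le_trans (ler_normB _ _))// mulr_natl mulr2n lerD ?UM.
    apply: (@le_trans _ _ (2 * M * K k)); first by rewrite ler_wpM2r ?UU ?(ltW (K0 k)).
    rewrite KE mulrA ler_pdivrMr//.
    have sd2 : d ^+ 2 <= sin (s - node k) ^+ 2.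
      by rewrite -[leRHS]real_normK ?num_real// ler_sqr ?nnegrE ?(ltW d0).
    have : 2 * M * (1 - r ^+ 2) <= e / 6 * (2 * d ^+ 2).
      rewrite (_ : 1 - r ^+ 2 = (1 - r) * (1 + r)); last by ring.
      have : 0 <= e / 6 * d ^+ 2 by rewrite mulr_ge0 ?ltW.
      nra.
    move=> h; apply: le_trans h _; rewrite ler_wpM2l ?(ltW e60)//.
    nra.
  pose b := (r%:C * disc z) ^+ N.
  have cb : cabs b = r ^+ N.
    rewrite /b exprMn cabsM zd cisX cabs_cis mulr1 -rmorphXn /= cabs_real.
    by rewrite ger0_norm// exprn_ge0// ltW.
  move: rN; rewrite lt_min => /andP[rN1 rN2].
  have b1 : b != 1 by apply/eqP => b1; move: cb; rewrite b1 cabs1; lra.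
  have hb : `|complex.Re (herglotz b) - 1| <= 3 * r ^+ N.
    have -> : complex.Re (herglotz b) - 1 = complex.Re (herglotz b - 1) by rewrite
      raddfB.
    rewrite (le_trans (normr_Re_le _))//.
    have D : 1 - b != 0 by rewrite subr_eq0 eq_sym.
    have -> : herglotz b - 1 = 2 * b * (1 - b)^-1 by rewrite /herglotz; field.
    rewrite !cabsM cabsV cb (_ : cabs 2 = 2);
      last by rewrite -[2](rmorph_nat (real_complex R)) cabs_real normr_nat.
    have h2 : 2 / 3 <= cabs (1 - b) by have := cabsD (1 - b) b;
      rewrite subrK cabs1 cb; lra.
    rewrite ler_pdivrMr; last by rewrite cabs_gt0.
    have q0 : 0 <= r ^+ N by rewrite exprn_ge0// ltW.
    by have := ler_wpM2l q0 h2; lra.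
  have sumK : \sum_(k < N) K k = N%:R * complex.Re (herglotz b).
    rewrite -Re_sum /arg sum_herglotz// -Re_realM; congr (complex.Re (_ * _)).
    by rewrite rmorph_nat.
  have RP : complex.Re (P z) = N%:R^-1 * \sum_(k < N) U (node k) * K k.
    rewrite /P Re_sum mulr_sumr; apply: eq_bigr => k _.
    by rewrite Re_realM mulrAC mulrC.
  rewrite RP (_ : _ - _ = N%:R^-1 * (\sum_(k < N) (U (node k) - U s) * K k) +
     U s * (complex.Re (herglotz b) - 1)); last first.
    under [in RHS]eq_bigr do rewrite mulrBl.
    rewrite sumrB -mulr_sumr sumK; field; rewrite gt_eqF//.
  rewrite (le_trans (ler_normD _ _))// (splitr e) lerD//; last first.
    rewrite normrM (@le_trans _ _ (M * (3 * r ^+ N)))//; first by rewrite ler_pM ?UM.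
    by move: rN2; rewrite ltr_pdivlMr ?mulr_gt0//; lra.
  rewrite normrM gtr0_norm ?invr_gt0// mulrC ler_pdivrMr//.
  rewrite (le_trans (ler_norm_sum _ _ _))//.
  rewrite (@le_trans _ _ (\sum_(k < N) (e / 6 * K k + e / 6)))//.
    by apply: ler_sum => k _; rewrite normrM (gtr0_norm (K0 _)) dev.
  rewrite big_split /= sumr_const card_ord -mulr_sumr sumK -[_ *+ N]mulr_natr.
  have : complex.Re (herglotz b) <= 2 by move: hb; rewrite ler_norml => /andP[_]; lra.
  move=> h2; have : e / 6 * (N%:R * complex.Re (herglotz b)) <= e / 6 * (N%:R * 2).
    by rewrite ler_wpM2l ?(ltW e60)// ler_wpM2l// ltW.
  lra.
exists P; split => //.
- exists (\sum_(k < N) `|U (node k) / N%:R| * (2 / (1 - r))) => z zs.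
  rewrite (le_trans (cabs_sum _ _ _))//; apply: ler_sum => k _.
  by rewrite cabsM cabs_real ler_wpM2l// cabs_herglotz// arg_le.
- move=> t; have := @bd (0 +i* t) (expR (- pi * t)).
  rewrite /glued expR_gt0 expRK mulNr opprK [pi * t]mulrC mulfK ?gt_eqF//; apply.
    by rewrite /strip /= lexx ler01.
  rewrite /half_plane.
  have -> : (0 +i* pi) * (0 +i* t) = (- pi * t)%:C :> R[i].
    by apply/eqP; rewrite eq_complex /= !mul0r mulr0 addr0 sub0r mulNr !eqxx.
  by rewrite cexp_real mulNr [pi * t]mulrC.
- move=> t; have := @bd (1 +i* t) (- expR (- pi * t)).
  rewrite /glued oppr_gt0 oppr_lt0 ltNge expR_ge0 /= expR_gt0 opprK expRK mulNr opprK
    [pi * t]mulrC mulfK ?gt_eqF//; apply.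
    by rewrite /strip /= lexx ler01.
  rewrite /half_plane.
  have -> : (0 +i* pi) * (1 +i* t) = (- pi * t)%:C + (0 +i* pi) :> R[i].
    by apply/eqP; rewrite eq_complex /=; apply/andP; split; apply/eqP; ring.
  rewrite cexpD cexp_real -cisE /cis cospi sinpi mulNr [pi * t]mulrC.
  by apply/eqP; rewrite eq_complex /=; apply/andP; split; apply/eqP; ring.
Qed.
End outer_functions.

(** * Calderon's space of analytic functions *)

Section calderon_operations.
Context (R : realType).


Lemma within_stripP (V : normedModType R[i]) (F : R[i]^o -> V) :
  {within @strip R, continuous F} <-> forall z, strip z -> forall e : R, 0 < e ->
    exists2 d : R, 0 < d & forall w, strip w -> cabs (w - z) < d -> rnorm (F w - F z)
      < e.
Proof.
split=> [/subspace_continuousP Fc z zs e e0|H].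
  have /rnorm_cvgP/(_ _ e0) := Fc _ zs; rewrite near_withinE => /nbhs_cabsP[d d0 dP].
  by exists d => // w ws wd; exact: dP.
apply/subspace_continuousP => z zs; apply/rnorm_cvgP => e e0.
have [d d0 dP] := H _ zs _ e0; rewrite near_withinE; apply/nbhs_cabsP.
by exists d => // w wd ws; exact: dP.
Qed.

Definition multiplier (a : R[i] -> R[i]^o) := holo1 a /\
  exists B : R, forall z, strip z -> cabs (a z) <= B.

Lemma multiplier_line (a : R[i] -> R[i]^o) (x : R) : multiplier a -> 0 <= x <= 1 ->
  continuous (fun t : R => a (x +i* t)).
Proof.
move=> [[a1 ha] _] x01 t; apply/(rnorm_cvgP (V := R[i]^o)) => e e0.
have [d d0 dP] := is_cderive_continuous (ha (x +i* t) x01) e0.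
exists d => // s /=; rewrite distrC => sd.
rewrite (_ : x +i* s = (x +i* t) + (0 +i* (s - t))); last first.
  by congr (_ +i* _); [rewrite addr0|rewrite addrC subrK].
by apply: dP; rewrite cabs_def /= expr0n add0r sqrtr_sqr.
Qed.

Context (A0 A1 : normedModType R[i]) (c : compatible_couple A0 A1).
Implicit Types (F G : calderon_space c).

Lemma bounded_scale_cvg0 (V : normedModType R[i]) (a : R -> R[i]) (b : R -> V) (B : R)
    (E : set_system R) : Filter E ->
  (forall t, cabs (a t) <= B) -> b t @[t --> E] --> 0 -> a t *: b t @[t --> E] --> 0.
Proof.
move=> FE aB /rnorm_cvgP b0; apply/rnorm_cvgP => e e0.
have B0 : 0 < 1 + `|B| by rewrite ltr_pwDl.
have := b0 _ (divr_gt0 e0 B0); apply: filterS => t; rewrite !subr0 ltr_pdivlMr// => h.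
rewrite rnormZc (le_lt_trans _ h)// mulrC ler_wpM2l ?rnorm_ge0//.
by rewrite (le_trans (aB t))// (le_trans (ler_norm _))// lerDr.
Qed.

Lemma calderon_mul (a : R[i] -> R[i]^o) F : multiplier a -> exists G,
  [/\ forall z, G z = a z *: F z, forall t, bdry0 G t = a (0 +i* t) *: bdry0 F t
    & forall t, bdry1 G t = a (1 +i* t) *: bdry1 F t].
Proof.
move=> ma; have [[a1 ha] [B aB]] := ma.
have s0 : 0 <= (0 : R) <= 1 by rewrite lexx ler01.
have s1 : 0 <= (1 : R) <= 1 by rewrite lexx ler01.
have l0 := multiplier_line ma s0; have l1 := multiplier_line ma s1.
have B0 t : cabs (a (0 +i* t)) <= B by apply: aB.
have B1 t : cabs (a (1 +i* t)) <= B by apply: aB.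
have bd0 : 0 <= B by rewrite (le_trans _ (B0 0))// cabs_ge0.
have h1 : {within @strip R, continuous (fun z => a z *: F z : sum_space c)}.
  apply/within_stripP => z zs e e0.
  have e20 : 0 < e / 2 by rewrite divr_gt0.
  have p1 : 0 < 1 + B by rewrite ltr_pwDl.
  have p2 : 0 < 1 + rnorm (F z) by rewrite ltr_pwDl// rnorm_ge0.
  have [d1 d10 h1] := (within_stripP _).1 (@calderon_continuous _ _ _ _ F) _ zs _
    (divr_gt0 e20 p1).
  have [d2 d20 h2] := is_cderive_continuous (ha _ zs) (divr_gt0 e20 p2).
  exists (Num.min d1 d2); first by rewrite lt_min d10.
  move=> w ws; rewrite lt_min => /andP[/(h1 _ ws) {}h1 /h2 {}h2].
  rewrite [z + _]addrC subrK in h2.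
  rewrite (_ : _ - _ = a w *: (F w - F z) + (a w - a z) *: F z); last first.
    by rewrite scalerBr scalerBl addrA subrK.
  rewrite (le_lt_trans (ler_rnormD _ _))// (splitr e) ltr_leD//.
    rewrite rnormZc; move: h1; rewrite ltr_pdivlMr// => h1; apply: le_lt_trans h1.
    by rewrite mulrC ler_wpM2l ?rnorm_ge0// (le_trans (aB _ ws))// lerDr.
  rewrite rnormZc; move: h2; rewrite ltr_pdivlMr// => /ltW h2; apply: le_trans h2.
  by rewrite ler_wpM2l ?cabs_ge0// lerDr.
have h2 : exists M : R, forall z, strip z -> rnorm (a z *: F z : sum_space c) <= M.
  have [M FM] := calderon_bounded F; exists (B * M) => z zs.
  by rewrite rnormZc ler_pM ?cabs_ge0 ?rnorm_ge0 ?aB ?FM.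
have h3 (z : R[i]) : open_strip z -> derivable (fun w : R[i]^o => a w *: F w :
  sum_space c) z 1.
  move=> zs; have [D hD] := derivable_is_cderive (@calderon_holomorphic _ _ _ _ F _ zs).
  have zs' : strip z by case/andP: zs => x0 x1; rewrite /strip /= (ltW x0) (ltW x1).
  exact: is_cderive_derivable (is_cderive_scale (ha _ zs') hD).
have h4 t : sum_val (a (0 +i* t) *: F (0 +i* t)) = emb0 c (a (0 +i* t) *: bdry0 F t).
  by rewrite sum_valZ bdry0E linearZ_LR.
have h5 t : sum_val (a (1 +i* t) *: F (1 +i* t)) = emb1 c (a (1 +i* t) *: bdry1 F t).
  by rewrite sum_valZ bdry1E linearZ_LR.
have h6 : continuous (fun t : R => a (0 +i* t) *: bdry0 F t).
  by move=> t; apply: cvgZ; [exact: l0|exact: bdry0_continuous].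
have h7 : continuous (fun t : R => a (1 +i* t) *: bdry1 F t).
  by move=> t; apply: cvgZ; [exact: l1|exact: bdry1_continuous].
have h8 : (fun t : R => a (0 +i* t) *: bdry0 F t) @ +oo --> (0 : A0) /\ (fun t : R =>
  a (0 +i* t) *: bdry0 F t) @ -oo --> (0 : A0).
  by have [? ?] := bdry0_cvg0 F; split; apply: bounded_scale_cvg0.
have h9 : (fun t : R => a (1 +i* t) *: bdry1 F t) @ +oo --> (0 : A1) /\ (fun t : R =>
  a (1 +i* t) *: bdry1 F t) @ -oo --> (0 : A1).
  by have [? ?] := bdry1_cvg0 F; split; apply: bounded_scale_cvg0.
by exists (CalderonSpace h1 h2 h3 h4 h5 h6 h7 h8 h9).
Qed.

Lemma calderon_add F G : exists E : calderon_space c,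
  [/\ forall z, E z = F z + G z, forall t, bdry0 E t = bdry0 F t + bdry0 G t
    & forall t, bdry1 E t = bdry1 F t + bdry1 G t].
Proof.
have h1 : {within @strip R, continuous (fun z => F z + G z : sum_space c)}.
  by move=> z; apply: cvgD; exact: calderon_continuous.
have h2 : exists M : R, forall z, strip z -> rnorm (F z + G z : sum_space c) <= M.
  have [M FM] := calderon_bounded F; have [N GN] := calderon_bounded G.
  exists (M + N) => z zs; rewrite (le_trans (ler_rnormD _ _))// lerD//;
    [exact: FM|exact: GN].
have h3 (z : R[i]) : open_strip z -> derivable (fun w : R[i]^o => F w + G w :
  sum_space c) z 1.
  by move=> zs; apply: derivableD; exact: calderon_holomorphic.
have h4 t : sum_val (F (0 +i* t) + G (0 +i* t)) = emb0 c (bdry0 F t + bdry0 G t).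
  by rewrite sum_valD !bdry0E raddfD.
have h5 t : sum_val (F (1 +i* t) + G (1 +i* t)) = emb1 c (bdry1 F t + bdry1 G t).
  by rewrite sum_valD !bdry1E raddfD.
have h6 : continuous (fun t : R => bdry0 F t + bdry0 G t).
  by move=> t; apply: cvgD; exact: bdry0_continuous.
have h7 : continuous (fun t : R => bdry1 F t + bdry1 G t).
  by move=> t; apply: cvgD; exact: bdry1_continuous.
have h8 : (fun t : R => bdry0 F t + bdry0 G t) @ +oo --> (0 : A0) /\ (fun t : R =>
  bdry0 F t + bdry0 G t) @ -oo --> (0 : A0).
  have [f1 f2] := bdry0_cvg0 F; have [g1 g2] := bdry0_cvg0 G.
  by split; rewrite -[X in _ --> X]addr0; apply: cvgD.
have h9 : (fun t : R => bdry1 F t + bdry1 G t) @ +oo --> (0 : A1) /\ (fun t : R =>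
  bdry1 F t + bdry1 G t) @ -oo --> (0 : A1).
  have [f1 f2] := bdry1_cvg0 F; have [g1 g2] := bdry1_cvg0 G.
  by split; rewrite -[X in _ --> X]addr0; apply: cvgD.
by exists (CalderonSpace h1 h2 h3 h4 h5 h6 h7 h8 h9).
Qed.

Lemma calderon_zero : exists E : calderon_space c,
  [/\ forall z, E z = 0, forall t, bdry0 E t = 0 & forall t, bdry1 E t = 0].
Proof.
have h1 : {within @strip R, continuous (fun=> 0 : sum_space c)} by move=> z;
  exact: cvg_cst.
have h2 : exists M : R, forall z, @strip R z -> rnorm (0 : sum_space c) <= M.
  by exists 0 => z _; rewrite rnorm0.
have h3 (z : R[i]) : open_strip z -> derivable (fun _ : R[i]^o => 0 : sum_space c) z 1
  by move=> _; exact: derivable_cst.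
have h4 (t : R) : sum_val (0 : sum_space c) = emb0 c 0 by rewrite sum_val0 raddf0.
have h5 (t : R) : sum_val (0 : sum_space c) = emb1 c 0 by rewrite sum_val0 raddf0.
have h6 : continuous (fun _ : R => 0 : A0) by move=> t; exact: cvg_cst.
have h7 : continuous (fun _ : R => 0 : A1) by move=> t; exact: cvg_cst.
have h8 : (fun _ : R => 0 : A0) @ +oo --> (0 : A0) /\ (fun _ : R => 0 : A0) @ -oo -->
  (0 : A0) by split; exact: cvg_cst.
have h9 : (fun _ : R => 0 : A1) @ +oo --> (0 : A1) /\ (fun _ : R => 0 : A1) @ -oo -->
  (0 : A1) by split; exact: cvg_cst.
by exists (CalderonSpace h1 h2 h3 h4 h5 h6 h7 h8 h9).
Qed.

(** The form in which one row of an analytic family of matrices acts on a family of Calderon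
    functions. *)
Lemma calderon_lincomb (I : Type) (r : seq I) (a : I -> R[i] -> R[i]^o) (F : I ->
  calderon_space c) :
  (forall i, multiplier (a i)) -> exists G : calderon_space c,
  [/\ forall z, G z = \sum_(i <- r) a i z *: F i z,
      forall t, bdry0 G t = \sum_(i <- r) a i (0 +i* t) *: bdry0 (F i) t
    & forall t, bdry1 G t = \sum_(i <- r) a i (1 +i* t) *: bdry1 (F i) t].
Proof.
move=> ma; elim: r => [|i r [G [G0 G1 G2]]].
  have [E [E0 E1 E2]] := calderon_zero.
  by exists E; split=> *; rewrite big_nil.
have [K [K0 K1 K2]] := calderon_mul (F i) (ma i).
have [E [E0 E1 E2]] := calderon_add K G.
by exists E; split=> *; rewrite big_cons ?E0 ?E1 ?E2 ?K0 ?K1 ?K2 ?G0 ?G1 ?G2.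
Qed.

(** Makes the suprema in [calderon_norm] suprema of bounded sets. *)
Lemma vanishing_bounded (V : normedModType R[i]) (b : R -> V) : continuous b ->
  b t @[t --> +oo] --> 0 -> b t @[t --> -oo] --> 0 -> exists M : R, forall t, rnorm (b
    t) <= M.
Proof.
move=> bc /rnorm_cvgP/(_ _ ltr01)[A1' [_ h1]] /rnorm_cvgP/(_ _ ltr01)[A2 [_ h2]].
have nc : continuous (fun t => rnorm (b t)).
  move=> t; apply/cvgrPdist_lt => e e0; have /rnorm_cvgP/(_ _ e0) := bc t.
  by apply: filterS => s; rewrite distrC; apply: le_lt_trans; exact: ler_dist_rnorm.
pose A := `|A1'| + `|A2| + 1.
have A0' : - A <= A by rewrite /A -subr_ge0 opprK !addr_ge0.
have [s _ hs] := EVT_max A0' (continuous_subspaceT nc).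
exists (1 + rnorm (b s)) => t.
have [tA|tA] := boolP (t \in `[- A, A]); first by rewrite (le_trans (hs _ tA))// lerDr.
move: tA; rewrite in_itv /= negb_and -!ltNge => tA.
have : rnorm (b t) <= 1.
  rewrite -[b t]subr0 ltW//; have := ler_norm A1'; have := ler_norm (- A2);
    rewrite normrN.
  have := normr_ge0 A1'; have := normr_ge0 A2.
  by case/orP: tA; rewrite /A => tA *; [apply: h2; lra|apply: h1; lra].
by move=> h; rewrite (le_trans h)// lerDl rnorm_ge0.
Qed.

Lemma bdry_le_calderon_norm F t :
  rnorm (bdry0 F t) <= calderon_norm F /\ rnorm (bdry1 F t) <= calderon_norm F.
Proof.
have [c0 c1] := bdry0_cvg0 F; have [c2 c3] := bdry1_cvg0 F.
have [M0 h0] := vanishing_bounded (@bdry0_continuous _ _ _ _ F) c0 c1.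
have [M1 h1] := vanishing_bounded (@bdry1_continuous _ _ _ _ F) c2 c3.
rewrite /calderon_norm !le_max; split; apply/orP; [left|right]; apply: ub_le_sup.
- by exists M0 => _ [s _ <-].
- by exists t.
- by exists M1 => _ [s _ <-].
- by exists t.
Qed.

Lemma calderon_norm_le F M : (forall t, rnorm (bdry0 F t) <= M) ->
  (forall t, rnorm (bdry1 F t) <= M) -> calderon_norm F <= M.
Proof.
move=> h0 h1; rewrite /calderon_norm ge_max; apply/andP; split; apply: ge_sup.
- by exists (rnorm (bdry0 F 0)), 0.
- by move=> _ [t _ <-].
- by exists (rnorm (bdry1 F 0)), 0.
- by move=> _ [t _ <-].
Qed.

Lemma calderon_norm_ge0 F : 0 <= calderon_norm F.
Proof. by rewrite (le_trans _ (bdry_le_calderon_norm F 0).1)// rnorm_ge0. Qed.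

Lemma interp_norm_le (theta : R) F : interp_norm theta (F theta%:C) <= calderon_norm F.
Proof.
apply: ge_inf; last by exists F.
by exists 0 => _ [G _ <-]; exact: calderon_norm_ge0.
Qed.

Lemma interp_norm_ge0 (theta : R) (a : sum_space c) : 0 <= interp_norm theta a.
Proof.
rewrite /interp_norm; set S := [set _ | _ in _].
(* Outside the interpolation space the set is empty, and its infimum is 0 by convention. *)
have [->|/set0P ne] := eqVneq S set0; first by rewrite inf0.
by apply: lb_le_inf => // _ [G _ <-]; exact: calderon_norm_ge0.
Qed.

Lemma interp_norm_approx (theta : R) (a : sum_space c) (e : R) : interp_space theta a
  -> 0 < e ->
  exists F : calderon_space c, F theta%:C = a /\ calderon_norm F < interp_norm theta a
    + e.
Proof.
move=> [F0 F0a] e0.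
have hi : has_inf [set calderon_norm f | f in [set f : calderon_space c | f theta%:C =
  a]].
  split; first by exists (calderon_norm F0), F0.
  by exists 0 => _ [G _ <-]; exact: calderon_norm_ge0.
by have [_ [F Fa <-] lt] := inf_adherent e0 hi; exists F.
Qed.

End calderon_operations.

(** * Interpolation of l_p sums of norms *)

Section interpolation_of_sums.
Context (R : realType).

Lemma powR_continuous_ge0 (p : R) : 0 < p -> forall x : R, 0 <= x -> forall e : R, 0 <
  e ->
  exists2 d : R, 0 < d & forall y, 0 <= y -> `|y - x| < d -> `|y `^ p - x `^ p| < e.
Proof.
move=> p0 x; rewrite le_eqVlt => /predU1P[<-|x0] e e0.
  exists (e `^ p^-1); first exact: powR_gt0.
  move=> y y0; rewrite subr0 ger0_norm// powR0 ?gt_eqF// subr0 ger0_norm ?powR_ge0//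
    => ye.
  have -> : e = (e `^ p^-1) `^ p by rewrite -powRrM mulVf ?gt_eqF// powRr1// ltW.
  by rewrite gt0_ltr_powR// nnegrE// powR_ge0.
have dx : derivable (@powR R ^~ p) x 1 by apply: derivable_powR; rewrite in_itv /= x0.
have /cvgrPdist_lt/(_ _ e0)[d /= d0 dP] := differentiable_continuous
  ((derivable1_diffP _ _).1 dx).
by exists d => // y y0 yd; rewrite distrC; apply: dP; rewrite /= distrC.
Qed.

Lemma cvg_rnorm_powR (V : normedModType R[i]) (p : R) (b : R -> V) (l : V) (E :
  set_system R) :
  Filter E -> 0 < p -> b t @[t --> E] --> l -> rnorm (b t) `^ p @[t --> E] --> rnorm l
    `^ p.
Proof.
move=> FE p0 bl; apply/cvgrPdist_lt => e e0.
have [d d0 dP] := powR_continuous_ge0 p0 (rnorm_ge0 l) e0.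
have /rnorm_cvgP/(_ _ d0) := bl; apply: filterS => t h.
by rewrite distrC; apply: dP; rewrite ?rnorm_ge0// (le_lt_trans (ler_dist_rnorm _ _)).
Qed.

Lemma cvg_log_bdry (V : normedModType R[i]) (p eta : R) (b : R -> V) (l : V) (E :
  set_system R) :
  Filter E -> 0 < p -> 0 < eta -> b t @[t --> E] --> l ->
  p^-1 * ln (rnorm (b t) `^ p + eta) @[t --> E] --> p^-1 * ln (rnorm l `^ p + eta).
Proof.
move=> FE p0 eta0 bl; apply: cvgMl_tmp.
apply: (@cvg_comp _ _ _ (fun t => rnorm (b t) `^ p + eta) (@ln R) _ (nbhs (rnorm l `^
  p + eta))).
  by apply: cvgD; [exact: cvg_rnorm_powR|exact: cvg_cst].
by apply: continuous_ln; rewrite ltr_wpDl ?powR_ge0.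
Qed.

Context (A0 A1 : normedModType R[i]) (c : compatible_couple A0 A1).

(* Dividing by an outer function with the boundary moduli of [F] replaces the
   two suprema in the norm of [F] by a geometric mean over the boundary. *)
Lemma interp_norm_outer (theta p eta : R) (F : calderon_space c) :
  0 < theta < 1 -> 0 < p -> 0 < eta ->
  exists P : R[i] -> R[i]^o, [/\ holo2 P,
    exists B : R, forall z, strip z -> cabs (P z) <= B,
    forall t, expR (p * complex.Re (P (0 +i* t))) <= expR (p * eta) * (rnorm (bdry0 F
      t) `^ p + eta),
    forall t, expR (p * complex.Re (P (1 +i* t))) <= expR (p * eta) * (rnorm (bdry1 F
      t) `^ p + eta) &
    interp_norm theta (F theta%:C) `^ p <= expR (p * eta) * expR (p * complex.Re (P
      theta%:C))].
Proof.
move=> /andP[th0 th1] p0 eta0.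
(* [eta] keeps the logarithm finite where the boundary function vanishes, and gives both lines the
   common limit [ln eta / p] at infinity. *)
pose u0 t := p^-1 * ln (rnorm (bdry0 F t) `^ p + eta).
pose u1 t := p^-1 * ln (rnorm (bdry1 F t) `^ p + eta).
have u0c : continuous u0 by move=> t; apply: cvg_log_bdry => //;
  exact: bdry0_continuous.
have u1c : continuous u1 by move=> t; apply: cvg_log_bdry => //;
  exact: bdry1_continuous.
have [b0p b0m] := bdry0_cvg0 F; have [b1p b1m] := bdry1_cvg0 F.
pose L := p^-1 * ln (0 `^ p + eta).
have limp (V : normedModType R[i]) (b : R -> V) : b t @[t --> +oo] --> 0 ->
    p^-1 * ln (rnorm (b t) `^ p + eta) @[t --> +oo] --> L.
  by rewrite /L -(rnorm0 V); exact: cvg_log_bdry.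
have limm (V : normedModType R[i]) (b : R -> V) : b t @[t --> -oo] --> 0 ->
    p^-1 * ln (rnorm (b t) `^ p + eta) @[t --> -oo] --> L.
  by rewrite /L -(rnorm0 V); exact: cvg_log_bdry.
have [P [hP [B PB] P0 P1]] := outer_function_exists u0c u1c
  (limp _ _ b0p) (limm _ _ b0m) (limp _ _ b1p) (limm _ _ b1m) eta0.
have E0 x : 0 <= x -> expR (p * (p^-1 * ln (x `^ p + eta))) = x `^ p + eta.
  by move=> x0; rewrite mulrA divff ?gt_eqF// mul1r lnK// posrE ltr_wpDl ?powR_ge0.
exists P; split => //.
- by exists B.
- move=> t; rewrite -(E0 (rnorm (bdry0 F t)))// ?rnorm_ge0// -expRD ler_expR -mulrDr
  ler_pM2l//.
  by have := P0 t; rewrite ler_norml => /andP[_]; rewrite lerBlDr.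
- move=> t; rewrite -(E0 (rnorm (bdry1 F t)))// ?rnorm_ge0// -expRD ler_expR -mulrDr
  ler_pM2l//.
  by have := P1 t; rewrite ler_norml => /andP[_]; rewrite lerBlDr.
(* This multiplier is 1 at [theta], so the vector represented there is unchanged, while division by
   exp(P) flattens both boundary norms to at most exp(eta + Re P(theta)). *)
pose a z : R[i] := cexp (P theta%:C - P z).
have ma : multiplier a.
  split; first by apply: holo1_cexp; apply: holo2_holo1; apply: holo2B => //;
    exact: holo2_cst.
  exists (expR (B + B)) => z zs; rewrite /a cabs_cexp ler_expR (le_trans (Re_le _))//.
  rewrite (le_trans (cabsD _ _))// cabsN lerD// PB// /strip /=.
  by rewrite !ltW.
have [G [G0 G1 G2]] := calderon_mul F ma.
have Gth : G theta%:C = F theta%:C by rewrite G0 /a subrr cexp0 scale1r.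
rewrite -Gth -expRD -mulrDr.
have Gn : calderon_norm G <= expR (eta + complex.Re (P theta%:C)).
  have key x y : 0 <= x -> `|y - p^-1 * ln (x `^ p + eta)| <= eta ->
      expR (complex.Re (P theta%:C) - y) * x <= expR (eta + complex.Re (P theta%:C)).
    move=> x0; rewrite ler_norml => /andP[xy _].
    have xE : x <= expR (p^-1 * ln (x `^ p + eta)).
      have [->|xn0] := eqVneq x 0; first exact: expR_ge0.
      have x0' : 0 < x by rewrite lt_def xn0.
      rewrite -{1}[x]lnK ?posrE// ler_expR ler_pdivlMl// -ln_powR.
      by rewrite ler_ln ?posrE ?powR_gt0 ?ltr_wpDl ?powR_ge0// lerDl ltW.
    apply: le_trans (ler_wpM2l (expR_ge0 _) xE) _.
    rewrite -expRD ler_expR; lra.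
  apply: calderon_norm_le => t.
    by rewrite G1 rnormZc /a cabs_cexp raddfB; apply: key; rewrite ?rnorm_ge0//;
      exact: P0.
  by rewrite G2 rnormZc /a cabs_cexp raddfB; apply: key; rewrite ?rnorm_ge0//;
    exact: P1.
have -> : expR (p * (eta + complex.Re (P theta%:C))) = expR (eta + complex.Re (P
  theta%:C)) `^ p.
  by rewrite /powR gt_eqF ?expR_gt0// expRK.
by rewrite ge0_ler_powR ?nnegrE ?(ltW p0) ?interp_norm_ge0 ?expR_ge0// (le_trans
  (interp_norm_le _ _)).
Qed.

Lemma le_expR_limit (x D k l : R) :
  (forall eta : R, 0 < eta -> x <= expR (k * eta) * (D + l * eta)) -> x <= D.
Proof.
move=> H; rewrite leNgt; apply/negP => Dx.
have fc : expR (k * eta) * (D + l * eta) @[eta --> (0 : R)] --> expR (k * 0) * (D + l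
  * 0).
  apply: cvgM.
    apply: (@cvg_comp _ _ _ (fun eta : R => k * eta) (@expR R) _ (nbhs (k * 0)));
      last exact: continuous_expR.
    by apply: cvgMl_tmp; exact: cvg_id.
  by apply: cvgD; [exact: cvg_cst|apply: cvgMl_tmp; exact: cvg_id].
rewrite !mulr0 expR0 mul1r addr0 in fc.
have xD0 : 0 < x - D by rewrite subr_gt0.
have [d /= d0 dP] := (cvgrPdist_lt _ _).1 fc _ xD0.
have d20 : 0 < d / 2 by rewrite divr_gt0.
have := dP (d / 2); rewrite /= sub0r normrN gtr0_norm// ltr_pdivrMr// ltr_pMr// ltr1n
  => /(_ isT).
by rewrite distrC => /(le_lt_trans (ler_norm _)); rewrite ltrBlDr subrK ltNge H.
Qed.

(** Each [F i] gives way to a scalar exp(p P_i), of modulus close to the p-th power of its boundary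
    norms. These scalars, rotated by the phases [cc i] so as to be positive at [theta], add up to
    one analytic function, and the maximum principle bounds its real part by [D] up to an error in
    [eta]. *)
Lemma interp_norm_sum_le (I : finType) (theta p D : R) (F : I -> calderon_space c) :
  0 < theta < 1 -> 0 < p ->
  (forall t, \sum_i rnorm (bdry0 (F i) t) `^ p <= D) ->
  (forall t, \sum_i rnorm (bdry1 (F i) t) `^ p <= D) ->
  \sum_i interp_norm theta (F i theta%:C) `^ p <= D.
Proof.
move=> th p0 F0 F1; apply: (@le_expR_limit _ D (p + p) #|I|%:R) => eta eta0.
have [P HP] := choice (fun i => interp_norm_outer (F i) th p0 eta0).
pose cc i : R[i] := cis (- (p * complex.Im (P i theta%:C))).
pose f z : R[i]^o := \sum_i cc i * cexp (p%:C * P i z).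
have hf : holo2 f.
  apply: holo2_sum => i; apply: holo2M; first exact: holo2_cst.
  by apply: holo2_cexp; apply: holo2M; [exact: holo2_cst|by have [] := HP i].
have fle z : complex.Re (f z) <= \sum_i expR (p * complex.Re (P i z)).
  rewrite /f Re_sum; apply: ler_sum => i _; rewrite (le_trans (Re_le _))//.
  by rewrite cabsM cabs_cis mul1r cabs_cexp Re_realM.
have [b hb] := choice (fun i => let: And5 _ h _ _ _ := HP i in h).
have bd (x : I -> R) (u : R[i]) : (forall i, expR (p * complex.Re (P i u)) <= expR (p
  * eta) * (x i + eta)) ->
    \sum_i x i <= D -> complex.Re (f u) <= expR (p * eta) * (D + #|I|%:R * eta).
  move=> hx xD; rewrite (le_trans (fle u))// (le_trans (ler_sum _ (fun i _ => hx i)))//.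
  rewrite -mulr_sumr ler_wpM2l ?expR_ge0// big_split /= lerD// sumr_const.
  by rewrite -[eta *+ _]mulr_natl.
have fth : complex.Re (f theta%:C) <= expR (p * eta) * (D + #|I|%:R * eta).
  apply: (strip_max hf (B := \sum_i expR (p * b i))).
  - move=> z zs; rewrite (le_trans (fle z))//; apply: ler_sum => i _.
    by rewrite ler_expR ler_pM2l// (le_trans (Re_le _))// hb.
  - by move=> t; apply: (bd (fun i => rnorm (bdry0 (F i) t) `^ p)) => // i;
    have [_ _ ] := HP i.
  - by move=> t; apply: (bd (fun i => rnorm (bdry1 (F i) t) `^ p)) => // i;
    have [_ _ _] := HP i.
  - by rewrite /strip /=; case/andP: th => t0 t1; rewrite (ltW t0) (ltW t1).
have fE : complex.Re (f theta%:C) = \sum_i expR (p * complex.Re (P i theta%:C)).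
  rewrite /f Re_sum; apply: eq_bigr => i _; rewrite /cc cisE -cexpD.
  rewrite (_ : _ + _ = (p * complex.Re (P i theta%:C))%:C) ?cexp_real//.
  by case: (P i _) => x y /=; apply/eqP; rewrite eq_complex /=; apply/andP; split;
    apply/eqP; ring.
apply: (@le_trans _ _ (expR (p * eta) * \sum_i expR (p * complex.Re (P i theta%:C)))).
  by rewrite mulr_sumr; apply: ler_sum => i _; have [_ _ _ _] := HP i.
by rewrite -fE mulrDl expRD -mulrA ler_wpM2l ?expR_ge0.
Qed.
End interpolation_of_sums.

(** * Walsh functions and the kernels *)

Section walsh.
Context (R : realType) (n : nat).
Implicit Types (e z d : cube n) (A B : {set 'I_n}).

Definition sgb (b : bool) : R := if b then -1 else 1.

Lemma sgb_sqr b : sgb b * sgb b = 1.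
Proof. by case: b; rewrite /sgb ?mulrNN mulr1. Qed.

Lemma sgb_neg b : sgb (~~ b) = - sgb b.
Proof. by case: b; rewrite /sgb ?opprK. Qed.

Lemma sum_cube_prod (F : 'I_n -> bool -> R) :
  \sum_(e : cube n) \prod_k F k (e k) = \prod_k \sum_(b : bool) F k b.
Proof. by rewrite bigA_distr_bigA. Qed.

Lemma prod_const2 (F : 'I_n -> R) : (forall k, F k = 2) -> \prod_k F k = 2 ^+ n.
Proof. by move=> F2; under eq_bigr do rewrite F2; rewrite prodr_const card_ord. Qed.

Definition walsh A e : R := \prod_(k in A) sgb (e k).

Lemma walshE A e : walsh A e = \prod_k (if k \in A then sgb (e k) else 1).
Proof. by rewrite /walsh big_mkcond. Qed.

Lemma sum_walsh_set e z : \sum_A walsh A e * walsh A z = (if e == z then 2 ^+ n else 0).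
Proof.
transitivity (\prod_(k < n) (sgb (e k) * sgb (z k) + 1)).
  rewrite bigA_distr; apply: eq_bigr => A _; rewrite !walshE -big_split /=.
  by apply: eq_bigr => k _; case: ifP; rewrite ?mulr1.
case: eqVneq => [->|ez].
  by under eq_bigr do rewrite sgb_sqr; rewrite prodr_const card_ord.
have [k ekz] : exists k, e k != z k.
  apply/existsP; apply: contraNT ez; rewrite negb_exists => /forallP h.
  by apply/eqP/ffunP => k; have := h k; rewrite negbK => /eqP.
rewrite (bigD1 k)//= (_ : sgb (e k) * sgb (z k) + 1 = 0) ?mul0r//.
by case: (e k) (z k) ekz => [] [] // _; rewrite /sgb; ring.
Qed.

Lemma sum_walsh_cube A B : \sum_e walsh A e * walsh B e = (if A == B then 2 ^+ n else
  0).
Proof.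
under eq_bigr do rewrite !walshE -big_split /=.
rewrite (sum_cube_prod (fun k b => (if k \in A then sgb b else 1) * (if k \in B then
  sgb b else 1))).
case: eqVneq => [->|AB].
  apply: prod_const2 => k.
  by rewrite big_bool /sgb /=; case: ifP => _; ring.
have [k kAB] : exists k, (k \in A) != (k \in B).
  apply/existsP; apply: contraNT AB; rewrite negb_exists => /forallP h.
  by apply/eqP/setP => k; have := h k; rewrite negbK => /eqP.
rewrite (bigD1 k)//= (_ : \sum_(b : bool) _ = 0) ?mul0r//.
by case: (k \in A) (k \in B) kAB => [] [] // _; rewrite big_bool /sgb /=; ring.
Qed.

Lemma walsh_flip A j e : walsh A (flip j e) = (if j \in A then - walsh A e else walsh
  A e).
Proof.
rewrite !walshE; case: ifP => jA.
  rewrite (bigD1 j)//= [in RHS](bigD1 j)//= jA /flip ffunE eqxx sgb_neg mulNr;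
    congr (- (_ * _)).
  by apply: eq_bigr => k /negbTE kj; rewrite ffunE kj.
apply: eq_bigr => k _; rewrite ffunE; case: eqP => // ->; by rewrite jA.
Qed.

Definition cube_opp d : cube n := [ffun k => ~~ d k].

Lemma cube_oppK : involutive cube_opp.
Proof. by move=> d; apply/ffunP => k; rewrite !ffunE negbK. Qed.

Lemma walsh_opp A d : walsh A (cube_opp d) = (-1) ^+ #|A| * walsh A d.
Proof.
rewrite /walsh -prodr_const -big_split /=; apply: eq_bigr => k _.
by rewrite ffunE sgb_neg mulN1r.
Qed.

Lemma walsh_norm A e : `|walsh A e| = 1.
Proof.
rewrite /walsh normr_prod big1// => k _; rewrite /sgb; by case: ifP => _;
  rewrite ?normrN1 ?normr1.
Qed.

(* Conditionally on [e], the pairs (z k, d k) are independent with density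
   1 + (1 - s) e_k z_k + s e_k z_k d_k. *)
Definition pos_kernel (s : R) e z d : R :=
  \prod_k (1 + sgb (e k) * sgb (z k) * ((1 - s) + s * sgb (d k))).

Definition kernel (s : R) e (w : cube n * cube n) : R :=
  (pos_kernel s e w.1 w.2 - pos_kernel s e w.1 (cube_opp w.2)) / 2.

Lemma pos_kernel_ge0 s e z d : 0 <= s <= 1 -> 0 <= pos_kernel s e z d.
Proof.
move=> /andP[s0 s1]; apply: prodr_ge0 => k _.
by case: (e k) (z k) (d k) => [] [] []; rewrite /sgb; lra.
Qed.

Lemma sum_pos_kernel_e s z d : \sum_e pos_kernel s e z d = 2 ^+ n.
Proof.
rewrite /pos_kernel (sum_cube_prod (fun k b => 1 + sgb b * sgb (z k) * ((1 - s) + s *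
  sgb (d k)))).
apply: prod_const2 => k.
by rewrite big_bool /sgb /=; ring.
Qed.

Lemma sum_pos_kernel_z s e d : \sum_z pos_kernel s e z d = 2 ^+ n.
Proof.
rewrite /pos_kernel (sum_cube_prod (fun k b => 1 + sgb (e k) * sgb b * ((1 - s) + s *
  sgb (d k)))).
apply: prod_const2 => k.
by rewrite big_bool /sgb /=; ring.
Qed.

Lemma card_cube : #|{: cube n}| = (2 ^ n)%N.
Proof. by rewrite card_ffun card_bool card_ord. Qed.

Lemma kernel_norm_le s e w : 0 <= s <= 1 ->
  `|kernel s e w| <= (pos_kernel s e w.1 w.2 + pos_kernel s e w.1 (cube_opp w.2)) / 2.
Proof.
move=> s01; rewrite /kernel normrM [X in _ * X]ger0_norm ?invr_ge0// ler_wpM2r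
  ?invr_ge0//.
by rewrite (le_trans (ler_normB _ _))// !ger0_norm ?pos_kernel_ge0.
Qed.

(** The two marginals of the positive kernel are uniform. This bound on columns and the next one on
    rows say that averaging against the kernel is a contraction on L_1 and on L_oo. *)
Lemma sum_kernel_e s w : 0 <= s <= 1 -> \sum_e `|kernel s e w| <= 2 ^+ n.
Proof.
move=> s01; rewrite (le_trans (ler_sum _ (fun e _ => kernel_norm_le e w s01)))//.
by rewrite -mulr_suml big_split /= !sum_pos_kernel_e; lra.
Qed.

Lemma sum_kernel_w s e : 0 <= s <= 1 -> \sum_w `|kernel s e w| <= 4 ^+ n.
Proof.
move=> s01; rewrite (le_trans (ler_sum _ (fun w _ => kernel_norm_le e w s01)))//.
have E : \sum_(w : cube n * cube n) pos_kernel s e w.1 w.2 = 4 ^+ n.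
  rewrite -(pair_bigA _ (fun z d => pos_kernel s e z d)) //=.
  rewrite exchange_big /=; under eq_bigr do rewrite sum_pos_kernel_z.
  by rewrite sumr_const card_cube -[LHS]mulr_natr natrX -exprMn; congr (_ ^+ _); ring.
have E' : \sum_(w : cube n * cube n) pos_kernel s e w.1 (cube_opp w.2) = 4 ^+ n.
  rewrite -E (reindex (fun w : cube n * cube n => (w.1, cube_opp w.2))) /=.
    by apply: eq_bigr => w _; rewrite cube_oppK.
  by exists (fun w => (w.1, cube_opp w.2)) => -[z d] _; rewrite /= cube_oppK.
have : \sum_(w : cube n * cube n) (pos_kernel s e w.1 w.2 + pos_kernel s e w.1
  (cube_opp w.2)) = 4 ^+ n + 4 ^+ n.
  by rewrite big_split /= E E'.
by move=> S; rewrite -mulr_suml S; lra.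
Qed.

(** For [0 <= s <= 1], the probability that a random subset of [A], each point being kept with
    probability [s], equals [B]; it vanishes unless [B] lies in [A]. *)
Definition kernel_coef (s : R) A B : R :=
  \prod_k (if k \in B then (if k \in A then s else 0) else (if k \in A then 1 - s else
    1)).

Lemma pos_kernelE s e z d : pos_kernel s e z d =
  \sum_A \sum_B kernel_coef s A B * (walsh A e * walsh A z * walsh B d).
Proof.
rewrite /pos_kernel; under eq_bigr do rewrite addrC.
rewrite bigA_distr; apply: eq_bigr => A _.
transitivity (walsh A e * walsh A z * \prod_k ((if k \in A then s * sgb (d k) else 0)
  + (if k \in A then 1 - s else 1))).
  rewrite !walshE -!big_split /=; apply: eq_bigr => k _.
  by case: ifP; rewrite ?mulr1 ?mul1r ?add0r// [_ + _ * _]addrC.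
rewrite bigA_distr mulr_sumr; apply: eq_bigr => B _.
rewrite [RHS]mulrCA; congr (_ * _).
rewrite /kernel_coef !walshE -!big_split /=; apply: eq_bigr => k _.
by case: ifP; case: ifP; rewrite ?mulr1 ?mul1r ?mul0r.
Qed.

(** Passing to the odd part drops the empty [B], whose coefficient [(1 - s)^|A|] is not small at
    [s = 0]: weighted by [s^(-3/2)], it would ruin any bound uniform in the number of nodes. *)
Lemma kernelE s e w : kernel s e w =
  \sum_(A : {set 'I_n}) \sum_(B : {set 'I_n} | odd #|B|) kernel_coef s A B * (walsh A
    e * walsh A w.1 * walsh B w.2).
Proof.
rewrite /kernel !pos_kernelE -sumrB mulr_suml; apply: eq_bigr => A _.
rewrite -sumrB mulr_suml [RHS]big_mkcond; apply: eq_bigr => B _.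
rewrite walsh_opp -signr_odd; case: (odd _) => /=; rewrite ?expr1 ?expr0; lra.
Qed.

End walsh.

Section real_scalars.
Context (R : realType) (V : normedModType R[i]).
Implicit Types (a b : R) (v w : V).

Definition rscale a v : V := a%:C *: v.

Lemma rscaleA a b v : rscale a (rscale b v) = rscale (a * b) v.
Proof. by rewrite /rscale scalerA -rmorphM. Qed.

Lemma rscaleBl a b v : rscale (a - b) v = rscale a v - rscale b v.
Proof. by rewrite /rscale rmorphB scalerBl. Qed.

Lemma rscale0 v : rscale 0 v = 0.
Proof. by rewrite /rscale scale0r. Qed.

Lemma rscale1 v : rscale 1 v = v.
Proof. by rewrite /rscale scale1r. Qed.

Lemma rscale_suml (I : Type) (r : seq I) (P : pred I) (F : I -> R) v :
  rscale (\sum_(i <- r | P i) F i) v = \sum_(i <- r | P i) rscale (F i) v.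
Proof. by rewrite /rscale rmorph_sum scaler_suml. Qed.

Lemma rscale_sumr (I : Type) (r : seq I) (P : pred I) a (F : I -> V) :
  rscale a (\sum_(i <- r | P i) F i) = \sum_(i <- r | P i) rscale a (F i).
Proof. exact: scaler_sumr. Qed.

Lemma rnorm_rscale a v : rnorm (rscale a v) = `|a| * rnorm v.
Proof. by rewrite /rscale rnormZc cabs_real. Qed.

End real_scalars.

(** * Walsh expansion of the discrete derivatives *)

Section walsh_transform.
Context (R : realType) (V : normedModType R[i]) (n : nat).
Implicit Types (f : cube n -> V) (e : cube n) (A B : {set 'I_n}).

Let two_n_neq0 : (2 ^+ n : R) != 0. Proof. by rewrite expf_neq0. Qed.

Definition wft f A : V := \sum_e rscale (2 ^- n * walsh R A e) (f e).

Lemma wft_inversion f e : f e = \sum_A rscale (walsh R A e) (wft f A).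
Proof.
under eq_bigr do rewrite /wft rscale_sumr.
rewrite exchange_big /=.
under eq_bigr => z _.
  under eq_bigr do rewrite rscaleA mulrCA.
  rewrite -rscale_suml -mulr_sumr sum_walsh_set; over.
rewrite (bigD1 e)//= eqxx mulVf// rscale1 big1 ?addr0// => z ze.
by rewrite eq_sym (negbTE ze) mulr0 rscale0.
Qed.

Lemma wft_unique (v : {set 'I_n} -> V) A :
  wft (fun e => \sum_B rscale (walsh R B e) (v B)) A = v A.
Proof.
rewrite /wft; under eq_bigr do rewrite rscale_sumr.
rewrite exchange_big /=.
under eq_bigr => B _.
  under eq_bigr do rewrite rscaleA -mulrA.
  rewrite -rscale_suml -mulr_sumr sum_walsh_cube; over.
rewrite (bigD1 A)//= eqxx mulVf// rscale1 big1 ?addr0// => B BA.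
by rewrite eq_sym (negbTE BA) mulr0 rscale0.
Qed.

Lemma cube_partialE j f e :
  cube_partial j f e = \sum_(A : {set 'I_n} | j \in A) rscale (walsh R A e) (wft f A).
Proof.
rewrite /cube_partial (wft_inversion f e) (wft_inversion f (flip j e)) -sumrB
  scaler_sumr.
rewrite [RHS]big_mkcond; apply: eq_bigr => A _; rewrite -rscaleBl walsh_flip.
case: ifP => _; last by rewrite subrr rscale0 scaler0.
have -> : (2^-1 : R[i]) = (2^-1 : R)%:C by rewrite fmorphV rmorph_nat.
by rewrite -/(rscale _ _) rscaleA opprK; congr (rscale _ _); field.
Qed.

Lemma cube_laplacianE f e :
  cube_laplacian f e = \sum_A rscale (walsh R A e) (rscale #|A|%:R (wft f A)).
Proof.
rewrite /cube_laplacian; under eq_bigr do rewrite cube_partialE.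
rewrite (exchange_big_dep xpredT) //=; apply: eq_bigr => A _.
rewrite sumr_const rscaleA mulrC -rscaleA /rscale rmorph_nat scaler_nat.
by congr (_ *+ _); apply: eq_card.
Qed.

Lemma wft_laplacian f A : wft (cube_laplacian f) A = rscale #|A|%:R (wft f A).
Proof.
have -> : cube_laplacian f = fun e => \sum_B rscale (walsh R B e) (rscale #|B|%:R (wft
  f B)).
  by apply/funext => e; exact: cube_laplacianE.
exact: wft_unique.
Qed.

Lemma sum_kernel_sgb (s : R) e z j :
  \sum_d kernel s e (z, d) * sgb R (d j) =
  2 ^+ n * \sum_A kernel_coef s A [set j]%SET * walsh R A e * walsh R A z.
Proof.
have w1 d : walsh R [set j]%SET d = sgb R (d j) by rewrite /walsh big_set1.
under eq_bigr do rewrite kernelE /= mulr_suml.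
rewrite exchange_big mulr_sumr /=; apply: eq_bigr => A _.
under eq_bigr do rewrite mulr_suml.
rewrite exchange_big /= (bigD1 [set j]%SET)/=; last by rewrite cards1.
rewrite [X in _ + X]big1 ?addr0; last first.
  move=> B /andP[_ Bj].
  transitivity (\sum_d kernel_coef s A B * (walsh R A e * walsh R A z) * (walsh R B d
    * walsh R [set j]%SET d)).
    by apply: eq_bigr => d _; rewrite w1 !mulrA.
  by rewrite -mulr_sumr sum_walsh_cube (negbTE Bj) mulr0.
transitivity (\sum_d kernel_coef s A [set j]%SET * (walsh R A e * walsh R A z) *
  (walsh R [set j]%SET d * walsh R [set j]%SET d)).
  by apply: eq_bigr => d _; rewrite w1 !mulrA.
by rewrite -mulr_sumr sum_walsh_cube eqxx mulrC !mulrA.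
Qed.

(** Orthogonality in [d] keeps only the singletons [B = {j}]: the rest of the kernel is invisible to
    functions linear in [d]. *)
Lemma kernel_on_linear (s : R) e (g : 'I_n -> cube n -> V) :
  \sum_w rscale (4 ^- n * kernel s e w) (\sum_j rscale (sgb R (w.2 j)) (g j w.1)) =
  \sum_j \sum_A rscale (kernel_coef s A [set j]%SET * walsh R A e) (wft (g j) A).
Proof.
under eq_bigr do rewrite rscale_sumr.
rewrite exchange_big /=; apply: eq_bigr => j _.
rewrite -(pair_bigA _ (fun z d => rscale (4 ^- n * kernel s e (z, d)) (rscale (sgb R
  (d j)) (g j z)))) /=.
under eq_bigr => z _.
  under eq_bigr do rewrite rscaleA -mulrA.
  rewrite -rscale_suml -mulr_sumr sum_kernel_sgb; over.
under [RHS]eq_bigr => A _ do rewrite /wft rscale_sumr.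
rewrite [RHS]exchange_big /=; apply: eq_bigr => z _.
under [RHS]eq_bigr do rewrite rscaleA.
rewrite -rscale_suml; congr (rscale _ _).
rewrite !mulr_sumr; apply: eq_bigr => A _.
have -> : (4 : R) = 2 * 2 by ring.
by rewrite exprMn; field.
Qed.

End walsh_transform.

(** * Riemann sums of a beta integral *)

Section kernel_coefficients.
Context (R : realType) (n : nat).
Implicit Types (A B : {set 'I_n}).

Lemma kernel_coefE (s : R) A B :
  kernel_coef s A B = if B \subset A then s ^+ #|B| * (1 - s) ^+ (#|A| - #|B|) else 0.
Proof.
rewrite /kernel_coef; case: ifPn => [BA|/subsetPn[k kB kA]]; last first.
  by rewrite (bigD1 k)//= kB (negbTE kA) mul0r.
have -> : (#|A| - #|B|)%N = #|A :\: B| by rewrite cardsD (finset.setIidPr BA).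
rewrite -!prodr_const (big_mkcond (mem B)) (big_mkcond (mem (A :\: B))) -big_split /=.
apply: eq_bigr => k _.
rewrite !inE; have [kB|kB] := boolP (k \in B);
  first by rewrite (fintype.subsetP BA) ?mulr1.
by case: ifP; rewrite mul1r.
Qed.

(** Right end points, so that negative powers of [s] are never evaluated at 0. *)
Definition quad_node N (i : nat) : R := i.+1%:R / N%:R.

Lemma quad_node_gt0 N i : (i < N)%N -> 0 < quad_node N i.
Proof. by move=> iN; rewrite divr_gt0// ltr0n// (leq_ltn_trans _ iN). Qed.

Lemma quad_node_le1 N i : (i < N)%N -> quad_node N i <= 1.
Proof.
by move=> iN; rewrite ler_pdivrMr ?ltr0n ?(leq_ltn_trans _ iN)// mul1r ler_nat.
Qed.

Lemma quad_node01 N i : (i < N)%N -> 0 <= quad_node N i <= 1.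
Proof. by move=> iN; rewrite quad_node_le1// ltW ?quad_node_gt0. Qed.

Lemma telescope_power_le (a b : R) k : 0 <= a -> a <= b ->
  k%:R * a ^+ k.-1 * (b - a) <= b ^+ k - a ^+ k <= k%:R * b ^+ k.-1 * (b - a).
Proof.
move=> a0 ab; have b0 := le_trans a0 ab; rewrite subrXX mulrC ![_ * (b - a)]mulrC.
case: k => [|k]; first by rewrite big_ord0 !mul0r !mulr0 lexx.
rewrite !ler_wpM2l ?subr_ge0//= mulr_natl.
  rewrite -[X in _ *+ X]card_ord -sumr_const; apply: ler_sum => i _.
  rewrite -[leRHS](_ : b ^+ (k - i) * b ^+ i = _);
    last by rewrite -exprD subnK ?leq_ord.
  by rewrite ler_wpM2l ?exprn_ge0// lerXn2r.
rewrite -[X in _ *+ X]card_ord -sumr_const; apply: ler_sum => i _.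
rewrite -[leLHS](_ : a ^+ (k - i) * a ^+ i = _); last by rewrite -exprD subnK ?leq_ord.
by rewrite ler_wpM2r ?exprn_ge0// lerXn2r.
Qed.

Lemma sum_quad_node_rev N m : \sum_(i < N) (1 - quad_node N i) ^+ m = \sum_(i < N)
  (i%:R / N%:R) ^+ m.
Proof.
rewrite (reindex_inj rev_ord_inj) /=; apply: eq_bigr => i _; congr (_ ^+ _).
have NR : 0 < N%:R :> R by rewrite ltr0n (leq_ltn_trans _ (ltn_ord i)).
by rewrite /quad_node subnSK// natrB ?(ltnW (ltn_ord i))//; field; rewrite gt_eqF.
Qed.

Lemma quadrature_beta_le1 N k : (0 < N)%N -> (0 < k)%N ->
  k%:R * (N%:R^-1 * \sum_(i < N) (1 - quad_node N i) ^+ k.-1) <= 1.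
Proof.
move=> N0 k0; have NR : 0 < N%:R :> R by rewrite ltr0n.
rewrite sum_quad_node_rev; pose a (i : nat) : R := i%:R / N%:R.
have da i : a i.+1 - a i = N%:R^-1 by rewrite /a -mulrBl -natrB// subSnn mul1r.
have aa i : a i <= a i.+1 by rewrite -subr_ge0 da invr_ge0 ltW.
have T : \sum_(i < N) (a i.+1 ^+ k - a i ^+ k) = 1.
  rewrite -(big_mkord xpredT (fun i => a i.+1 ^+ k - a i ^+ k)) telescope_sumr//.
  by rewrite /a divff ?gt_eqF// mul0r expr1n expr0n eqn0Ngt k0 subr0.
rewrite -[leRHS]T !mulr_sumr; apply: ler_sum => i _.
have a0 : 0 <= a i by rewrite divr_ge0.
have := telescope_power_le k a0 (aa i); rewrite da => /andP[h _].
by apply: le_trans h; rewrite -/(a i) [N%:R^-1 * _]mulrC mulrA.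
Qed.

(** A Riemann sum for the integral of [k (1 - s)^(k-1)], which is 1. Reversing the nodes makes it
    the lower sum of [k t^(k-1)]; [telescope_power_le] places 1 between this and the upper sum, and
    the two differ by at most [k / N]. *)
Lemma quadrature_beta N k : (0 < N)%N -> (0 < k)%N ->
  `|k%:R * (N%:R^-1 * \sum_(i < N) (1 - quad_node N i) ^+ k.-1) - 1| <= k%:R / N%:R.
Proof.
move=> N0 k0; have L1 := quadrature_beta_le1 N0 k0; move: L1.
rewrite sum_quad_node_rev; pose a (i : nat) : R := i%:R / N%:R => L1.
have NR : 0 < N%:R :> R by rewrite ltr0n.
have a0 i : 0 <= a i by rewrite divr_ge0.
have da i : a i.+1 - a i = N%:R^-1 by rewrite /a -mulrBl -natrB// subSnn mul1r.
have aa i : a i <= a i.+1 by rewrite -subr_ge0 da invr_ge0 ltW.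
have T : \sum_(i < N) (a i.+1 ^+ k - a i ^+ k) = 1.
  rewrite -(big_mkord xpredT (fun i => a i.+1 ^+ k - a i ^+ k)) telescope_sumr//.
  by rewrite /a divff ?gt_eqF// mul0r expr1n expr0n eqn0Ngt k0 subr0.
have T' : \sum_(i < N) (a i.+1 ^+ k.-1 - a i ^+ k.-1) <= 1.
  rewrite -(big_mkord xpredT (fun i => a i.+1 ^+ k.-1 - a i ^+ k.-1)) telescope_sumr//.
  by rewrite /a divff ?gt_eqF// expr1n lerBlDr lerDl exprn_ge0// divr_ge0.
have L2 : 1 <= k%:R * (N%:R^-1 * \sum_(i < N) a i.+1 ^+ k.-1).
  rewrite -[leLHS]T !mulr_sumr; apply: ler_sum => i _.
  have := telescope_power_le k (a0 i) (aa i); rewrite da => /andP[_ +].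
  by rewrite -mulrA [_ * N%:R^-1]mulrC.
have L3 : k%:R * (N%:R^-1 * \sum_(i < N) a i.+1 ^+ k.-1) <=
    k%:R * (N%:R^-1 * \sum_(i < N) a i ^+ k.-1) + k%:R / N%:R.
  rewrite -mulrDr ler_wpM2l// -[X in _ + X]mulr1 -mulrDr ler_wpM2l ?invr_ge0 ?(ltW
    NR)//.
  by rewrite -lerBlDl -sumrB.
rewrite ler_norml; apply/andP; split; first lra.
by rewrite lerBlDr (le_trans L1)// lerDr divr_ge0.
Qed.

End kernel_coefficients.

Section linear_approximation.
Context (R : realType) (V : normedModType R[i]) (n : nat).

Definition quad_kernel N (e : cube n) w : R :=
  \sum_(i < N) N%:R^-1 * (quad_node R N i)^-1 * kernel (quad_node R N i) e w.

(** Compare Walsh coefficients. For [j] in [A], the factor [|A|] of the Laplacian,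
    [s (1 - s)^(|A|-1)] of the kernel and the weight [s^-1] combine to the beta integral, equal to
    1; for [j] outside [A] the kernel coefficient vanishes. This is the projection performed by
    [partial_j]. *)
Lemma quad_kernel_approx (f : 'I_n -> cube n -> V) (e : cube n) N : (0 < N)%N ->
  rnorm (\sum_w rscale (4 ^- n * quad_kernel N e w) (\sum_j rscale (sgb R (w.2 j))
    (cube_laplacian (f j) w.1))
    - \sum_j cube_partial j (f j) e)
  <= (\sum_j \sum_(A : {set _}) #|A|%:R * rnorm (wft (f j) A)) / N%:R.
Proof.
move=> N0.
have -> : \sum_w rscale (4 ^- n * quad_kernel N e w) (\sum_j rscale (sgb R (w.2 j))
  (cube_laplacian (f j) w.1)) =
   \sum_j \sum_A rscale (\sum_(i < N) N%:R^-1 * (quad_node R N i)^-1 * kernel_coef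
     (quad_node R N i) A [set j]%SET * walsh R A e) (wft (cube_laplacian (f j)) A).
  transitivity (\sum_(i < N) rscale (N%:R^-1 * (quad_node R N i)^-1) (\sum_w rscale (4
    ^- n * kernel (quad_node R N i) e w)
      (\sum_j rscale (sgb R (w.2 j)) (cube_laplacian (f j) w.1)))).
    under [RHS]eq_bigr do rewrite rscale_sumr; rewrite [RHS]exchange_big /=.
    apply: eq_bigr => w _; rewrite /quad_kernel mulr_sumr rscale_suml;
      apply: eq_bigr => i _.
    by rewrite rscaleA; congr (rscale _ _); ring.
  under eq_bigr do rewrite (kernel_on_linear _ _ (fun j => cube_laplacian (f j)))
    rscale_sumr.
  rewrite exchange_big /=; apply: eq_bigr => j _.
  under eq_bigr do rewrite rscale_sumr.
  rewrite exchange_big /=; apply: eq_bigr => A _.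
  rewrite rscale_suml; apply: eq_bigr => i _; rewrite rscaleA; congr (rscale _ _); ring.
rewrite -sumrB mulr_suml (le_trans (ler_rnorm_sum _ _ _))//; apply: ler_sum => j _.
rewrite cube_partialE [X in _ - X]big_mkcond -sumrB mulr_suml (le_trans (ler_rnorm_sum
  _ _ _))//.
apply: ler_sum => A _; rewrite wft_laplacian rscaleA.
case: ifPn => jA; last first.
  rewrite big1 ?mul0r ?rscale0 ?subrr ?rnorm0 ?mulr_ge0 ?invr_ge0 ?rnorm_ge0// => i _.
  by rewrite kernel_coefE finset.sub1set (negbTE jA) mulr0 mul0r.
rewrite -rscaleBl rnorm_rscale mulrAC ler_wpM2r ?rnorm_ge0//.
have A0 : (0 < #|A|)%N by apply/card_gt0P; exists j.
apply: le_trans (quadrature_beta R N0 A0).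
rewrite le_eqVlt; apply/orP; left; apply/eqP.
rewrite (_ : _ - _ = walsh R A e * (#|A|%:R * (N%:R^-1 * \sum_(i < N) (1 - quad_node R
  N i) ^+ #|A|.-1) - 1)).
  by rewrite normrM walsh_norm mul1r.
rewrite mulrBr mulr1; congr (_ - _).
rewrite mulrC mulrCA; congr (_ * _); rewrite mulr_sumr mulr_sumr; apply: eq_bigr => i _.
rewrite kernel_coefE finset.sub1set jA cards1 expr1 subn1; field.
by rewrite pnatr_eq0 -lt0n N0 gt_eqF ?quad_node_gt0.
Qed.

End linear_approximation.

(** * Jensen's inequality and Riemann sums of powers *)

Section schur.
Context (R : realType).

(** Young's inequality, read as the graph of [t^p] lying above its tangent at [x]. *)
Lemma young_tangent (p a x : R) : 1 < p -> 0 <= a -> 0 <= x ->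
  p * (a * x `^ (p - 1)) <= a `^ p + (p - 1) * x `^ p.
Proof.
move=> p1 a0 x0; have p0 : 0 < p by rewrite (lt_trans ltr01).
have q0 : 0 < p / (p - 1) by rewrite divr_gt0// subr_gt0.
have pq : p^-1 + (p / (p - 1))^-1 = 1 by field; rewrite !gt_eqF// subr_gt0.
have := conjugate_powR a0 (powR_ge0 x (p - 1)) p0 q0 pq.
rewrite -powRrM (_ : (p - 1) * (p / (p - 1)) = p); last by field;
  rewrite gt_eqF// subr_gt0.
rewrite -(ler_pM2l p0) => h; apply: le_trans h _.
rewrite le_eqVlt; apply/orP; left; apply/eqP; field.
by rewrite !gt_eqF// subr_gt0.
Qed.

(** The tangent is taken at the mean. A total mass below [G] does no harm, as the missing mass may
    be placed at the value 0. *)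
Lemma jensen_powR (I : finType) (k a : I -> R) (p G : R) : 1 < p -> 0 < G ->
  (forall i, 0 <= k i) -> (forall i, 0 <= a i) -> \sum_i k i <= G ->
  G * ((\sum_i k i * a i) / G) `^ p <= \sum_i k i * a i `^ p.
Proof.
move=> p1 G0 k0 a0 kG; set x := _ / G.
have x0 : 0 <= x by rewrite divr_ge0 ?(ltW G0)// sumr_ge0// => i _; rewrite mulr_ge0.
have xp : x * x `^ (p - 1) = x `^ p by rewrite mulr_powRB1// (lt_trans ltr01).
have : \sum_i k i * (p * (a i * x `^ (p - 1))) <= \sum_i k i * (a i `^ p + (p - 1) * x
  `^ p).
  by apply: ler_sum => i _; rewrite ler_wpM2l// young_tangent.
have -> : \sum_i k i * (p * (a i * x `^ (p - 1))) = p * G * x `^ p.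
  rewrite -xp mulrA -[p * G * x]mulrA /x [G * _]mulrC divfK ?gt_eqF// mulr_sumr
    mulr_suml.
  by apply: eq_bigr => i _; ring.
under eq_bigr do rewrite mulrDr; rewrite big_split /= -mulr_suml.
have : (\sum_i k i) * ((p - 1) * x `^ p) <= G * ((p - 1) * x `^ p).
  by rewrite ler_wpM2r// mulr_ge0 ?powR_ge0// subr_ge0 ltW.
lra.
Qed.

Lemma powR_concave (r al : R) : 0 < al < 1 -> 0 <= r -> r `^ al <= al * r + (1 - al).
Proof.
move=> /andP[a0 a1] r0.
have a1' : 0 < 1 - al by rewrite subr_gt0.
have h : al^-1^-1 + (1 - al)^-1^-1 = 1 by rewrite !invrK addrC subrK.
have := conjugate_powR (powR_ge0 r al) ler01 _ _ h; rewrite !invr_gt0 => /(_ a0 a1').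
by rewrite mulr1 -powRrM divff ?gt_eqF// powRr1// powR1 !invrK mul1r [r * _]mulrC.
Qed.

(** The bound is the integral of [t^(al-1)] over [[0, M/N]]. The induction step is the tangent
    inequality [powR_concave] at [r = M/(M+1)]. Besides carrying the induction, [M < N] serves to
    sum over small nodes only in [coef_mass1]. *)
Lemma quadrature_power_lt1 N M al : (0 < N)%N -> (M <= N)%N -> 0 < al < 1 ->
  \sum_(i < M) N%:R^-1 * quad_node R N i `^ (al - 1) <= al^-1 * (M%:R / N%:R) `^ al.
Proof.
move=> N0 MN al01; have /andP[al0 al1] := al01.
have NR : 0 < N%:R :> R by rewrite ltr0n.
elim: M MN => [|M ih] MN; first by rewrite big_ord0 mulr_ge0 ?powR_ge0 ?invr_ge0// ltW.
rewrite big_ord_recr /= (le_trans (lerD (ih (ltnW MN)) (lexx _)))//.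
rewrite -/(quad_node R N M); set b := quad_node R N M.
have b0 : 0 < b by exact: quad_node_gt0.
pose r := M%:R / N%:R / b.
have r0 : 0 <= r by rewrite divr_ge0 ?(ltW b0)// divr_ge0.
have -> : M%:R / N%:R = r * b by rewrite /r divfK// gt_eqF.
have Nb : N%:R^-1 = b * (1 - r).
  rewrite mulrBr mulr1 /r mulrC divfK ?gt_eqF// /b /quad_node -mulrBl -natrB//.
  by rewrite subSnn mul1r.
rewrite powRM ?(ltW b0)// Nb mulrAC mulr_powRB1 ?(ltW b0)//.
have B0 := powR_ge0 b al; move: (b `^ al) B0 => B B0.
have h : al^-1 * (r `^ al * B) <= al^-1 * ((al * r + (1 - al)) * B).
  by rewrite ler_wpM2l ?invr_ge0 ?(ltW al0)// ler_wpM2r// powR_concave.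
rewrite (le_trans (lerD h (lexx _)))//.
by rewrite le_eqVlt; apply/orP; left; apply/eqP; field; rewrite gt_eqF.
Qed.

Lemma quadrature_power N al : (0 < N)%N -> 0 < al ->
  \sum_(i < N) N%:R^-1 * quad_node R N i `^ (al - 1) <= Num.max 1 al^-1.
Proof.
move=> N0 al0; have NR : 0 < N%:R :> R by rewrite ltr0n.
rewrite le_max; have [al1|al1] := ltP al 1.
  have := @quadrature_power_lt1 N N al N0 (leqnn N); rewrite al0 al1 => /(_ isT).
  by rewrite divff ?gt_eqF// powR1 mulr1 => ->; rewrite orbT.
apply/orP; left; apply: (@le_trans _ _ (\sum_(i < N) N%:R^-1)).
  apply: ler_sum => i _; rewrite ler_piMr ?invr_ge0 ?(ltW NR)//.
  rewrite -[leRHS](powRr0 (quad_node R N i)); apply: ger_powR; last by rewrite subr_ge0.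
  by rewrite (quad_node_gt0 _ (ltn_ord i)) (quad_node_le1 _ (ltn_ord i)).
by rewrite sumr_const card_ord -[_ *+ N]mulr_natr mulVf// gt_eqF.
Qed.

End schur.

(** * The discretized analytic family and its Schur test *)

Section kernel_operators.
Context (R : realType) (n : nat).

(* s_i ^ (w - 2) / N weights: as N goes to infinity this is the integral of
   s ^ (w - 2) kernel_s over s in [0, 1]. *)
Definition weight N (w : R[i]) (i : nat) : R[i] :=
  N%:R^-1%:C * cexp ((w - 2) * (ln (quad_node R N i))%:C).

Definition ckernel N (w : R[i]) (e : cube n) (u : cube n * cube n) : R[i] :=
  \sum_(i < N) (4 ^- n * kernel (quad_node R N i) e u)%:C * weight N w i.

Lemma cabs_weight N w i : (i < N)%N ->
  cabs (weight N w i) = N%:R^-1 * quad_node R N i `^ (complex.Re w - 2).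
Proof.
move=> iN; rewrite /weight cabsM cabs_real ger0_norm ?invr_ge0// cabs_cexp.
rewrite /powR gt_eqF ?quad_node_gt0// [(w - 2) * _]mulrC Re_realM.
have -> : complex.Re (w - 2) = complex.Re w - 2.
  by rewrite raddfB -[in LHS](rmorph_nat (real_complex R) 2).
by rewrite [ln _ * _]mulrC.
Qed.

Lemma ckernel_norm_le N w e u : cabs (ckernel N w e u) <=
  \sum_(i < N) 4 ^- n * `|kernel (quad_node R N i) e u| * (N%:R^-1 * quad_node R N i
    `^ (complex.Re w - 2)).
Proof.
rewrite (le_trans (cabs_sum _ _ _))//; apply: ler_sum => i _.
by rewrite cabsM cabs_real normrM cabs_weight// ger0_norm// invr_ge0 exprn_ge0.
Qed.

Lemma ckernel_row N w e : (0 < N)%N -> 1 < complex.Re w ->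
  \sum_u cabs (ckernel N w e u) <= Num.max 1 (complex.Re w - 1)^-1.
Proof.
move=> N0 w1; rewrite (le_trans (ler_sum _ (fun u _ => ckernel_norm_le N w e u)))//.
rewrite exchange_big /=; have al0 : 0 < complex.Re w - 1 by rewrite subr_gt0.
apply: le_trans (quadrature_power N0 al0); apply: ler_sum => i _.
rewrite -mulr_suml -addrA -opprD -[1 + 1]/2 ler_piMl ?mulr_ge0 ?powR_ge0 ?invr_ge0//.
rewrite -mulr_sumr mulrC ler_pdivrMr ?exprn_gt0// mul1r sum_kernel_w//.
exact: quad_node01.
Qed.

Lemma ckernel_col N w u : (0 < N)%N -> 1 < complex.Re w ->
  \sum_e cabs (ckernel N w e u) <= 2 ^- n * Num.max 1 (complex.Re w - 1)^-1.
Proof.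
move=> N0 w1; rewrite (le_trans (ler_sum _ (fun e _ => ckernel_norm_le N w e u)))//.
rewrite exchange_big /=; have al0 : 0 < complex.Re w - 1 by rewrite subr_gt0.
have p2 : 0 < 2 ^+ n :> R by rewrite exprn_gt0.
rewrite -[leRHS]mulrC ler_pdivlMr//; apply: le_trans (quadrature_power N0 al0).
rewrite mulr_suml; apply: ler_sum => i _.
rewrite -mulr_suml -addrA -opprD -[1 + 1]/2 mulrAC ler_piMl ?mulr_ge0 ?powR_ge0
  ?invr_ge0//.
rewrite -mulr_sumr; have := @sum_kernel_e R n (quad_node R N i) u (quad_node01 _
  (ltn_ord i)).
move: (\sum_e _) => S S2; rewrite (_ : 4 ^- n = 2 ^- n * 2 ^- n :> R); last first.
  by rewrite -invfM -exprMn; congr (_ ^- _); ring.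
rewrite (_ : _ * S * _ = S / 2 ^+ n); last by field; rewrite gt_eqF.
by rewrite ler_pdivrMr// mul1r.
Qed.

(** Jensen along each row, then the column sums. The two sums are [2^n] times means over the cube
    and over the pairs, so [G] bounds the norm between normalized L_p spaces. *)
Lemma ckernel_schur (V : normedModType R[i]) (p G : R) N w (x : cube n * cube n -> V) :
  1 < p -> (0 < N)%N -> 1 < complex.Re w -> Num.max 1 (complex.Re w - 1)^-1 <= G ->
  \sum_e rnorm (\sum_u ckernel N w e u *: x u) `^ p <= G `^ p * (2 ^- n * \sum_u rnorm
    (x u) `^ p).
Proof.
move=> p1 N0 w1 hG; have G0 : 0 < G by rewrite (lt_le_trans _ hG)// lt_max ltr01.
have p0 : 0 < p by rewrite (lt_trans ltr01).
have Gp : 0 < G `^ p by rewrite powR_gt0.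
pose X e := \sum_u cabs (ckernel N w e u) * rnorm (x u).
have X0 e : 0 <= X e by apply: sumr_ge0 => u _; rewrite mulr_ge0 ?cabs_ge0 ?rnorm_ge0.
have h1 e : rnorm (\sum_u ckernel N w e u *: x u) `^ p <= G `^ p * (G^-1 * \sum_u cabs
  (ckernel N w e u) * rnorm (x u) `^ p).
  apply: (@le_trans _ _ (X e `^ p)).
    rewrite ge0_ler_powR ?nnegrE ?(ltW p0) ?rnorm_ge0// (le_trans (ler_rnorm_sum _ _
      _))//.
    by apply: ler_sum => u _; rewrite rnormZc.
  have -> : X e = G * (X e / G) by rewrite mulrC divfK// gt_eqF.
  rewrite powRM ?divr_ge0 ?(ltW G0)// ler_pM2l// ler_pdivlMl//.
  apply: jensen_powR => // [u|u|]; [exact: cabs_ge0|exact: rnorm_ge0|].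
  exact: le_trans (ckernel_row e N0 w1) hG.
rewrite (le_trans (ler_sum _ (fun e _ => h1 e)))// -mulr_sumr ler_pM2l// -mulr_sumr
  ler_pdivrMl//.
rewrite exchange_big /= [leRHS]mulrA [leRHS]mulr_sumr; apply: ler_sum => u _.
rewrite -mulr_suml ler_wpM2r ?powR_ge0// (le_trans (ckernel_col u N0 w1))// mulrC.
by rewrite ler_wpM2r// invr_ge0 exprn_ge0.
Qed.

Lemma ckernel1 N e u : (0 < N)%N -> ckernel N 1 e u = (4 ^- n * quad_kernel R N e u)%:C.
Proof.
move=> N0; rewrite /ckernel /quad_kernel mulr_sumr rmorph_sum; apply: eq_bigr => i _.
rewrite /weight (_ : (1 - 2) * _ = (- ln (quad_node R N i))%:C); last first.
  by rewrite rmorphN /=; ring.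
rewrite cexp_real expRN lnK ?posrE ?quad_node_gt0// -!rmorphM; congr (_%:C) => /=.
by ring.
Qed.

End kernel_operators.

(** * The estimate on L_2 of a Hilbert space *)

Section coefficient_estimate.
Context (R : realType) (n : nat).
Implicit Types (A B : {set 'I_n}).

Lemma leq_bin_mid m k : (0 < k < m)%N -> (m <= 'C(m, k))%N.
Proof.
elim: m k => // m ih [//|k] /=; rewrite ltnS => km; rewrite binS.
have [E|kk] := eqVneq k.+1 m; first by rewrite -E binn add1n binSn.
have h : (m <= 'C(m, k.+1))%N by rewrite ih//= ltn_neqAle kk.
have h2 : (0 < 'C(m, k))%N by rewrite bin_gt0 ltnW.
by rewrite (leq_trans _ (leq_add h h2))// addn1.
Qed.

(** With the binomial coefficient in place of [j + l] this is one term of the expansion of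
    [((1 - s) + s)^(j+l)], and for [j, l > 0] that coefficient is at least [j + l]. *)
Lemma bernstein_mid_le (s : R) j l : 0 <= s <= 1 -> (0 < j)%N -> (0 < l)%N ->
  (j + l)%:R * (s ^+ j * (1 - s) ^+ l) <= 1.
Proof.
move=> /andP[s0 s1] j0 l0; have t0 : 0 <= 1 - s by rewrite subr_ge0.
apply: (@le_trans _ _ ('C(j + l, j)%:R * (s ^+ j * (1 - s) ^+ l))).
  rewrite ler_wpM2r ?mulr_ge0 ?exprn_ge0// ler_nat leq_bin_mid// j0.
  by rewrite -[X in (X < _)%N]addn0 ltn_add2l.
rewrite -[leRHS](_ : ((1 - s) + s) ^+ (j + l) = 1); last by rewrite subrK expr1n.
rewrite [leRHS]exprDn; have jl : (j < (j + l).+1)%N by rewrite ltnS leq_addr.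
rewrite (bigD1 (Ordinal jl))//= addKn [(1 - s) ^+ l * _]mulrC mulr_natl lerDl.
by rewrite sumr_ge0// => i _; rewrite mulrn_wge0// mulr_ge0 ?exprn_ge0.
Qed.

Lemma bernoulli_le (s : R) a : 0 <= s <= 1 -> 1 - (1 - s) ^+ a <= a%:R * s.
Proof.
move=> /andP[s0 s1]; have t0 : 0 <= 1 - s by rewrite subr_ge0.
elim: a => [|a ih]; first by rewrite expr0 subrr mul0r.
have t1 : (1 - s) ^+ a <= 1 by rewrite exprn_ile1// lerBlDr lerDl.
rewrite exprS -natr1 mulrDl mul1r; have := exprn_ge0 a t0; nra.
Qed.

Lemma sum_kernel_coef (s : R) A : \sum_B kernel_coef s A B = 1.
Proof.
rewrite /kernel_coef -bigA_distr big1// => k _.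
by case: ifP => _ /=; ring.
Qed.

Lemma kernel_coef_ge0 (s : R) A B : 0 <= s <= 1 -> 0 <= kernel_coef s A B.
Proof.
move=> /andP[s0 s1]; rewrite kernel_coefE; case: ifP => // _.
by rewrite mulr_ge0 ?exprn_ge0// subr_ge0.
Qed.

Variable N : nat.
Hypothesis N0 : (0 < N)%N.

Let s (i : 'I_N) : R := quad_node R N i.
Let s0 i : 0 < s i. Proof. exact: quad_node_gt0. Qed.
Let s1 i : s i <= 1. Proof. exact: quad_node_le1. Qed.
Let s01 i : 0 <= s i <= 1. Proof. exact: quad_node01. Qed.
Let NR : 0 < N%:R :> R. Proof. by rewrite ltr0n. Qed.

(** The exponent -3/2 is [Re w - 2] on the line [Re w = 1/2]; as [s <= 1], this dominates the
    multipliers for every [w] to the right of that line. *)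
Definition coef_mass A B : R :=
  \sum_(i < N) kernel_coef (s i) A B * (N%:R^-1 * s i `^ (- (3 / 2))).

Lemma coef_mass_ge0 A B : 0 <= coef_mass A B.
Proof.
apply: sumr_ge0 => i _; rewrite mulr_ge0 ?kernel_coef_ge0// mulr_ge0 ?powR_ge0//.
Qed.

Lemma half_power_sum : \sum_(i < N) N%:R^-1 * s i `^ (- (1 / 2)) <= 2.
Proof.
have := @quadrature_power R N (1 / 2) N0; rewrite divr_gt0// => /(_ isT).
rewrite (_ : 1 / 2 - 1 = - (1 / 2) :> R); last by field.
move=> /le_trans; apply; rewrite ge_max invf_div divr1 lexx andbT.
by rewrite ler1n.
Qed.

Lemma power_shift i : s i * s i `^ (- (3 / 2)) = s i `^ (- (1 / 2)).
Proof.
rewrite -{1}(powRr1 (ltW (s0 i))) -powRD; last by apply/implyP => _; rewrite gt_eqF.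
by congr (_ `^ _); field.
Qed.

(** The random subset of [A] is nonempty with probability [1 - (1 - s)^|A| <= |A| s]. The gained
    factor [s] makes the weight integrable: [s^(-1/2)] has integral 2. *)
Lemma sum_coef_mass A : \sum_(B | B != finset.set0) coef_mass A B <= 2 * #|A|%:R.
Proof.
rewrite exchange_big /=.
apply: (@le_trans _ _ (\sum_(i < N) #|A|%:R * (N%:R^-1 * s i `^ (- (1 / 2))))).
  apply: ler_sum => i _; rewrite -mulr_suml.
  have := sum_kernel_coef (s i) A; rewrite (bigD1 finset.set0)//= => E.
  have -> : \sum_(B | B != finset.set0) kernel_coef (s i) A B = 1 - (1 - s i) ^+ #|A|.
    by move: E; rewrite kernel_coefE finset.sub0set cards0 expr0 mul1r subn0; lra.
  rewrite -power_shift [N%:R^-1 * (s i * _)]mulrCA [leRHS]mulrA ler_wpM2r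
    ?bernoulli_le//.
  by rewrite mulr_ge0 ?powR_ge0// invr_ge0 ltW.
by rewrite -mulr_sumr mulrC ler_wpM2r// half_power_sum.
Qed.

(** A Riemann sum of [s^(-1/2) (1 - s)^(k-1)], [k = |A|]. Below [s = 1/k] the second factor is
    dropped, which costs [2 k^(-1/2)]; above, [s^(-1/2) <= k^(1/2)] and the beta integral [1/k] give
    [k^(-1/2)]. *)
Lemma coef_mass1 A B : #|B| = 1%N -> B \subset A -> coef_mass A B ^+ 2 <= 9 / #|A|%:R.
Proof.
move=> B1 BA; have A0 : (0 < #|A|)%N by rewrite -B1 subset_leq_card.
have AR : 0 < #|A|%:R :> R by rewrite ltr0n.
pose q := (#|A|%:R : R) `^ (- (1 / 2)).
have q2 : q ^+ 2 = #|A|%:R^-1.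
  rewrite -powR_mulrn ?powR_ge0// -powRrM (_ : - (1 / 2) * 2%:R = -1); last by field.
  by rewrite powR_inv1 ?ltW.
suff h : coef_mass A B <= 3 * q.
  have -> : 9 / #|A|%:R = (3 * q) ^+ 2 by rewrite exprMn q2; congr (_ * _); ring.
  by rewrite lerXn2r ?nnegrE ?coef_mass_ge0// mulr_ge0 ?powR_ge0.
(* The nodes of index below [M] are exactly those at most [1 / |A|]. *)
pose M := (N %/ #|A|)%N.
have MN : (M <= N)%N by rewrite leq_div.
apply: (@le_trans _ _ (\sum_(i < N) ((if (i < M)%N then N%:R^-1 * s i `^ (- (1 / 2))
  else 0) +
     (#|A|%:R * q) * (N%:R^-1 * (1 - s i) ^+ #|A|.-1)))).
  apply: ler_sum => i _; rewrite kernel_coefE BA B1 expr1 subn1.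
  rewrite [leLHS](_ : _ = N%:R^-1 * (s i * s i `^ (- (3 / 2))) * (1 - s i) ^+
    #|A|.-1); last by rewrite -/(s i); ring.
  rewrite power_shift.
  have p0 : 0 <= (1 - s i) ^+ #|A|.-1 by rewrite exprn_ge0// subr_ge0.
  have p1 : (1 - s i) ^+ #|A|.-1 <= 1 by rewrite exprn_ile1// ?subr_ge0// lerBlDr
    lerDl ltW.
  have n0 : 0 <= N%:R^-1 :> R by rewrite invr_ge0 ltW.
  case: ifPn => iM.
    rewrite -[leLHS]addr0 lerD// ?mulr_ge0 ?powR_ge0//.
    by rewrite -mulrA ler_wpM2l// ler_piMr// powR_ge0.
  rewrite add0r -mulrA [leRHS]mulrCA ler_wpM2l// ler_wpM2r//.
  have -> : #|A|%:R * q = #|A|%:R `^ (1 / 2).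
    rewrite /q -{1}(powRr1 (ltW AR)) -powRD; last by apply/implyP => _; rewrite gt_eqF.
    by congr (_ `^ _); field.
  have -> : s i `^ (- (1 / 2)) = (s i)^-1 `^ (1 / 2).
    by rewrite -[(s i)^-1]powR_inv1 ?(ltW (s0 i))// -powRrM mulN1r.
  rewrite ge0_ler_powR ?divr_ge0 ?nnegrE ?invr_ge0 ?(ltW (s0 i))//.
  rewrite /s /quad_node invf_div ler_pdivrMr ?ltr0n// -natrM ler_nat.
  by move: iM; rewrite -leqNgt /M => iM; rewrite mulnC ltnW// -ltn_divLR.
rewrite big_split /= (_ : 3 * q = 2 * q + q); last by ring.
rewrite lerD//.
  rewrite -big_mkcond /= (_ : \sum_(i < N | (i < M)%N) _ = \sum_(i < M) N%:R^-1 *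
    quad_node R N i `^ (- (1 / 2))).
    have h12 : 0 < (1 / 2 : R) < 1 by lra.
    have := @quadrature_power_lt1 R N M (1 / 2) N0 MN h12.
    rewrite (_ : 1 / 2 - 1 = - (1 / 2) :> R); last by field.
    move=> /le_trans; apply; rewrite invf_div divr1 ler_wpM2l//.
    have -> : q = (#|A|%:R^-1) `^ (1 / 2).
      by rewrite /q -[#|A|%:R^-1]powR_inv1 ?(ltW AR)// -powRrM mulN1r.
    rewrite ge0_ler_powR ?divr_ge0 ?nnegrE ?invr_ge0//.
    by rewrite ler_pdivrMr// mulrC ler_pdivlMr// -natrM ler_nat leq_divM.
  by rewrite (big_ord_widen _ (fun i => N%:R^-1 * quad_node R N i `^ (- (1 / 2))) MN).
rewrite -mulr_sumr -mulr_sumr mulrAC ler_piMl ?powR_ge0//.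
exact: quadrature_beta_le1.
Qed.

(** One factor [s] is spent on the weight. The strict inequalities leave at least one more [s] and
    one [1 - s], so [bernstein_mid_le] applies and gives [1 / (|A| - 1)]. *)
Lemma coef_mass_mid A B : (1 < #|B| < #|A|)%N -> B \subset A ->
  coef_mass A B <= 2 / (#|A|.-1)%:R.
Proof.
move=> /andP[B1 BA'] BA; have A1 : 0 < (#|A|.-1)%:R :> R by rewrite ltr0n;
  case: #|A| BA' B1 => [|[|]] // h; case: #|B| h.
apply: (@le_trans _ _ (\sum_(i < N) (#|A|.-1)%:R^-1 * (N%:R^-1 * s i `^ (- (1 / 2))))).
  apply: ler_sum => i _; rewrite kernel_coefE BA.
  have n0 : 0 <= N%:R^-1 :> R by rewrite invr_ge0 ltW.
  rewrite -/(s i) -(prednK (ltnW B1)) exprS prednK ?(ltnW B1)//.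
  rewrite [leLHS](_ : _ = (s i ^+ #|B|.-1 * (1 - s i) ^+ (#|A| - #|B|)) * (N%:R^-1 *
    (s i * s i `^ (- (3 / 2))))); last by ring.
  rewrite power_shift ler_wpM2r ?mulr_ge0 ?powR_ge0//.
  rewrite -[leRHS]mul1r ler_pdivlMr// mulrC.
  have -> : (#|A|.-1 = #|B|.-1 + (#|A| - #|B|))%N.
    by move: B1 BA'; case: #|B| #|A| => [//|b] [//|a] /= _ ab;
      rewrite subSS subnKC// -ltnS ltnW.
  by rewrite bernstein_mid_le// ?subn_gt0//; case: #|B| B1 => // -[].
by rewrite -mulr_sumr mulrC ler_wpM2r ?invr_ge0 ?(ltW A1)// half_power_sum.
Qed.

Lemma coef_mass_top A : (1 < #|A|)%N -> coef_mass A A <= 1.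
Proof.
move=> A1; apply: (@le_trans _ _ (\sum_(i < N) N%:R^-1)); last first.
  by rewrite sumr_const card_ord -[_ *+ N]mulr_natr mulVf// gt_eqF.
apply: ler_sum => i _; rewrite kernel_coefE subxx subnn expr0 mulr1.
have n0 : 0 <= N%:R^-1 :> R by rewrite invr_ge0 ltW.
rewrite mulrCA ler_piMr// -/(s i) -powR_mulrn ?(ltW (s0 i))// -powRD; last first.
  by apply/implyP => _; rewrite gt_eqF.
rewrite -[leRHS](powRr0 (s i)); apply: ger_powR; first by rewrite s0 s1.
have : 2 <= #|A|%:R :> R by rewrite ler_nat.
lra.
Qed.

(** 16 = 9 + 1 + 6. The [|A|] singletons contribute [9 / |A|] each, and [B = A] at most 1. The
    others are bounded by their maximum times their sum, [2 / (|A| - 1)] times [2 |A|], at most 6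
    when [|A| >= 3]; a smaller [A] contains no odd set but singletons. *)
Lemma coef_sq_sum A : \sum_(B : {set 'I_n} | odd #|B|) coef_mass A B ^+ 2 <= 16.
Proof.
have z B : ~~ (B \subset A) -> coef_mass A B ^+ 2 = 0.
  move=> BA; rewrite /coef_mass big1 ?expr0n// => i _.
  by rewrite kernel_coefE (negbTE BA) mul0r.
rewrite (bigID (fun B : {set 'I_n} => #|B| == 1%N)) /=.
have S1 : \sum_(B : {set 'I_n} | odd #|B| && (#|B| == 1%N)) coef_mass A B ^+ 2 <= 9.
  apply: (@le_trans _ _ (\sum_(B : {set 'I_n} | (B \subset A) && (#|B| == 1%N)) 9 /
    #|A|%:R)).
    rewrite big_mkcond [leRHS]big_mkcond; apply: ler_sum => B _ /=.
    have [/eqP B1|B1] := boolP (#|B| == 1%N); last by rewrite !andbF.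
    rewrite B1 /=; case: ifPn => BA; first by rewrite andbT in BA; exact: coef_mass1.
    by rewrite z// -(andbT (_ \subset _)).
  rewrite sumr_const.
  have -> : #|[pred B : {set 'I_n} | (B \subset A) && (#|B| == 1%N)]| = #|A|.
    rewrite -[RHS]bin1 -cards_draws.
    by apply: eq_card => B; rewrite !inE.
  have [->|A0] := eqVneq #|A| 0%N; first by rewrite mulr0n.
  by rewrite -[_ *+ _]mulr_natr divfK// pnatr_eq0.
have [A3|A3] := leqP #|A| 2.
  rewrite [X in _ + X]big1 ?addr0; last first.
    move=> B /andP[Bo B1]; rewrite z//; apply/negP => /subset_leq_card BA.
    by move: (leq_trans BA A3) Bo B1; case: #|B| => [|[|[|]]].
  by rewrite (le_trans S1)// ler_nat.
rewrite [X in _ + X](bigID (pred1 A)) /=.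
have S2 : \sum_(B : {set 'I_n} | odd #|B| && (#|B| != 1%N) && (B == A)) coef_mass A B
  ^+ 2 <= 1.
  have t : coef_mass A A ^+ 2 <= 1.
    by rewrite expr_le1// ?coef_mass_ge0// coef_mass_top// ltnW.
  apply: (@le_trans _ _ (\sum_(B : {set 'I_n} | B == A) coef_mass A B ^+ 2)).
    rewrite big_mkcond [leRHS]big_mkcond; apply: ler_sum => B _ /=.
    by case: (B == A); rewrite ?andbF// andbT; case: ifP => // _; exact: sqr_ge0.
  by rewrite big_pred1_eq.
have AR : 0 < (#|A|.-1)%:R :> R by rewrite ltr0n; case: #|A| A3 => // -[].
have S3 : \sum_(B : {set 'I_n} | odd #|B| && (#|B| != 1%N) && (B != A)) coef_mass A B
  ^+ 2 <=
    2 / (#|A|.-1)%:R * (2 * #|A|%:R).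
  apply: (@le_trans _ _ (\sum_(B : {set 'I_n} | B != finset.set0) 2 / (#|A|.-1)%:R *
    coef_mass A B)); last first.
    by rewrite -mulr_sumr ler_wpM2l ?sum_coef_mass// divr_ge0// ltW.
  rewrite big_mkcond [leRHS]big_mkcond; apply: ler_sum => B _ /=.
  have p : 0 <= 2 / (#|A|.-1)%:R * coef_mass A B by rewrite mulr_ge0 ?coef_mass_ge0//
    divr_ge0// ltW.
  case: ifPn => [/andP[/andP[Bo B1] nBA]|_]; last by case: ifP.
  have -> : B != finset.set0 by apply: contraTneq Bo => ->; rewrite cards0.
  have [BA|/z ->//] := boolP (B \subset A).
  rewrite expr2 ler_wpM2r ?coef_mass_ge0// coef_mass_mid//.
  have lt2 : (#|B| < #|A|)%N by apply: proper_card; rewrite finset.properEneq nBA.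
  by rewrite lt2 andbT; move: Bo B1; case: #|B| => [|[|]].
have S4 : 2 / (#|A|.-1)%:R * (2 * #|A|%:R) <= 6 :> R.
  have E : #|A|%:R = (#|A|.-1)%:R + 1 :> R by rewrite natr1 prednK// (leq_trans _ A3).
  have A2 : 2 <= (#|A|.-1)%:R :> R by rewrite ler_nat; case: #|A| A3 => // -[].
  by rewrite mulrAC ler_pdivrMr// E; lra.
by apply: (le_trans (lerD S1 (lerD S2 (le_trans S3 S4)))); lra.
Qed.
End coefficient_estimate.

(** * Orthogonality in a Hilbert space *)

Section hilbert.
Context (R : realType) (H : completeNormedModType R[i]) (ip : {dot H for Num.conj}).
Hypothesis ipE : forall x : H, `|x| ^+ 2 = ip x x.
Implicit Types (x y z : H).

Definition rip x y : R := complex.Re (ip x y).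

Lemma ripDl x y z : rip (x + y) z = rip x z + rip y z.
Proof. by rewrite /rip linearDl ReD. Qed.

Lemma ripZl (a : R) x z : rip (rscale a x) z = a * rip x z.
Proof. by rewrite /rip /rscale linearZl_LR Re_realM. Qed.

Lemma ripC x y : rip x y = rip y x.
Proof.
rewrite /rip hermC /= expr0 mul1r; by case: (ip y x).
Qed.

Lemma rip_self x : rip x x = rnorm x ^+ 2.
Proof. by rewrite /rip -ipE rnormE -rmorphXn. Qed.

Lemma ripDr x y z : rip z (x + y) = rip z x + rip z y.
Proof. by rewrite ![rip z _]ripC ripDl. Qed.

Lemma ripZr (a : R) x z : rip z (rscale a x) = a * rip z x.
Proof. by rewrite ![rip z _]ripC ripZl. Qed.

Lemma rip0l z : rip 0 z = 0.
Proof. by rewrite -(rscale0 z) ripZl mul0r. Qed.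

Lemma rip_suml (I : Type) (r : seq I) (P : pred I) (F : I -> H) z :
  rip (\sum_(i <- r | P i) F i) z = \sum_(i <- r | P i) rip (F i) z.
Proof. by apply: (big_morph (fun x => rip x z)) => [x y|]; rewrite ?ripDl ?rip0l. Qed.

Lemma rip_sumr (I : Type) (r : seq I) (P : pred I) (F : I -> H) z :
  rip z (\sum_(i <- r | P i) F i) = \sum_(i <- r | P i) rip z (F i).
Proof. by rewrite ripC rip_suml; apply: eq_bigr => i _; rewrite ripC. Qed.

Lemma rip_le x y : rip x y <= rnorm x * rnorm y.
Proof.
have [x0|x0] := eqVneq (rnorm x) 0.
  have /eqP -> : x == 0 by rewrite -rnorm_eq0 x0.
  by rewrite rip0l rnorm0 mul0r.
have x0' : 0 < rnorm x by rewrite lt_def x0 rnorm_ge0.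
have := sqr_ge0 (rnorm (rscale (rnorm y) x - rscale (rnorm x) y)).
rewrite -rip_self.
have -> : rscale (rnorm y) x - rscale (rnorm x) y = rscale (rnorm y) x + rscale (-
  rnorm x) y.
  by rewrite /rscale rmorphN scaleNr.
rewrite !ripDl !ripDr !ripZl !ripZr !rip_self (ripC y x) => h.
have [y0|y0] := eqVneq (rnorm y) 0.
  have /eqP -> : y == 0 by rewrite -rnorm_eq0 y0.
  by rewrite ripC rip0l rnorm0 mulr0.
have y0' : 0 < rnorm y by rewrite lt_def y0 rnorm_ge0.
rewrite -(ler_pM2l (mulr_gt0 x0' y0')); lra.
Qed.

(** Stated for any finite orthogonal system, since the Walsh matrix is used both with sets and,
    transposed, with points of the cube as indices of summation. *)
Lemma parseval (I J : finType) (phi : I -> J -> R) (c : R) (h : I -> H) :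
  (forall i i', \sum_j phi i j * phi i' j = (if i == i' then c else 0)) ->
  \sum_j rnorm (\sum_i rscale (phi i j) (h i)) ^+ 2 = c * \sum_i rnorm (h i) ^+ 2.
Proof.
move=> orth.
transitivity (\sum_j \sum_i \sum_i' phi i j * phi i' j * rip (h i) (h i')).
  apply: eq_bigr => j _; rewrite -rip_self rip_suml; apply: eq_bigr => i _.
  by rewrite rip_sumr; apply: eq_bigr => i' _; rewrite ripZl ripZr mulrA.
rewrite exchange_big mulr_sumr /=; apply: eq_bigr => i _.
rewrite exchange_big /= (bigD1 i)//= -mulr_suml orth eqxx rip_self big1 ?addr0//.
by move=> i' ii'; rewrite -mulr_suml orth eq_sym (negbTE ii') mul0r.
Qed.

Lemma cauchy_schwarz_sum (I : finType) (P : pred I) (a b : I -> R) :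
  (\sum_(i | P i) a i * b i) ^+ 2 <= (\sum_(i | P i) a i ^+ 2) * (\sum_(i | P i) b i
    ^+ 2).
Proof.
have : 0 <= \sum_(i | P i) \sum_(j | P j) (a i * b j - a j * b i) ^+ 2.
  by apply: sumr_ge0 => i _; apply: sumr_ge0 => j _; exact: sqr_ge0.
have -> : \sum_(i | P i) \sum_(j | P j) (a i * b j - a j * b i) ^+ 2 =
   2 * ((\sum_(i | P i) a i ^+ 2) * (\sum_(i | P i) b i ^+ 2)) - 2 * (\sum_(i | P i) a
     i * b i) ^+ 2.
  transitivity (\sum_(i | P i) \sum_(j | P j) (a i ^+ 2 * b j ^+ 2 + b i ^+ 2 * a j ^+
    2 - 2 * (a i * b i) * (a j * b j))).
    by apply: eq_bigr => i _; apply: eq_bigr => j _; ring.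
  have S (f g : I -> R) : \sum_(i | P i) \sum_(j | P j) f i * g j = (\sum_(i | P i) f
    i) * (\sum_(i | P i) g i).
    by rewrite mulr_suml; apply: eq_bigr => i _; rewrite mulr_sumr.
  under eq_bigr do rewrite sumrB big_split /=.
  rewrite sumrB big_split /= !S; rewrite expr2 -!mulr_sumr; ring.
lra.
Qed.

Context (n : nat).

(** [h A] is a Walsh coefficient of the image and [X A B] one of [x]: Parseval in [e],
    Cauchy-Schwarz over the odd [B] with [coef_sq_sum], then Parseval over the pairs. *)
Lemma ckernel_L2 N w (x : cube n * cube n -> H) : (0 < N)%N -> 1 / 2 <= complex.Re w ->
  \sum_e rnorm (\sum_u ckernel N w e u *: x u) ^+ 2 <= 16 * (2 ^- n * \sum_u rnorm (x
    u) ^+ 2).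
Proof.
move=> N0 w12.
pose m (A B : {set 'I_n}) : R[i] := \sum_(i < N) (kernel_coef (quad_node R N i) A
  B)%:C * weight N w i.
pose phi (AB : {set 'I_n} * {set 'I_n}) (u : cube n * cube n) : R := walsh R AB.1 u.1
  * walsh R AB.2 u.2.
pose X A B := \sum_u rscale (phi (A, B) u) (rscale (4 ^- n) (x u)).
pose h A := \sum_(B : {set 'I_n} | odd #|B|) m A B *: X A B.
have E e : \sum_u ckernel N w e u *: x u = \sum_A rscale (walsh R A e) (h A).
  under [RHS]eq_bigr => A _.
    rewrite /h rscale_sumr.
    under eq_bigr => B _ do rewrite /X /rscale scaler_sumr scaler_sumr.
    rewrite exchange_big; over.
  rewrite [RHS]exchange_big /=; apply: eq_bigr => u _.
  under [RHS]eq_bigr => A _.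
    under eq_bigr => B _ do rewrite !scalerA.
    rewrite -scaler_suml; over.
  rewrite -scaler_suml; congr (_ *: _).
  rewrite /ckernel.
  under eq_bigr => i _.
    rewrite kernelE mulr_sumr rmorph_sum mulr_suml; over.
  rewrite exchange_big /=; apply: eq_bigr => A _.
  under eq_bigr => i _.
    rewrite mulr_sumr rmorph_sum mulr_suml; over.
  rewrite exchange_big /=; apply: eq_bigr => B _.
  rewrite /m mulr_sumr !mulr_suml; apply: eq_bigr => i _.
  by rewrite /phi /= !rmorphM /=; ring.
under eq_bigr do rewrite E.
rewrite (parseval (phi := fun A e => walsh R A e) _ (c := 2 ^+ n));
  last exact: sum_walsh_cube.
have mle A B : cabs (m A B) <= coef_mass R N A B.
  rewrite (le_trans (cabs_sum _ _ _))//; apply: ler_sum => i _.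
  have s01 := quad_node01 R (ltn_ord i).
  rewrite cabsM cabs_real cabs_weight// ger0_norm ?kernel_coef_ge0//.
  rewrite ler_wpM2l ?kernel_coef_ge0// ler_wpM2l ?invr_ge0//.
  apply: ger_powR; first by rewrite quad_node_gt0 ?quad_node_le1.
  lra.
have hle A : rnorm (h A) ^+ 2 <= 16 * \sum_B rnorm (X A B) ^+ 2.
  apply: (@le_trans _ _ ((\sum_(B : {set 'I_n} | odd #|B|) coef_mass R N A B * rnorm
    (X A B)) ^+ 2)).
    rewrite lerXn2r ?nnegrE ?rnorm_ge0//.
      by apply: sumr_ge0 => B _; rewrite mulr_ge0 ?coef_mass_ge0 ?rnorm_ge0.
    rewrite (le_trans (ler_rnorm_sum _ _ _))//; apply: ler_sum => B _.
    by rewrite rnormZc ler_wpM2r ?rnorm_ge0.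
  rewrite (le_trans (cauchy_schwarz_sum _ _ _))// ler_pM//.
  - by apply: sumr_ge0 => B _; exact: sqr_ge0.
  - by apply: sumr_ge0 => B _; exact: sqr_ge0.
  - exact: coef_sq_sum.
  - rewrite [leLHS]big_mkcond; apply: ler_sum => B _; case: ifP => // _; exact: sqr_ge0.
apply: (@le_trans _ _ (2 ^+ n * \sum_A 16 * \sum_B rnorm (X A B) ^+ 2)).
  by rewrite ler_wpM2l ?exprn_ge0//; apply: ler_sum => A _.
rewrite -mulr_sumr (pair_bigA _ (fun A B => rnorm (X A B) ^+ 2)) /=.
have -> : \sum_(p : {set 'I_n} * {set 'I_n}) rnorm (X p.1 p.2) ^+ 2 = 4 ^+ n * \sum_u
  rnorm (rscale (4 ^- n) (x u)) ^+ 2.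
  rewrite -(parseval (phi := fun u AB => phi AB u)).
    by apply: eq_bigr => -[A B] _.
  move=> [z d] [z' d']; rewrite /phi /=.
  transitivity (\sum_A \sum_B (walsh R A z * walsh R A z') * (walsh R B d * walsh R B
    d')).
    rewrite (pair_bigA _ (fun A B => (walsh R A z * walsh R A z') * (walsh R B d *
      walsh R B d'))) /=.
    by apply: eq_bigr => -[A B] _ /=; ring.
  under eq_bigr do rewrite -mulr_sumr sum_walsh_set.
  rewrite -mulr_suml sum_walsh_set xpair_eqE.
  case: (z == z'); case: (d == d') => /=; rewrite ?mul0r ?mulr0//.
  by rewrite -exprMn; congr (_ ^+ _); ring.
have -> : \sum_u rnorm (rscale (4 ^- n) (x u)) ^+ 2 = (4 ^- n) ^+ 2 * \sum_u rnorm (x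
  u) ^+ 2.
  rewrite mulr_sumr; apply: eq_bigr => u _.
  by rewrite rnorm_rscale exprMn real_normK ?num_real.
rewrite le_eqVlt; apply/orP; left; apply/eqP.
have -> : (4 ^+ n : R) = 2 ^+ n * 2 ^+ n by rewrite -exprMn; congr (_ ^+ _); ring.
by field; rewrite expf_neq0.
Qed.

End hilbert.

(** * Interpolation *)

Section bounded_holomorphic.
Context (R : realType).
Notation scal := (R[i]^o).
Implicit Types (f g : R[i] -> scal).

Definition bholo f := holo2 f /\ exists B : R, forall z, strip z -> cabs (f z) <= B.

Lemma bholo_multiplier f : bholo f -> multiplier f.
Proof. by move=> [hf bf]; split=> //; exact: holo2_holo1. Qed.

Lemma bholo_cst (c : R[i]) : bholo (fun=> c).
Proof. by split; [exact: holo2_cst|exists (cabs c)]. Qed.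

Lemma bholoM f g : bholo f -> bholo g -> bholo (fun z => f z * g z).
Proof.
move=> [hf [B fB]] [hg [C gC]]; split; first exact: holo2M.
by exists (B * C) => z zs; rewrite cabsM ler_pM ?cabs_ge0 ?fB ?gC.
Qed.

Lemma bholo_sum (I : Type) (r : seq I) (F : I -> R[i] -> scal) :
  (forall i, bholo (F i)) -> bholo (fun z => \sum_(i <- r) F i z).
Proof.
move=> hF; split; first by apply: holo2_sum => i; exact: (hF i).1.
have [B hB] := choice (fun i => (hF i).2).
exists (\sum_(i <- r) B i) => z zs; rewrite (le_trans (cabs_sum _ _ _))//.
by apply: ler_sum => i _; exact: hB.
Qed.

(** As the slope [b] is real, the modulus depends on [Re z] only, hence is bounded on the strip. *)
Lemma bholo_exp (a : R[i]) (b : R) : bholo (fun z => cexp (a + b%:C * z)).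
Proof.
split; first exact: holo2_affine_exp.
exists (expR (complex.Re a + `|b|)) => z /andP[z0 z1].
rewrite cabs_cexp ler_expR ReD Re_realM lerD2l (le_trans (ler_norm _))//.
by rewrite normrM (ger0_norm z0) ler_piMr.
Qed.

Lemma bholo_ckernel (n N : nat) (a : R[i]) (b : R) (e : cube n) u :
  bholo (fun z => ckernel N (a + b%:C * z) e u).
Proof.
apply: bholo_sum => i; apply: bholoM; first exact: bholo_cst.
apply: bholoM; first exact: bholo_cst.
have := bholo_exp ((a - 2) * (ln (quad_node R N i))%:C) (b * ln (quad_node R N i)).
congr bholo; apply/funext => z; congr cexp.
by rewrite rmorphM /=; ring.
Qed.

End bounded_holomorphic.

(** * L_p estimates over a Hilbert space *)

Section hilbert_Lp.
Context (R : realType) (H : completeNormedModType R[i]) (ip : {dot H for Num.conj}).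
Hypothesis ipE : forall x : H, `|x| ^+ 2 = ip x x.

(** The exponential stands for [A^z] only when [A > 0]; at [A = 0] the vanishing of [g] takes
    over. *)
Lemma rnorm_cexp_ln (A : R) (z : R[i]) (g : H) : 0 <= A -> rnorm g <= 1 -> (A = 0 -> g
  = 0) ->
  rnorm (cexp (z * (ln A)%:C) *: g) <= A `^ complex.Re z.
Proof.
rewrite le_eqVlt => /predU1P[<-|A0] g1 g0;
  first by rewrite g0// scaler0 rnorm0 powR_ge0.
rewrite rnormZc cabs_cexp [z * _]mulrC Re_realM /powR gt_eqF// [complex.Re z * _]mulrC.
by rewrite ler_piMr ?expR_ge0.
Qed.

Lemma normalized_vector (x : H) : rnorm (rscale (rnorm x)^-1 x) <= 1 /\
  rscale (rnorm x) (rscale (rnorm x)^-1 x) = x.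
Proof.
rewrite rnorm_rscale rscaleA; have [x0|x0] := eqVneq (rnorm x) 0.
  have /eqP xz : x == 0 by rewrite -rnorm_eq0 x0.
  by rewrite x0 mulr0 mul0r rscale0 xz.
rewrite ger0_norm ?invr_ge0 ?rnorm_ge0// mulVf// divff// rscale1; split=> //.
Qed.

Context (n : nat).

(* Stein interpolation between L_2 and L_1 (sg = 1) or L_oo (sg = 0). *)
Lemma stein_interpolation N (m sg : R) (w : R[i]) (A : cube n * cube n -> R) (B : cube
  n -> R)
    (g : cube n * cube n -> H) (l : cube n -> H) :
  (0 < N)%N -> 2 <= m -> (sg == 0) || (sg == 1) -> complex.Re w = 1 - (2 * m)^-1 ->
  (forall u, 0 <= A u) -> (forall u, rnorm (g u) <= 1) -> (forall u, A u = 0 -> g u =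
    0) ->
  (forall e, 0 <= B e) -> (forall e, rnorm (l e) <= 1) -> (forall e, B e = 0 -> l e =
    0) ->
  2 ^- n * \sum_u A u <= 1 -> \sum_e B e <= 1 ->
  forall r, r = m^-1 + (1 - 2 / m) * sg ->
  \sum_e rip ip (\sum_u ckernel N w e u *: (cexp (r%:C * (ln (A u))%:C) *: g u))
               (cexp ((1 - r)%:C * (ln (B e))%:C) *: l e) <= 2 * m.
Proof.
move=> N0 m2 sg01 wE A0 g1 gA B0 l1 lB SA SB r rE.
have m0 : 0 < m by rewrite (lt_le_trans _ m2).
(* The point of the strip where the exponent [rr], which runs from 1/2 on the left line to [sg] on
   the right one, takes the value [r]. *)
pose eta := 1 - 2 / m.
have eta01 : 0 <= eta <= 1.
  by rewrite subr_ge0 ler_pdivrMr// mul1r m2 lerBlDr lerDl divr_ge0// ltW.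
pose rr (z : R[i]) : R[i] := 2^-1%:C + (sg - 2^-1)%:C * z.
(* Equal to [w] at [eta]; its real part runs from [1/2 + 1/(2m)], within reach of the L_2 estimate,
   to [1 + 1/(2m)], where the Schur bound is [2m]. *)
pose ww (z : R[i]) : R[i] := (w - (eta / 2)%:C) + 2^-1%:C * z.
pose al u z : R[i] := cexp (rr z * (ln (A u))%:C).
pose be e z : R[i] := cexp ((1 - rr z) * (ln (B e))%:C).
pose Phi z : R[i]^o := \sum_e be e z * (\sum_u ckernel N (ww z) e u * al u z * ip (g
  u) (l e)).
have half2 : (1 : R[i]) = 2^-1%:C + 2^-1%:C.
  by rewrite -rmorphD /= (_ : 2^-1 + 2^-1 = 1 :> R)//; field.
have hPhi : bholo Phi.
  apply: bholo_sum => e; apply: bholoM.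
    have := bholo_exp (2^-1%:C * (ln (B e))%:C) ((2^-1 - sg) * ln (B e)).
    congr bholo; apply/funext => z; congr cexp; rewrite /rr.
    rewrite [1 in RHS]half2.
    by rewrite !rmorphM !rmorphB /=; ring.
  apply: bholo_sum => u; apply: bholoM; last exact: bholo_cst.
  apply: bholoM; first exact: bholo_ckernel.
  have := bholo_exp (2^-1%:C * (ln (A u))%:C) ((sg - 2^-1) * ln (A u)).
  congr bholo; apply/funext => z; congr cexp; rewrite /rr.
  by rewrite !rmorphM !rmorphB /=; ring.
pose Y e z := \sum_u ckernel N (ww z) e u *: (al u z *: g u).
have PhiE z : complex.Re (Phi z) = \sum_e rip ip (be e z *: Y e z) (l e).
  rewrite /Phi Re_sum; apply: eq_bigr => e _; rewrite /rip linearZl_LR;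
    congr (complex.Re (_ * _)).
  rewrite /Y linear_sumlz; apply: eq_bigr => u _.
  by rewrite !linearZl_LR /= -mulrA.
have bound z : complex.Re (Phi z) <= \sum_e rnorm (be e z *: l e) * rnorm (Y e z).
  rewrite PhiE; apply: ler_sum => e _; rewrite (le_trans (rip_le ipE _ _))// !rnormZc.
  by rewrite le_eqVlt mulrAC eqxx.
have lbe e z : rnorm (be e z *: l e) <= B e `^ (1 - complex.Re (rr z)).
  rewrite -[X in _ <= _ `^ (X - _)]/(complex.Re (1 : R[i])) -raddfB.
  by apply: rnorm_cexp_ln => //; exact: lB.
have lal u z : rnorm (al u z *: g u) <= A u `^ complex.Re (rr z).
  by apply: rnorm_cexp_ln => //; exact: gA.
have m4 : 4 <= 2 * m by rewrite (_ : 4 = 2 * 2)// ?ler_pM2l//; ring.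
have line0 t : complex.Re (Phi (0 +i* t)) <= 2 * m.
  have rr0 : complex.Re (rr (0 +i* t)) = 2^-1.
    by rewrite /rr ReD Re_realM /= mulr0 addr0.
  have ww0 : 1 / 2 <= complex.Re (ww (0 +i* t)).
    rewrite /ww ReD Re_realM ReB wE /= mulr0 addr0 /eta.
    rewrite (_ : _ - _ = 1 / 2 + (2 * m)^-1); last by field; rewrite gt_eqF.
    by rewrite lerDl invr_ge0 mulr_ge0 ?(ltW m0).
  apply: le_trans m4; apply: le_trans (bound _) _.
  rewrite -[4]ger0_norm// -ler_sqr ?nnegrE; last 2 first.
  - by apply: sumr_ge0 => e _; rewrite mulr_ge0 ?rnorm_ge0.
  - by rewrite normr_ge0.
  rewrite (le_trans (cauchy_schwarz_sum _ _ _))// real_normK ?num_real//.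
  have -> : (4 : R) ^+ 2 = 1 * 16 by ring.
  rewrite ler_pM ?sumr_ge0//; try by move=> e _; exact: sqr_ge0.
    apply: le_trans SB; apply: ler_sum => e _.
    have -> : B e = (B e `^ (1 - 2^-1)) ^+ 2.
      by rewrite -powR_mulrn ?powR_ge0// -powRrM (_ : _ * _ = 1) ?powRr1//; field.
    by rewrite lerXn2r ?nnegrE ?rnorm_ge0 ?powR_ge0// -rr0 lbe.
  rewrite (le_trans (ckernel_L2 ipE _ N0 ww0))// -[leRHS]mulr1 ler_pM2l//.
  apply: le_trans SA; rewrite ler_wpM2l ?invr_ge0 ?exprn_ge0//; apply: ler_sum => u _.
  have -> : A u = (A u `^ 2^-1) ^+ 2.
    by rewrite -powR_mulrn ?powR_ge0// -powRrM mulVf// powRr1.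
  by rewrite lerXn2r ?nnegrE ?rnorm_ge0 ?powR_ge0// -rr0 lal.
have line1 t : complex.Re (Phi (1 +i* t)) <= 2 * m.
  have rr1 : complex.Re (rr (1 +i* t)) = sg.
    by rewrite /rr ReD Re_realM /= mulr1 addrC subrK.
  have ww1 : complex.Re (ww (1 +i* t)) = 1 + (2 * m)^-1.
    rewrite /ww ReD Re_realM ReB wE /= mulr1 /eta; field; rewrite gt_eqF//.
  have ww1' : 1 < complex.Re (ww (1 +i* t)) by rewrite ww1 ltrDl invr_gt0 mulr_gt0.
  have G : Num.max 1 (complex.Re (ww (1 +i* t)) - 1)^-1 = 2 * m.
    by rewrite ww1 addrC addKr invrK; apply/max_idPr; rewrite (le_trans _ m4)// ler1n.
  apply: le_trans (bound _) _.
  have Yle e : rnorm (Y e (1 +i* t)) <= \sum_u cabs (ckernel N (ww (1 +i* t)) e u) * A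
    u `^ sg.
    rewrite (le_trans (ler_rnorm_sum _ _ _))//; apply: ler_sum => u _.
    by rewrite rnormZc ler_wpM2l ?cabs_ge0// -rr1 lal.
  (* For [sg = 0] the operator acts on L_oo and the row sums count; for [sg = 1] it acts on L_1 and
     the column sums count. *)
  case/orP: sg01 => /eqP sgE.
    apply: (@le_trans _ _ (\sum_e B e * (2 * m))); last first.
      by rewrite -mulr_suml ler_piMl// mulr_ge0 ?(ltW m0).
    apply: ler_sum => e _; rewrite ler_pM ?rnorm_ge0//.
      by rewrite (le_trans (lbe _ _))// rr1 sgE subr0 powRr1.
    rewrite (le_trans (Yle e))// -G; apply: le_trans (ckernel_row e N0 ww1').
    by apply: ler_sum => u _; rewrite sgE powRr0 mulr1.
  apply: (@le_trans _ _ (\sum_e \sum_u cabs (ckernel N (ww (1 +i* t)) e u) * A u)).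
    apply: ler_sum => e _; rewrite -[leRHS]mul1r ler_pM ?rnorm_ge0//.
      by rewrite (le_trans (lbe _ _))// rr1 sgE subrr powRr0.
    by rewrite (le_trans (Yle e))//; apply: ler_sum => u _; rewrite sgE powRr1.
  rewrite exchange_big /=; apply: (@le_trans _ _ (\sum_u 2 ^- n * (2 * m) * A u)).
    apply: ler_sum => u _; rewrite -mulr_suml ler_wpM2r// -G; exact: ckernel_col.
  by rewrite -mulr_sumr mulrAC mulrC ler_piMr// mulr_ge0 ?(ltW m0).
have [B' hB'] := hPhi.2.
have := strip_max hPhi.1 (fun z zs => le_trans (Re_le _) (hB' z zs)) line0 line1 (z :=
  eta%:C).
rewrite /strip /= => /(_ eta01); apply: le_trans.
have rre : rr eta%:C = r%:C.
  rewrite /rr -rmorphM -rmorphD; congr (_%:C); rewrite rE /eta /=; field;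
    rewrite gt_eqF//.
have wwe : ww eta%:C = w by rewrite /ww -rmorphM /= [2^-1 * _]mulrC subrK.
rewrite PhiE; apply: ler_sum => e _;
  rewrite /Y /al /be wwe rre -rmorphB -!rmorphM !cexp_real.
by rewrite -!/(rscale _ _) (ripZr ip) (ripZl ip).
Qed.

(** Duality: [x] is normalized to [A^(1/p) g] and tested against [B^(1-1/p) l], the norming
    functional of its image [h]. The pairing bounded by [stein_interpolation] is then
    [(T / S)^(1/p)]. *)
Lemma ckernel_Lp N (p m : R) (w : R[i]) (x : cube n * cube n -> H) :
  (0 < N)%N -> 1 < p -> m = Num.max p (p / (p - 1)) -> complex.Re w = 1 - (2 * m)^-1 ->
  \sum_e rnorm (\sum_u ckernel N w e u *: x u) `^ p <=
    (2 * m) `^ p * (2 ^- n * \sum_u rnorm (x u) `^ p).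
Proof.
move=> N0 p1 mE wE; have p0 : 0 < p by rewrite (lt_trans ltr01).
have q0 : 0 < p - 1 by rewrite subr_gt0.
(* L_oo serves for [p >= 2], where [m = p], and L_1 for [p < 2], where [m] is the conjugate
   exponent. *)
have [sg [sg01 m2 rE]] : exists sg : R, [/\ (sg == 0) || (sg == 1), 2 <= m & m^-1 + (1
  - 2 / m) * sg = p^-1].
  rewrite mE; have [p2|p2] := leP 2 p.
    exists 0; rewrite eqxx; have -> : Num.max p (p / (p - 1)) = p.
      by apply/max_idPl; rewrite ler_pdivrMr// ler_peMr ?(ltW p0)// lerBrDr.
    by split=> //; rewrite mulr0 addr0.
  exists 1; rewrite eqxx orbT; have -> : Num.max p (p / (p - 1)) = p / (p - 1).
    by apply/max_idPr; rewrite ler_pdivlMr// ler_piMr ?(ltW p0)// lerBlDr ltW.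
  split=> //; first by rewrite ler_pdivlMr//; lra.
  by field; rewrite !gt_eqF.
have m0 : 0 < m by rewrite (lt_le_trans _ m2).
pose h e := \sum_u ckernel N w e u *: x u.
pose S := 2 ^- n * \sum_u rnorm (x u) `^ p.
pose T := \sum_e rnorm (h e) `^ p.
rewrite -/S -/T; have S0 : 0 <= S.
  by rewrite mulr_ge0 ?invr_ge0 ?exprn_ge0// sumr_ge0// => u _; exact: powR_ge0.
have T0 : 0 <= T by rewrite sumr_ge0// => u _; exact: powR_ge0.
have [->|Tn0] := eqVneq T 0; first by rewrite mulr_ge0 ?powR_ge0.
have Tp : 0 < T by rewrite lt_def Tn0.
have Sp : 0 < S.
  rewrite lt_def S0 andbT; apply: contra Tn0 => /eqP SE.
  have x0 u : x u = 0.
    apply/eqP; rewrite -rnorm_eq0; apply/eqP/(@powR_eq0_eq0 _ _ p)/eqP.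
    move/eqP: SE; rewrite mulf_eq0 invr_eq0 expf_eq0 pnatr_eq0 andbF /=.
    by rewrite psumr_eq0 => [/allP /(_ u)|? _];
      rewrite ?powR_ge0// mem_index_enum => /(_ isT).
  rewrite /T big1// => e _; rewrite /h big1 => [|u _]; last by rewrite x0 scaler0.
  by rewrite rnorm0 powR0// gt_eqF.
pose A u := rnorm (x u) `^ p / S.
pose B e := rnorm (h e) `^ p / T.
pose g u := rscale (rnorm (x u))^-1 (x u).
pose l e := rscale (rnorm (h e))^-1 (h e).
have A0 u : 0 <= A u by rewrite divr_ge0 ?powR_ge0.
have B0 e : 0 <= B e by rewrite divr_ge0 ?powR_ge0.
have zero (y : H) (Z : R) : 0 < Z -> rnorm y `^ p / Z = 0 -> y = 0.
  move=> Z0 /eqP; rewrite mulf_eq0 invr_eq0 (gt_eqF Z0) orbF => /eqP/powR_eq0_eq0/eqP.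
  by rewrite rnorm_eq0 => /eqP.
have gA u : A u = 0 -> g u = 0 by move=> /(zero _ _ Sp) xu;
  rewrite /g xu /rscale scaler0.
have lB e : B e = 0 -> l e = 0 by move=> /(zero _ _ Tp) xu;
  rewrite /l xu /rscale scaler0.
have SA : 2 ^- n * \sum_u A u <= 1 by rewrite -mulr_suml mulrA divff ?gt_eqF.
have SB : \sum_e B e <= 1 by rewrite -mulr_suml divff.
have := stein_interpolation N0 m2 sg01 wE A0 (fun u => (normalized_vector (x u)).1) gA
  B0 (fun e => (normalized_vector (h e)).1) lB SA SB (esym rE).
have powE (y : H) (Z r : R) : 0 < Z ->
    cexp (r%:C * (ln (rnorm y `^ p / Z))%:C) *: rscale (rnorm y)^-1 y =
    rscale (rnorm y `^ (p * r) * Z `^ (- r)) (rscale (rnorm y)^-1 y).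
  move=> Z0; have [y0|y0] := eqVneq (rnorm y) 0.
    have /eqP -> : y == 0 by rewrite -rnorm_eq0 y0.
    by rewrite /rscale !scaler0.
  have y0' : 0 < rnorm y by rewrite lt_def y0 rnorm_ge0.
  rewrite /rscale -rmorphM cexp_real; congr (_%:C *: _).
  rewrite lnM ?posrE ?powR_gt0 ?invr_gt0// lnV ?posrE// ln_powR.
  by rewrite /powR !gt_eqF// -expRD; congr expR; ring.
have E e : rip ip (\sum_u ckernel N w e u *: (cexp (p^-1%:C * (ln (A u))%:C) *: g u))
    (cexp ((1 - p^-1)%:C * (ln (B e))%:C) *: l e) = S `^ (- p^-1) * T `^ (p^-1 - 1) *
      rnorm (h e) `^ p.
  have -> : \sum_u ckernel N w e u *: (cexp (p^-1%:C * (ln (A u))%:C) *: g u) = rscale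
    (S `^ (- p^-1)) (h e).
    rewrite /h rscale_sumr; apply: eq_bigr => u _.
    rewrite powE// divff ?gt_eqF// powRr1 ?rnorm_ge0// mulrC -rscaleA
      (normalized_vector (x u)).2.
    by rewrite /rscale !scalerA mulrC.
  rewrite powE// (_ : p * (1 - p^-1) = p - 1); last by field; rewrite gt_eqF.
  rewrite (ripZl ip) (ripZr ip) (ripZr ip) (rip_self ipE) opprB.
  rewrite -(mulr_powRB1 (rnorm_ge0 _) p0); have [->|b0] := eqVneq (rnorm (h e)) 0.
    by rewrite expr0n mul0r !mulr0.
  by field.
under eq_bigr do rewrite E.
rewrite -mulr_sumr -/T => bound.
have : S `^ (- p^-1) * T `^ (p^-1 - 1) * T = (T / S) `^ p^-1.
  rewrite -mulrA [_ * T]mulrC -{1}(powRr1 T0) -powRD; last by apply/implyP => _.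
  rewrite (_ : 1 + (p^-1 - 1) = p^-1); last by ring.
  rewrite powRM ?invr_ge0// mulrC powRN; congr (_ * _).
  by rewrite -[S^-1]powR_inv1// -powRrM mulN1r powRN.
move=> TS; rewrite TS in bound.
rewrite -ler_pdivrMr//.
have -> : T / S = ((T / S) `^ p^-1) `^ p by rewrite -powRrM mulVf ?gt_eqF// powRr1//
  divr_ge0.
by rewrite ge0_ler_powR ?nnegrE ?powR_ge0 ?(ltW p0)// mulr_ge0// ltW.
Qed.

End hilbert_Lp.

(** * Interpolation between [H] and [Y], and Pisier's inequality *)

Section interpolated_operator.
Context (R : realType) (X Y H : completeNormedModType R[i]).
Hypothesis hH : is_hilbert H.
Context (c : compatible_couple H Y) (theta p : R).
Hypothesis (th01 : 0 < theta < 1) (p1 : 1 < p).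
Variable iota : {linear X -> sum_space c}.
Hypothesis iota_range : range iota = interp_space (c := c) theta.
Hypothesis iota_norm : forall x, rnorm x = interp_norm theta (iota x).

Let m : R := Num.max p (p / (p - 1)).
Let D : R := 2 * m / (1 - theta).
Let th0 : 0 < theta. Proof. by case/andP: th01. Qed.
Let th1 : 0 < 1 - theta. Proof. by rewrite subr_gt0; case/andP: th01. Qed.
Let p0 : 0 < p. Proof. by rewrite (lt_trans ltr01). Qed.
Let m1 : 1 < m. Proof. by rewrite lt_max p1. Qed.
Let m0 : 0 < m. Proof. by rewrite (lt_trans ltr01). Qed.

Lemma pisier_bound_gt0 : 0 < D.
Proof. by rewrite divr_gt0// mulr_gt0. Qed.

Let D0 := pisier_bound_gt0.

Lemma le_pisier_bound : 2 * m <= D.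
Proof.
rewrite ler_pdivlMr// ler_piMr ?mulr_ge0 ?(ltW m0)// lerBlDr lerDl ltW//.
Qed.

Context (n : nat).

(** The matrices [ckernel N (w z)] act on near-optimal Calderon functions of the vectors [x u]. At
    [theta] this yields the image of [x], and [interp_norm_sum_le] reduces the claim to the two
    boundary lines. *)
Lemma ckernel_interpolated N (x : cube n * cube n -> X) : (0 < N)%N ->
  \sum_e rnorm (\sum_u ckernel N 1 e u *: x u) `^ p <= D `^ p * (2 ^- n * \sum_u rnorm
    (x u) `^ p).
Proof.
move=> N0; have [ip ipE] := hH.
apply: (@le_expR_limit _ _ _ 0 (D `^ p * (2 ^- n * #|{: cube n * cube n}|%:R))) => d d0.
rewrite mul0r expR0 mul1r.
have [F HF] : exists F : cube n * cube n -> calderon_space c, forall u,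
    F u theta%:C = iota (x u) /\ calderon_norm (F u) `^ p <= rnorm (x u) `^ p + d.
  suff /choice[F HF] : forall u, exists F : calderon_space c,
      F theta%:C = iota (x u) /\ calderon_norm F `^ p <= rnorm (x u) `^ p + d by
        exists F.
  move=> u; have [r r0 hr] := powR_continuous_ge0 p0 (rnorm_ge0 (x u)) d0.
  have xi : interp_space (c := c) theta (iota (x u)) by rewrite -iota_range;
    exists (x u).
  have [F [Fx Fn]] := interp_norm_approx xi r0; exists F; split=> //.
  have Fge : rnorm (x u) <= calderon_norm F by rewrite iota_norm -Fx interp_norm_le.
  have := hr _ (calderon_norm_ge0 F); rewrite ger0_norm ?subr_ge0// ltrBlDl.
  rewrite {1}iota_norm => /(_ Fn) h; rewrite -lerBlDl.
  by rewrite (le_trans (ler_norm _))// ltW.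
pose b := (2 * m)^-1.
have b0 : 0 < b by rewrite invr_gt0 mulr_gt0.
(* The affine map with [w theta = 1] and real part [1 - b] on the left line, where [ckernel_Lp]
   holds; the right line is then forced to be at [1 + b (1 - theta) / theta]. *)
pose w (z : R[i]) : R[i] := (1 - b)%:C + (b / theta)%:C * z.
have mw (e : cube n) u : multiplier (fun z => ckernel N (w z) e u : R[i]^o).
  by apply: bholo_multiplier; exact: bholo_ckernel.
have [G HG] := choice (fun e => calderon_lincomb (index_enum _) F (mw e)).
have wth : w theta%:C = 1.
  by rewrite /w -rmorphM -rmorphD /= divfK ?gt_eqF// subrK.
have Gth e : G e theta%:C = iota (\sum_u ckernel N 1 e u *: x u).
  have [-> _ _] := HG e; rewrite raddf_sum; apply: eq_bigr => u _.
  by rewrite wth; have [-> _] := HF u; exact: esym (linearZ_LR iota _ _).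
under eq_bigr do rewrite iota_norm -Gth.
(* Serves both lines: boundary values are bounded by the Calderon norms, whose p-th powers exceed
   those of the norms of [x u] by at most [d]. *)
have key (V : normedModType R[i]) (y : cube n * cube n -> V) (S : R) :
    (forall u, rnorm (y u) <= calderon_norm (F u)) ->
    S <= D `^ p * (2 ^- n * \sum_u rnorm (y u) `^ p) ->
    S <= D `^ p * (2 ^- n * \sum_u rnorm (x u) `^ p) + D `^ p * (2 ^- n * #|{: cube n
      * cube n}|%:R) * d.
  move=> yF /le_trans; apply.
  rewrite -mulrA -mulrDr ler_wpM2l ?powR_ge0// -mulrA -mulrDr ler_wpM2l ?invr_ge0
    ?exprn_ge0//.
  rewrite mulr_natl -sumr_const -big_split /=; apply: ler_sum => u _.
  have [_ Fu] := HF u; apply: le_trans Fu.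
  by rewrite ge0_ler_powR ?nnegrE ?(ltW p0) ?rnorm_ge0 ?calderon_norm_ge0.
apply: interp_norm_sum_le => // t.
  apply: (@key _ (fun u => bdry0 (F u) t)) => [u|];
    first exact: (bdry_le_calderon_norm _ _).1.
  have wt : complex.Re (w (0 +i* t)) = 1 - (2 * m)^-1.
    by rewrite /w ReD Re_realM /= mulr0 addr0.
  apply: (@le_trans _ _ ((2 * m) `^ p * (2 ^- n * \sum_u rnorm (bdry0 (F u) t) `^
    p))); last first.
    rewrite ler_wpM2r ?mulr_ge0 ?invr_ge0 ?exprn_ge0 ?sumr_ge0//; first by move=> u _;
      exact: powR_ge0.
    by rewrite ge0_ler_powR ?nnegrE ?(ltW p0) ?le_pisier_bound ?(ltW D0)// mulr_ge0
      ?(ltW m0).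
  apply: le_trans (ckernel_Lp ipE (fun u => bdry0 (F u) t) N0 p1 (erefl m) wt).
  by apply: ler_sum => e _; have [_ -> _] := HG e.
apply: (@key _ (fun u => bdry1 (F u) t)) => [u|];
  first exact: (bdry_le_calderon_norm _ _).2.
have wt : complex.Re (w (1 +i* t)) = 1 - b + b / theta.
  by rewrite /w ReD Re_realM /= mulr1.
have wE : complex.Re (w (1 +i* t)) - 1 = (2 * m * theta / (1 - theta))^-1.
  by rewrite wt /b; field; rewrite !gt_eqF.
have wt1 : 1 < complex.Re (w (1 +i* t)).
  by rewrite -subr_gt0 wE invr_gt0 divr_gt0// !mulr_gt0.
apply: le_trans (ckernel_schur (fun u => bdry1 (F u) t) p1 N0 wt1 _); last first.
  rewrite ge_max wE invrK /D; apply/andP; split.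
    by apply: le_trans le_pisier_bound; have := m1; lra.
  rewrite ler_wpM2r ?invr_ge0 ?(ltW th1)// ler_piMr ?mulr_ge0 ?(ltW m0)//.
  by case/andP: th01 => _ /ltW.
by apply: ler_sum => e _; have [_ _ ->] := HG e.
Qed.

Lemma pisier_ineq_interpolated : @pisier_ineq R X n p D.
Proof.
move=> f.
pose x (u : cube n * cube n) : X := \sum_j rscale (sgb R (u.2 j)) (cube_laplacian (f
  j) u.1).
pose y e := \sum_j cube_partial j (f j) e.
have xE (e d : cube n) : \sum_(j < n) (-1) ^+ d j *: cube_laplacian (f j) e = x (e, d).
  rewrite /x; apply: eq_bigr => j _; rewrite /rscale; congr (_ *: _).
  by rewrite /sgb /=; case: (d j); rewrite ?expr1 ?expr0 ?rmorphN ?rmorph1.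
have main : \sum_e rnorm (y e) `^ p <= D `^ p * (2 ^- n * \sum_u rnorm (x u) `^ p).
  apply: (@le_expR_limit _ _ _ 0 #|{: cube n}|%:R) => d d0; rewrite mul0r expR0 mul1r.
  have cont e : exists r : R, 0 < r /\ forall v : X, rnorm (v - y e) < r ->
      rnorm (y e) `^ p <= rnorm v `^ p + d.
    have [r r0 hr] := powR_continuous_ge0 p0 (rnorm_ge0 (y e)) d0.
    exists r; split=> // v vr;
      have := hr _ (rnorm_ge0 v) (le_lt_trans (ler_dist_rnorm _ _) vr).
    by rewrite ltr_norml => /andP[h _]; lra.
  have [r Hr] := choice cont.
  pose C := \sum_j \sum_(A : {set 'I_n}) #|A|%:R * rnorm (wft (f j) A).
  (* A sum over the finite cube dominates each [C / r e], so that one [N] serves all points at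
     once. *)
  pose K := \sum_(e : cube n) C / r e.
  have C0 : 0 <= C by apply: sumr_ge0 => j _; apply: sumr_ge0 => A _;
    rewrite mulr_ge0 ?rnorm_ge0.
  pose N := (Num.bound K).+1.
  have N0 : (0 < N)%N by [].
  have KN e : C / N%:R < r e.
    have re := (Hr e).1; rewrite ltr_pdivrMr// mulrC -ltr_pdivrMr//.
    apply: (@le_lt_trans _ _ K).
      rewrite /K (bigD1 e)//= lerDl sumr_ge0// => e' _.
      by rewrite divr_ge0// ltW// (Hr e').1.
    have K0 : 0 <= K by apply: sumr_ge0 => e' _; rewrite divr_ge0// ltW// (Hr e').1.
    by rewrite (lt_trans (archi_boundP K0))// ltr_nat.
  apply: (@le_trans _ _ (\sum_e (rnorm (\sum_u ckernel N 1 e u *: x u) `^ p + d))).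
    apply: ler_sum => e _; apply: (Hr e).2; apply: le_lt_trans (KN e).
    apply: le_trans (quad_kernel_approx f e N0).
    rewrite le_eqVlt; apply/orP; left; apply/eqP; congr (rnorm (_ - _)).
    by apply: eq_bigr => u _; rewrite ckernel1.
  rewrite big_split /= sumr_const mulr_natl lerD2r; exact: ckernel_interpolated.
rewrite /cube_mean; under [in leRHS]eq_bigr => e _.
  under eq_bigr do rewrite xE.
  over.
rewrite -(mulr_sumr _ _ _ (2 ^+ n)^-1) (pair_bigA _ (fun e d => rnorm (x (e, d)) `^
  p)) /=.
have -> : \sum_(u : cube n * cube n) rnorm (x (u.1, u.2)) `^ p = \sum_u rnorm (x u) `^
  p.
  by apply: eq_bigr => -[].
have n2 : 0 <= (2 ^+ n)^-1 :> R by rewrite invr_ge0 exprn_ge0.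
have S0 : 0 <= \sum_u rnorm (x u) `^ p by apply: sumr_ge0 => u _; exact: powR_ge0.
have T0 : 0 <= \sum_e rnorm (y e) `^ p by apply: sumr_ge0 => u _; exact: powR_ge0.
have -> : D = (D `^ p) `^ p^-1 by rewrite -powRrM divff ?gt_eqF// powRr1// ltW.
rewrite -powRM ?powR_ge0 ?mulr_ge0//.
rewrite ge0_ler_powR ?nnegrE ?invr_ge0 ?(ltW p0) ?mulr_ge0 ?powR_ge0//.
by rewrite mulrCA ler_wpM2l.
Qed.

End interpolated_operator.

Theorem theorem1p6 (R : realType) (X Y H : completeNormedModType R[i])
  (hH : is_hilbert H) (c : compatible_couple H Y) (theta : R)
  (theta_gt0 : 0 < theta) (theta_lt1 : theta < 1)
  (hX : is_interpolation c theta X)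
  (p : R) (p_gt1 : 1 < p) :
  (pisier_const X p <= (2 * Num.max p (p / (p - 1)) / (1 - theta))%:E)%E.
Proof.
have [iota [_ iota_range iota_norm]] := hX.
have th01 : 0 < theta < 1 by rewrite theta_gt0.
apply: ge_ereal_sup => _ [n _ <-]; apply: ereal_inf_lbound.
exists (2 * Num.max p (p / (p - 1)) / (1 - theta)) => //; split.
  exact: pisier_bound_gt0.
exact: (pisier_ineq_interpolated hH th01 p_gt1 iota_range iota_norm).
Qed.
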